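(* Let $H$ be a real or complex infinite dimensional separable Hilbert space and let $V\subset H$ be a closed subspace. Then $\mathrm{Gr_c}(V,H)$ is an analytic Banach manifold: the maps \[ B_1(W)\cap \mathrm{Gr_c}(V,H)\to \mathrm{L_c}(W,W^{\perp}),\qquad Y\mapsto P_{W^{\perp}}(P_W|_Y)^{-1},\qquad W\in \mathrm{Gr_c}(V,H), \] are homeomorphisms and form an analytic atlas. If $V$ has infinite dimension and infinite codimension, then $\mathrm{Gr_c}(V,H)$ is a $C^0$-submanifold of $\mathrm{Gr}(H)$, but it is not a $C^1$-submanifold of $\mathrm{Gr}(H)$.
   Context: $P_W$ is the orthogonal projection onto the closed subspace $W$. $\mathrm{Gr}(H)$ is the set of closed linear subspaces of $H$ with the metric $\mathrm{dist}(V,W)=\|P_V-P_W\|$; $B_1(W)$ is its open unit ball centered at $W$. $\mathrm{Gr}(H)$ is an analytic Banach manifold with atlas given by the homeomorphisms $B_1(W)\to \mathrm{L}(W,W^{\perp})$, $Y\mapsto P_{W^{\perp}}(P_W|_Y)^{-1}$, $W\in\mathrm{Gr}(H)$, whose inverses are $A\mapsto \mathrm{graph}\,A$. Here $\mathrm{L}$ and $\mathrm{L_c}$ denote the Banach spaces of bounded, respectively compact, linear operators. $\mathrm{Gr_c}(V,H)\subset\mathrm{Gr}(H)$ is the set of closed subspaces $W$ such that $P_W-P_V$ is compact, with the induced topology. A subset $M$ of a Banach manifold $N$ is a $C^k$-submanifold if near each of its points there is a local chart of $N$ (a homeomorphism onto an open set of a Banach space $E\times F$ if $k=0$, a $C^1$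 diffeomorphism if $k=1$) carrying $M$ to the intersection of that open set with $E\times\{0\}$. *)

(* Defs.v *)
From HB Require Import structures.
From mathcomp Require Import all_boot all_order all_algebra.
From mathcomp Require Import sesquilinear complex.
From mathcomp Require Import all_classical all_reals topology normedtype derive.

Set Implicit Arguments.
Unset Strict Implicit.
Unset Printing Implicit Defensive.

Import Order.TTheory GRing.Theory Num.Theory.
Import numFieldNormedType.Exports.

Local Open Scope classical_set_scope.
Local Open Scope ring_scope.

Inductive scalar_kind := RealScalars | ComplexScalars.

Definition scalars (R : realType) (k : scalar_kind) : numFieldType :=
  match k with RealScalars => R | ComplexScalars => R[i]%C end.

Section Scalars.
Context {R : realType} {k : scalar_kind}.
Local Notation K := (scalars R k).

Definition sconj : K -> K :=
  match k with RealScalars => idfun | ComplexScalars => @conjc R end.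

Definition sre : K -> R :=
  match k with RealScalars => idfun | ComplexScalars => @complex.Re R end.

Definition sofr : R -> K :=
  match k with RealScalars => idfun | ComplexScalars => fun x => (x%:C)%C end.

Lemma sofrK : cancel sofr sre.
Proof. by rewrite /sofr /sre; case: k. Qed.

Lemma sofrD a b : sofr (a + b) = sofr a + sofr b.
Proof. by rewrite /sofr; case: k => //=; rewrite raddfD. Qed.

Lemma sofrM a b : sofr (a * b) = sofr a * sofr b.
Proof. by rewrite /sofr; case: k => //=; rewrite rmorphM. Qed.

Lemma sofr1 : sofr 1 = 1.
Proof. by rewrite /sofr; case: k. Qed.

Lemma sofr0 : sofr 0 = 0.
Proof. by rewrite /sofr; case: k. Qed.

Lemma ler_sofr a b : (sofr a <= sofr b) = (a <= b).
Proof. by rewrite /sofr; case: k => //=; rewrite lecR. Qed.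

Lemma sofr_norm a : `|sofr a| = sofr `|a|.
Proof.
rewrite /sofr; case: k => //=.
by rewrite normc_def/= expr0n/= addr0 sqrtr_sqr.
Qed.

Lemma sofr_sre (x : K) : 0 <= x -> sofr (sre x) = x.
Proof.
rewrite /sofr /sre; move: x; rewrite /scalars; case: k => //= -[a b].
by rewrite lecE/= => /andP[/eqP -> _].
Qed.

Lemma ler_sre (x y : K) : x <= y -> sre x <= sre y.
Proof.
rewrite /sre; move: x y; rewrite /scalars; case: k => //= -[a b] [c d].
by rewrite lecE/= => /andP[].
Qed.

Lemma sreD (x y : K) : sre (x + y) = sre x + sre y.
Proof.
rewrite /sre; move: x y; rewrite /scalars; case: k => //= -[a b] [c d].
by [].
Qed.

Lemma sreM (x y : K) : 0 <= x -> 0 <= y -> sre (x * y) = sre x * sre y.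
Proof.
by move=> x0 y0; rewrite -[in LHS](sofr_sre x0) -[in LHS](sofr_sre y0)
  -sofrM sofrK.
Qed.

Lemma sconj0 : sconj 0 = 0.
Proof. by rewrite /sconj; case: k => //; exact: (rmorph0 (@conjc R)). Qed.

End Scalars.

(** The norm of a space over [scalars R k] takes its values in [scalars R k];
    [rnorm] is the same norm with values in [R]. *)
Section RNorm.
Context {R : realType} {k : scalar_kind} {E : normedModType (scalars R k)}.

Definition rnorm (x : E) : R := sre `|x|.

Lemma sofr_rnorm x : sofr (rnorm x) = `|x|.
Proof. exact: sofr_sre. Qed.

Lemma rnorm_ge0 x : 0 <= rnorm x.
Proof. by rewrite -(ler_sofr (k := k)) sofr0 sofr_rnorm. Qed.

Lemma rnormD x y : rnorm (x + y) <= rnorm x + rnorm y.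
Proof. by rewrite -(ler_sofr (k := k)) sofrD !sofr_rnorm ler_normD. Qed.

Lemma rnormZ a x : rnorm (a *: x) = sre `|a| * rnorm x.
Proof. by rewrite /rnorm normrZ sreM. Qed.

Lemma rnormN x : rnorm (- x) = rnorm x.
Proof. by rewrite /rnorm normrN. Qed.

Lemma rnorm0 : rnorm 0 = 0.
Proof. by rewrite /rnorm normr0 -[0 in LHS](sofr0 (k := k)) sofrK. Qed.

Lemma rnorm0_eq0 x : rnorm x = 0 -> x = 0.
Proof. by move=> x0; apply/normr0_eq0; rewrite -sofr_rnorm x0 sofr0. Qed.

Lemma rnorm_le1 x : (`|x| <= 1) = (rnorm x <= 1).
Proof. by rewrite -sofr_rnorm -(sofr1 (k := k)) ler_sofr. Qed.

End RNorm.

(** A real or complex normed space seen as a real one. *)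
Definition realify (R : realType) (k : scalar_kind)
  (E : normedModType (scalars R k)) : Type := E.

Section Realify.
Context {R : realType} {k : scalar_kind} (E : normedModType (scalars R k)).
Local Notation ER := (realify E).

HB.instance Definition _ := GRing.Zmodule.copy ER E.

Let rscale (a : R) (x : ER) : ER := sofr (k := k) a *: (x : E).

Let rscaleA a b v : rscale a (rscale b v) = rscale (a * b) v.
Proof. by rewrite /rscale sofrM scalerA. Qed.
Let rscale1 : left_id 1 rscale.
Proof. by move=> v; rewrite /rscale sofr1 scale1r. Qed.
Let rscaleDr : right_distributive rscale +%R.
Proof. by move=> a u v; rewrite /rscale scalerDr. Qed.
Let rscaleDl v : {morph rscale^~ v : a b / a + b}.
Proof. by move=> a b; rewrite /rscale sofrD scalerDl. Qed.

HB.instance Definition _ := GRing.Zmodule_isLmodule.Build R ER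
  rscaleA rscale1 rscaleDr rscaleDl.

Let rnormZr (a : R) (x : ER) : rnorm (a *: x : E) = `|a| * rnorm (x : E).
Proof.
rewrite [a *: x]/(sofr (k := k) a *: (x : E)) rnormZ sofr_norm.
by rewrite sofrK.
Qed.

HB.instance Definition _ := Lmodule_isNormed.Build R ER
  (@rnormD R k E) rnormZr (@rnorm0_eq0 R k E).

End Realify.

HB.mixin Record CompleteNormedModule_isHilbert (R : realType) (k : scalar_kind) H
    of CompleteNormedModule (scalars R k) H := {
  inner : {dot H for @sconj R k};
  inner_norm : forall x : H, inner x x = `|x| ^+ 2 }.

#[short(type="hilbertType")]
HB.structure Definition Hilbert (R : realType) (k : scalar_kind) :=
  {H of CompleteNormedModule (scalars R k) H &
        CompleteNormedModule_isHilbert R k H}.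

Definition separable_space (T : topologicalType) :=
  exists2 D : set T, countable D & dense D.

Section Operators.
Context {R : realType} {k : scalar_kind}.
Local Notation K := (scalars R k).

Definition unit_ball (E : normedModType K) : set E := [set x | `|x| <= 1].

Definition opnorm (E F : normedModType K) (f : E -> F) : R :=
  sup [set rnorm (f x) | x in @unit_ball E].

Definition bounded_linear (E F : normedModType K) (f : E -> F) : Prop :=
  linear f /\ exists C : K, forall x, `|f x| <= C * `|x|.

Definition compact_map (E F : normedModType K) (f : E -> F) : Prop :=
  precompact (f @` @unit_ball E).

Section OpNormTheory.
Context {E F : normedModType K}.
Implicit Types f g : E -> F.

Definition ball_bounded f :=
  exists C, forall x, unit_ball x -> rnorm (f x) <= C.

Lemma unit_ball0 : unit_ball (0 : E).
Proof. by rewrite /unit_ball/= normr0. Qed.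

Lemma opnorm_ub f x : ball_bounded f -> unit_ball x -> rnorm (f x) <= opnorm f.
Proof.
move=> [C fC] Ex; apply: ub_le_sup; last by exists x.
by exists C => _ [y Ey <-]; exact: fC.
Qed.

Lemma opnorm_le f C : (forall x, unit_ball x -> rnorm (f x) <= C) ->
  opnorm f <= C.
Proof.
move=> fC; apply: ge_sup; last by move=> _ [y Ey <-]; exact: fC.
by exists (rnorm (f 0)), 0 => //; exact: unit_ball0.
Qed.

Lemma ball_boundedD f g :
  ball_bounded f -> ball_bounded g -> ball_bounded (f \+ g).
Proof.
move=> [C fC] [D gD]; exists (C + D) => x Ex.
by rewrite (le_trans (rnormD _ _))// lerD ?fC ?gD.
Qed.

Lemma opnormD f g : ball_bounded f -> ball_bounded g ->
  opnorm (f \+ g) <= opnorm f + opnorm g.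
Proof.
move=> fb gb; apply: opnorm_le => x Ex.
by rewrite (le_trans (rnormD _ _))// lerD ?opnorm_ub.
Qed.

Lemma opnorm0 : opnorm (fun _ : E => 0 : F) = 0.
Proof.
apply/eqP; rewrite eq_le; apply/andP; split.
  by apply: opnorm_le => x _; rewrite rnorm0.
rewrite -[leLHS](rnorm0 (E := F)).
by apply: (@opnorm_ub (fun _ : E => 0 : F) 0); [exists 0 => x _; rewrite rnorm0|exact: unit_ball0].
Qed.

Lemma opnormZ_le f (a : K) : ball_bounded f ->
  opnorm (fun x => a *: f x) <= sre `|a| * opnorm f.
Proof.
move=> fb; apply: opnorm_le => x Ex; rewrite rnormZ ler_wpM2l//.
  by rewrite -(ler_sofr (k := k)) sofr0 sofr_sre.
exact: opnorm_ub.
Qed.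

Lemma ball_boundedZ f (a : K) : ball_bounded f -> ball_bounded (fun x => a *: f x).
Proof.
move=> [C fC]; exists (sre `|a| * C) => x Ex; rewrite rnormZ ler_wpM2l ?fC//.
by rewrite -(ler_sofr (k := k)) sofr0 sofr_sre.
Qed.

Lemma opnormZ f (a : K) : ball_bounded f ->
  opnorm (fun x => a *: f x) = sre `|a| * opnorm f.
Proof.
move=> fb; apply/eqP; rewrite eq_le opnormZ_le//=.
have [->|a0] := eqVneq a 0.
  rewrite normr0 -[X in sre X](sofr0 (k := k)) sofrK mul0r.
  rewrite (_ : (fun x => 0 *: f x) = (fun=> 0)) ?opnorm0//.
  by apply/funext => x; rewrite scale0r.
have b0 : 0 < sre `|a|.
  rewrite lt_neqAle; apply/andP; split.
    apply: contra_neq a0 => a0; apply: normr0_eq0.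
    by rewrite -(sofr_sre (normr_ge0 a)) -a0 sofr0.
  by rewrite -(ler_sofr (k := k)) sofr0 sofr_sre.
rewrite -ler_pdivlMl//.
rewrite [X in opnorm X <= _](_ : f = (fun x => a^-1 *: (a *: f x))); last first.
  by apply/funext => x; rewrite scalerA mulVf// scale1r.
rewrite (le_trans (opnormZ_le _ (ball_boundedZ _ fb)))//.
rewrite normrV ?unitfE//.
suff -> : sre `|a|^-1 = (sre `|a|)^-1 by [].
apply: (mulfI (lt0r_neq0 b0)); rewrite divff ?lt0r_neq0// -sreM ?invr_ge0//.
by rewrite divff ?normr_eq0// -(sofr1 (k := k)) sofrK.
Qed.

Lemma bounded_linear_ball f : bounded_linear f -> ball_bounded f.
Proof.
move=> [_ [C fC]]; exists (sre `|C|) => x Ex.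
rewrite -(ler_sofr (k := k)) sofr_rnorm sofr_sre//.
have := fC x; have [x0|x0] := eqVneq `|x| 0.
  by rewrite x0 mulr0 => /le_trans -> //.
have xgt0 : 0 < `|x| by rewrite lt_neqAle eq_sym x0 normr_ge0.
move=> fx.
have C0 : 0 <= C.
  have := le_trans (normr_ge0 (f x)) fx.
  by rewrite pmulr_lge0.
by rewrite (le_trans fx)// ger0_norm// ler_piMr.
Qed.

Lemma bounded_linear0 : bounded_linear (fun _ : E => 0 : F).
Proof.
split; first by move=> a x y; rewrite scaler0 addr0.
by exists 0 => x; rewrite normr0 mul0r.
Qed.

Lemma bounded_linearP (a : K) f g : bounded_linear f -> bounded_linear g ->
  bounded_linear (fun x => a *: f x + g x).
Proof.
move=> [lf [C fC]] [lg [D gD]]; split.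
  by move=> b x y; rewrite lf lg !scalerDr !scalerA mulrC addrACA.
exists (`|a| * C + D) => x; rewrite (le_trans (ler_normD _ _))//.
by rewrite mulrDl -mulrA normrZ lerD// ler_wpM2l.
Qed.

Lemma compact_map0 : compact_map (fun _ : E => 0 : F).
Proof.
apply: (@precompact_subset _ _ [set 0]); first by move=> _ [x _ <-].
by apply: compact_precompact; [exact: norm_hausdorff|exact: compact_set1].
Qed.

Lemma compact_mapP (a : K) f g : compact_map f -> compact_map g ->
  compact_map (fun x => a *: f x + g x).
Proof.
rewrite /compact_map [in X in X -> _]precompactE.
rewrite [in X in _ -> X -> _]precompactE => cf cg.
apply: (@precompact_subset _ _ ((fun z : F * F => a *: z.1 + z.2) @`
   (closure (f @` @unit_ball E) `*` closure (g @` @unit_ball E)))).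
  move=> _ [x Ex <-]; exists (f x, g x) => //.
  by split; apply: subset_closure; exists x.
apply: compact_precompact; first exact: norm_hausdorff.
apply: continuous_compact; last exact: compact_setX.
apply: continuous_subspaceT => z.
apply: cvgD; last exact: cvg_snd.
by apply: cvgZr; exact: cvg_fst.
Qed.

End OpNormTheory.

Section Lb.
Variables E F : normedModType K.

(** [Lb E F] and [Lc E F]: the spaces of bounded, respectively compact, linear
    operators from [E] to [F], with the operator norm. *)
Definition Lb_pred : {pred E -> F} := fun f => `[< bounded_linear f >].
Definition Lc_pred : {pred E -> F} :=
  fun f => `[< bounded_linear f /\ compact_map f >].

Record Lb := MkLb { Lb_fun :> E -> F ; Lb_prop : Lb_fun \in Lb_pred }.
Record Lc := MkLc { Lc_fun :> E -> F ; Lc_prop : Lc_fun \in Lc_pred }.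

Let Lb_submod : submod_closed Lb_pred.
Proof.
split; first exact/asboolP/bounded_linear0.
by move=> a f g /asboolP fb /asboolP gb; exact/asboolP/bounded_linearP.
Qed.

Let Lc_submod : submod_closed Lc_pred.
Proof.
split; first by apply/asboolP; split; [exact: bounded_linear0|exact: compact_map0].
move=> a f g /asboolP[fb fc] /asboolP[gb gc]; apply/asboolP; split.
  exact: bounded_linearP.
exact: compact_mapP.
Qed.

HB.instance Definition _ := GRing.isSubmodClosed.Build K (E -> F) Lb_pred Lb_submod.
HB.instance Definition _ := GRing.isSubmodClosed.Build K (E -> F) Lc_pred Lc_submod.

HB.instance Definition _ := [isSub for Lb_fun].
HB.instance Definition _ := [Choice of Lb by <:].
HB.instance Definition _ := [SubChoice_isSubLmodule of Lb by <:].

HB.instance Definition _ := [isSub for Lc_fun].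
HB.instance Definition _ := [Choice of Lc by <:].
HB.instance Definition _ := [SubChoice_isSubLmodule of Lc by <:].

Lemma Lb_bounded (f : Lb) : bounded_linear f.
Proof. exact/asboolP/(Lb_prop f). Qed.

Lemma Lc_bounded (f : Lc) : bounded_linear f.
Proof. by have /asboolP[] := Lc_prop f. Qed.

Lemma Lc_compact (f : Lc) : compact_map f.
Proof. by have /asboolP[] := Lc_prop f. Qed.

Let opnorm_eq0 (f : E -> F) : bounded_linear f -> opnorm f = 0 -> f = fun=> 0.
Proof.
move=> fb f0; apply/funext => x.
have fz0 : f 0 = 0.
  by have := fb.1 (-1) 0 0; rewrite scaler0 addr0 scaleN1r addNr.
have [->//|x0] := eqVneq x 0.
have nx0 : `|x| != 0 by rewrite normr_eq0.
have fZ (a : K) y : f (a *: y) = a *: f y.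
  by have := fb.1 a y 0; rewrite !addr0 fz0 addr0.
have : rnorm (f (`|x|^-1 *: x)) <= 0.
  rewrite -f0; apply: opnorm_ub; first exact: bounded_linear_ball.
  by rewrite /unit_ball/= normrZ normfV normr_id mulVf.
rewrite le_eqVlt ltNge rnorm_ge0 orbF => /eqP/rnorm0_eq0.
rewrite fZ => /eqP; rewrite scaler_eq0 invr_eq0 (negbTE nx0)/=.
by move/eqP.
Qed.

Let Lb_norm (f : Lb) : K := sofr (opnorm (f : E -> F)).
Let Lc_norm (f : Lc) : K := sofr (opnorm (f : E -> F)).

Let Lb_normD f g : Lb_norm (f + g) <= Lb_norm f + Lb_norm g.
Proof.
rewrite /Lb_norm -sofrD ler_sofr.
by apply: opnormD; apply: bounded_linear_ball; exact: Lb_bounded.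
Qed.

Let Lb_normZ (a : K) f : Lb_norm (a *: f) = `|a| * Lb_norm f.
Proof.
rewrite /Lb_norm -[X in X * _](sofr_sre (normr_ge0 a)) -sofrM -opnormZ//.
by apply: bounded_linear_ball; exact: Lb_bounded.
Qed.

Let Lb_norm0 f : Lb_norm f = 0 -> f = 0.
Proof.
move=> /(congr1 sre); rewrite sofrK -[X in sre X](sofr0 (k := k)) sofrK => f0.
apply/val_inj; exact: (opnorm_eq0 (Lb_bounded f)).
Qed.

HB.instance Definition _ :=
  Lmodule_isNormed.Build K Lb Lb_normD Lb_normZ Lb_norm0.

Let Lc_normD f g : Lc_norm (f + g) <= Lc_norm f + Lc_norm g.
Proof.
rewrite /Lc_norm -sofrD ler_sofr.
by apply: opnormD; apply: bounded_linear_ball; exact: Lc_bounded.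
Qed.

Let Lc_normZ (a : K) f : Lc_norm (a *: f) = `|a| * Lc_norm f.
Proof.
rewrite /Lc_norm -[X in X * _](sofr_sre (normr_ge0 a)) -sofrM -opnormZ//.
by apply: bounded_linear_ball; exact: Lc_bounded.
Qed.

Let Lc_norm0 f : Lc_norm f = 0 -> f = 0.
Proof.
move=> /(congr1 sre); rewrite sofrK -[X in sre X](sofr0 (k := k)) sofrK => f0.
apply/val_inj; exact: (opnorm_eq0 (Lc_bounded f)).
Qed.

HB.instance Definition _ :=
  Lmodule_isNormed.Build K Lc Lc_normD Lc_normZ Lc_norm0.

End Lb.
End Operators.

Section InnerTheory.
Context {R : realType} {k : scalar_kind} {H : hilbertType R k}.
Implicit Types x y z : H.

Lemma innerC x y : inner x y = sconj (inner y x).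
Proof.
have := @hermitian_subproof _ _ _ _ (@inner R k H) x y.
by rewrite expr0 mul1r.
Qed.

Lemma innerP (a : scalars R k) x y z :
  inner (a *: x + y) z = a * inner x z + inner y z.
Proof. exact: (linearPl (inner : {bilinear H -> H -> _ | *%R & _})). Qed.

Lemma inner0l x : inner 0 x = 0.
Proof. by have := innerP (-1) 0 0 x; rewrite scaler0 addr0 mulN1r addNr. Qed.

Lemma innerDl x y z : inner (x + y) z = inner x z + inner y z.
Proof. by rewrite -[x]scale1r innerP mul1r scale1r. Qed.

Lemma innerZl (a : scalars R k) x z : inner (a *: x) z = a * inner x z.
Proof. by rewrite -[a *: x]addr0 innerP inner0l addr0. Qed.

Lemma inner_eq0C x y : inner x y = 0 -> inner y x = 0.
Proof. by move=> xy; rewrite innerC xy sconj0. Qed.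

Lemma inner_eq0 x : inner x x = 0 -> x = 0.
Proof. by rewrite inner_norm => /eqP; rewrite sqrf_eq0 normr_eq0 => /eqP. Qed.

Lemma pythagoras x y : inner x y = 0 -> `|x + y| ^+ 2 = `|x| ^+ 2 + `|y| ^+ 2.
Proof.
move=> xy; have yx := inner_eq0C xy.
rewrite -!inner_norm innerDl innerC innerDl yx addr0 -innerC.
by rewrite (innerC y) innerDl xy add0r -innerC.
Qed.

Lemma cauchy_schwarz x y : `|inner x y| <= `|x| * `|y|.
Proof.
have [->|y0] := eqVneq y 0; first by rewrite innerC inner0l sconj0 !normr0 mulr0.
have ny0 : 0 < `|y| by rewrite normr_gt0.
pose t := inner x y / `|y| ^+ 2; pose z := x - t *: y.
have zy : inner z (t *: y) = 0.
  apply: inner_eq0C; rewrite innerZl; apply/eqP; rewrite mulf_eq0; apply/orP; right.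
  apply/eqP; apply: inner_eq0C.
  rewrite /z -scaleNr addrC innerP inner_norm /t mulNr divfK ?addNr//.
  by rewrite expf_neq0// lt0r_neq0.
have := pythagoras zy; rewrite /z subrK => xE.
have : `|t *: y| ^+ 2 <= `|x| ^+ 2 by rewrite xE lerDr exprn_ge0.
rewrite ler_sqr ?nnegrE// normrZ normrM normfV normrX normr_id.
by rewrite expr2 invfM mulrA divfK ?lt0r_neq0// ler_pdivrMr.
Qed.

End InnerTheory.

Record Gr (R : realType) (k : scalar_kind) (H : hilbertType R k) := MkGr {
  Gr_set :> H -> Prop;
  Gr_submod : submod_closed [pred x | x \in (Gr_set : set H)];
  Gr_closed : closed Gr_set }.

HB.instance Definition _ R k (H : hilbertType R k) := gen_eqMixin (Gr H).
HB.instance Definition _ R k (H : hilbertType R k) := gen_choiceMixin (Gr H).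

Section Subspaces.
Context {R : realType} {k : scalar_kind} {H : hilbertType R k}.
Local Notation K := (scalars R k).

Definition Gr_pred (W : Gr H) : {pred H} := [pred x | x \in (Gr_set W : set H)].

(** The subspace [W] as a normed space in its own right. *)
Record subsp (W : Gr H) := MkSubsp {
  subsp_val :> H; subsp_prop : subsp_val \in Gr_pred W }.

HB.instance Definition _ W :=
  GRing.isSubmodClosed.Build K H (Gr_pred W) (Gr_submod W).
HB.instance Definition _ W := [isSub for @subsp_val W].
HB.instance Definition _ W := [Choice of subsp W by <:].
HB.instance Definition _ W := [SubChoice_isSubLmodule of subsp W by <:].

Section SubspNorm.
Variable W : Gr H.

Let subsp_norm (x : subsp W) : K := `|val x|.

Let subsp_normD x y : subsp_norm (x + y) <= subsp_norm x + subsp_norm y.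
Proof. exact: ler_normD. Qed.

Let subsp_normZ (a : K) x : subsp_norm (a *: x) = `|a| * subsp_norm x.
Proof. exact: normrZ. Qed.

Let subsp_norm0 x : subsp_norm x = 0 -> x = 0.
Proof. by move=> /normr0_eq0 x0; exact/val_inj. Qed.

HB.instance Definition _ :=
  Lmodule_isNormed.Build K (subsp W) subsp_normD subsp_normZ subsp_norm0.

End SubspNorm.

Implicit Types V W Y : Gr H.

Lemma Gr0 W : W 0.
Proof. by have [/set_mem] := Gr_submod W. Qed.

Lemma GrP W a x y : W x -> W y -> W (a *: x + y).
Proof.
move=> Wx Wy; have [_ /(_ a x y) WP] := Gr_submod W.
by apply: set_mem; apply: WP; exact: mem_set.
Qed.

Lemma GrZ W a x : W x -> W (a *: x).
Proof. by move=> Wx; rewrite -[a *: x]addr0; apply: GrP => //; exact: Gr0. Qed.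

Lemma GrD W x y : W x -> W y -> W (x + y).
Proof. by move=> Wx Wy; rewrite -[x]scale1r; exact: GrP. Qed.

Lemma GrB W x y : W x -> W y -> W (x - y).
Proof. by move=> Wx Wy; rewrite addrC -scaleN1r; exact: GrP. Qed.

Definition orth_set W : set H := [set x | forall w, W w -> inner x w = 0].

Lemma orth_submod W : submod_closed [pred x | x \in orth_set W].
Proof.
split; first by apply: mem_set => w _; rewrite inner0l.
move=> a x y /set_mem Wx /set_mem Wy; apply: mem_set => w Ww.
by rewrite innerP Wx// Wy// mulr0 addr0.
Qed.

Lemma orth_closed W : closed (orth_set W).
Proof.
move=> x clx w Ww; apply/eqP; apply/negPn/negP => xw.
have c0 : 0 < `|inner x w| by rewrite normr_gt0.
have w0 : 0 < `|w| + 1 by rewrite ltr_wpDl.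
have [|y [Wy]] := clx (ball x (`|inner x w| / (`|w| + 1))).
  by apply: nbhsx_ballx; rewrite divr_gt0.
rewrite -ball_normE/= ltr_pdivlMr// => xy.
have : `|inner x w| < `|inner x w|.
  apply: le_lt_trans xy.
  have {1}-> : inner x w = inner (x - y) w.
    by rewrite innerDl -scaleN1r innerZl (Wy _ Ww) mulr0 addr0.
  by rewrite (le_trans (cauchy_schwarz _ _))// ler_wpM2l// lerDl.
by rewrite ltxx.
Qed.

Definition orth W : Gr H := MkGr (orth_submod W) (@orth_closed W).

(** The orthogonal projection onto [W]: [orthproj W x] is the point [y] of [W] such
    that [x - y] is orthogonal to [W]; as [H] is complete, it always exists, and
    the default value [0] is never used. *)
Definition orthproj W (x : H) : H :=
  xget 0 [set y | W y /\ orth W (x - y)].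

Lemma proj_in W x : W (orthproj W x).
Proof. by rewrite /orthproj; case: xgetP => [y _ []//|_]; exact: Gr0. Qed.

Lemma proj_id W x : W x -> orthproj W x = x.
Proof.
move=> Wx; apply: xget_unique.
  by split=> // w _; rewrite subrr inner0l.
move=> y [Wy /(_ (x - y) (GrB Wx Wy))] /inner_eq0 /eqP.
by rewrite subr_eq0 => /eqP.
Qed.

Lemma ler_proj W x : rnorm (orthproj W x) <= rnorm x.
Proof.
rewrite -(ler_sofr (k := k)) !sofr_rnorm /orthproj.
case: xgetP => [y _ [Wy /(_ _ Wy) xy]|_]; last by rewrite normr0.
rewrite -ler_sqr ?nnegrE//.
by rewrite -(subrK y x) (pythagoras xy) lerDr exprn_ge0.
Qed.

Definition gr_dist V W : R := opnorm (fun x => orthproj V x - orthproj W x).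

Lemma ball_bounded_projB V W : ball_bounded (fun x => orthproj V x - orthproj W x).
Proof.
exists 2 => x; rewrite /unit_ball/= rnorm_le1 => x1.
rewrite (le_trans (rnormD _ _))// rnormN (_ : 2 = 1 + 1)//.
by rewrite lerD// (le_trans (ler_proj _ _)).
Qed.

Let gr_distxx V : gr_dist V V = 0.
Proof.
rewrite /gr_dist (_ : (fun _ => _) = fun _ : H => 0 : H) ?opnorm0//.
by apply/funext => x; rewrite subrr.
Qed.

Let gr_dist_sub V W : gr_dist V W = 0 -> V `<=` W.
Proof.
move=> VW x Vx; have [->|x0] := eqVneq x 0; first exact: Gr0.
have nx0 : `|x| != 0 by rewrite normr_eq0.
pose y : H := `|x|^-1 *: x.
have y1 : unit_ball y by rewrite /unit_ball/= normrZ normfV normr_id mulVf.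
have : rnorm (orthproj V y - orthproj W y) <= 0.
  by rewrite -VW; exact: (opnorm_ub (ball_bounded_projB V W)).
rewrite le_eqVlt ltNge rnorm_ge0 orbF => /eqP/rnorm0_eq0/eqP.
rewrite subr_eq0 proj_id => [/eqP yE|]; last exact: GrZ.
have Wy : W y by rewrite yE; exact: proj_in.
have -> : x = `|x| *: y by rewrite /y scalerA mulfV// scale1r.
exact: GrZ.
Qed.

Let gr_dist_sym V W : gr_dist V W = gr_dist W V.
Proof.
rewrite /gr_dist /opnorm; congr sup; apply/seteqP.
by split=> _ [x Hx <-]; exists x => //; rewrite -rnormN opprB.
Qed.

Let gr_dist_eq0 V W : gr_dist V W = 0 -> V = W.
Proof.
move=> VW; have : Gr_set V = Gr_set W.
  by apply/seteqP; split; apply: gr_dist_sub => //; rewrite gr_dist_sym.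
case: V W {VW} => [A Al Ac] [B Bl Bc] /= AB; subst B.
by rewrite (Prop_irrelevance Al Bl) (Prop_irrelevance Ac Bc).
Qed.

Let gr_dist_triangle Y V W : gr_dist V W <= gr_dist V Y + gr_dist Y W.
Proof.
rewrite (le_trans _ (opnormD (ball_bounded_projB V Y) (ball_bounded_projB Y W)))//.
rewrite le_eqVlt; apply/orP; left; apply/eqP; congr opnorm.
by apply/funext => x /=; rewrite addrA subrK.
Qed.

HB.instance Definition _ := isMetric.Build R (Gr H)
  gr_distxx gr_dist_eq0 gr_dist_sym gr_dist_triangle.

Definition Grc (V : Gr H) : set (Gr H) :=
  [set W | compact_map (fun x => orthproj W x - orthproj V x)].

Lemma orthprojS_subproof W x : orthproj W x \in Gr_pred W.
Proof. by apply: mem_set; exact: proj_in. Qed.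

(** [orthproj W], with values in the space [subsp W]. *)
Definition orthprojS W x : subsp W := MkSubsp (orthprojS_subproof W x).

(** The map [P_{W^\perp} (P_W|_Y)^{-1}]: [xget] picks the preimage of [w] under
    [P_W|_Y], which is unique when [P_W|_Y] is injective. *)
Definition graph_map W Y (w : subsp W) : subsp (orth W) :=
  orthprojS (orth W) (xget 0 [set y | Y y /\ orthprojS W y = w]).

Arguments graph_map : clear implicits.

(** The chart centered at [W], with values in the space of bounded, respectively
    compact, operators; the default value [0] is only used outside of the domain
    of the chart. *)
Definition chart W Y : Lb (subsp W) (subsp (orth W)) :=
  insubd 0 (graph_map W Y).

Definition chartc W Y : Lc (subsp W) (subsp (orth W)) :=
  insubd 0 (graph_map W Y).

(** [finite_dim A] and [finite_codim A] are meant for linear subspaces [A]. *)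
Definition finite_dim (A : set H) : Prop :=
  exists s : seq H, forall x, A x ->
    exists c : 'I_(size s) -> K, x = \sum_i c i *: s`_i.

Definition finite_codim (A : set H) : Prop :=
  exists s : seq H, forall x, exists2 v, A v &
    exists c : 'I_(size s) -> K, x = v + \sum_i c i *: s`_i.

End Subspaces.

Arguments graph_map {R k H} W Y w.

Section Maps.

Definition multilinear (K : numFieldType) (E F : normedModType K) (n : nat)
    (a : ('I_n -> E) -> F) : Prop :=
  forall (i : 'I_n) (v : 'I_n -> E), linear (fun x => a [eta v with i |-> x]).

(** Near [x], [f] is the sum of a power series, whose [n]-th term is a bounded
    [n]-linear map evaluated on the diagonal, with a positive radius of
    convergence. *)
Definition analytic_at (K : numFieldType) (E F : normedModType K)
    (f : E -> F) (x : E) : Prop :=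
  exists (a : forall n, ('I_n -> E) -> F) (r C : K),
    [/\ 0 < r,
        forall n, multilinear (@a n),
        forall n v, `|a n v| * r ^+ n <= C * \prod_i `|v i|
      & forall h, `|h| < r ->
          (\sum_(0 <= n < N) a n (fun=> h)) @[N --> \oo] --> f (x + h)].

Definition analytic_on (K : numFieldType) (E F : normedModType K)
  (A : set E) (f : E -> F) : Prop := forall x, A x -> analytic_at f x.

(** On an open set; the differential is continuous for the operator norm. *)
Definition C1_on (R : realType) (E F : normedModType R)
    (A : set E) (f : E -> F) : Prop :=
  (forall x, A x -> differentiable f x) /\
  forall x, A x -> forall e : R, 0 < e ->
    \forall y \near x, forall h, `|'d f y h - 'd f x h| <= e * `|h|.

Definition homeo_on (X Y : topologicalType) (A : set X) (B : set Y)
    (f : X -> Y) : Prop :=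
  [/\ set_bij A B f, {within A, continuous f}
    & exists2 g : Y -> X, {in A, cancel f g} & {within B, continuous g}].

(** The transition map [psi \o phi^-1] from [phi @` U] has the property [P]. *)
Definition transition (X E F : Type) (P : set E -> (E -> F) -> Prop)
    (U : set X) (phi : X -> E) (psi : X -> F) : Prop :=
  exists2 tau : E -> F, P (phi @` U) tau & {in U, tau \o phi =1 psi}.

End Maps.

Definition banach (K : numFieldType) (E : normedModType K) : Prop :=
  forall F : set_system E, ProperFilter F -> cauchy F -> cvg F.

(** The maps [phi i] with domains [U i], for [i] in [I], form an analytic atlas of
    [M] with its topology of subspace of [X], modeled on Banach spaces. *)
Record analytic_atlas (K : numFieldType) (X : topologicalType) (M : set X)
    (T : Type) (I : set T) (E : T -> normedModType K)
    (U : T -> set X) (phi : forall i, X -> E i) : Prop := AnalyticAtlas {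
  atlas_banach : forall i, I i -> banach (E i);
  atlas_cover : M = \bigcup_(i in I) U i;
  atlas_domain : forall i, I i -> exists2 O, open O & U i = O `&` M;
  atlas_open : forall i, I i -> open (phi i @` U i);
  atlas_homeo : forall i, I i -> homeo_on (U i) (phi i @` U i) (phi i);
  atlas_analytic : forall i j, I i -> I j ->
    transition (@analytic_on K (E i) (E j)) (U i `&` U j) (phi i) (phi j) }.

Arguments analytic_atlas {K X} M {T} I E U phi.

(** [phi] is a homeomorphism from a neighborhood [U] of [x] onto an open subset of
    [E * F], and it carries [M] to the slice [E * {0}]. *)
Definition slice_chart (K : numFieldType) (X : topologicalType) (M : set X)
    (x : X) (E F : normedModType K) (U : set X) (phi : X -> E * F) : Prop :=
  [/\ open_nbhs x U, open (phi @` U), homeo_on U (phi @` U) phi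
    & phi @` (U `&` M) = phi @` U `&` [set z | z.2 = 0]].

(** [phi] is [C^1], and so is its inverse, with respect to the charts [psi i], with
    domains [D i], of a manifold [X]. *)
Definition C1_compatible (R : realType) (X T : Type) (G : T -> normedModType R)
    (D : T -> set X) (psi : forall i, X -> G i)
    (E : normedModType R) (U : set X) (phi : X -> E) : Prop :=
  forall i, transition (@C1_on R (G i) E) (U `&` D i) (psi i) phi /\
            transition (@C1_on R E (G i)) (U `&` D i) phi (psi i).

Section Submanifolds.
Context {R : realType} {k : scalar_kind} {H : hilbertType R k}.

Definition C0_submanifold (M : set (Gr H)) : Prop :=
  forall W, M W ->
    exists (E F : completeNormedModType (scalars R k)) (U : set (Gr H))
      (phi : Gr H -> E * F), slice_chart M W U phi.

(** Differentiability is over the reals, and [E] and [F] are real Banach spaces,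
    also when [H] is complex: a complex chart that is holomorphic is in particular
    a chart in this sense. *)
Definition C1_submanifold (M : set (Gr H)) : Prop :=
  forall W, M W ->
    exists (E F : completeNormedModType R) (U : set (Gr H))
      (phi : Gr H -> E * F), slice_chart M W U phi /\
        @C1_compatible R (Gr H) (Gr H)
          (fun Y => realify (Lb (subsp Y) (subsp (orth Y))))
          (fun Y => ball Y 1) chart (E * F)%type U phi.

End Submanifolds.

(* Main.v *)
From HB Require Import structures.
Require Import Defs.
From mathcomp Require Import all_boot all_order all_algebra.
From mathcomp Require Import complex finmap lra ring.
From mathcomp Require Import all_classical all_reals topology normedtype derive.
From mathcomp Require Import wochoice.

Set Implicit Arguments.
Unset Strict Implicit.
Unset Printing Implicit Defensive.

Import Order.TTheory GRing.Theory Num.Theory.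
Import numFieldNormedType.Exports.

Local Open Scope classical_set_scope.
Local Open Scope ring_scope.

(** Two facts on the geometry of subspaces carry the first half. First ([gap]),
    [P_Y - P_Z] is the difference of [P_Y P_Z^\perp] and [P_Y^\perp P_Z], which have orthogonal
    ranges, so its norm is controlled by how far the vectors of each subspace are from the
    other one. Secondly, if [|P_W - P_Y| < 1], then [P_W] maps [Y] onto [W], bijectively and
    with a bounded inverse [S], so that [Y] is the graph of [P_W^\perp S]. It follows that
    graphs depend on operators in a 1-Lipschitz way ([gr_dist_graphs]), that operators
    depend continuously on graphs ([graph_map_close]), and that [P_Y - P_W] is compact if
    and only if the operator is ([graph_map_compact], [gr_of_compact]). The transition maps
    are analytic because, near a given operator, they are given by a Neumann series
    ([transition_analytic]).

    In the chart at [W], the subset [Grc V] of [Gr H] is the subspace of compact operators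
    in the space of bounded operators, and the second half compares the two spaces.

    By the theorem of Bartle and Graves ([continuous_section]), the quotient map by the
    compact operators has a continuous section; so the space of bounded operators is
    homeomorphic to the product of the compact ones and of the quotient, and [Grc V] is a
    [C^0]-submanifold. A convex combination of local lifts, with weights that are built
    from a well-ordering of the quotient as in the proof that metric spaces are
    paracompact, gives approximate sections, and the sum of successive corrections
    converges.

    A slice chart of class [C^1] would give, by differentiation, a bounded projection from
    the bounded operators onto the compact ones ([C1_submanifold_projection]). If [V] has
    infinite dimension and infinite codimension, there is none ([no_projection]): among
    the diagonal operators from [V] to its orthogonal complement this is the theorem that
    the sequences converging to 0 have no complement in the bounded ones, proved with an
    uncountable almost disjoint family of sets of integers. *)

(** * Norms with real values and topologies *)

Section NbhsBy.
Context {R : realType}.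

(** [D] is a distance with values in [R] that defines the topology. Stated with it, the
    continuity of maps between [Gr H], normed spaces over [scalars R k] and real normed
    spaces has the same form in all cases. *)
Definition nbhs_by (X : topologicalType) (D : X -> X -> R) : Prop :=
  forall x (A : set X),
    nbhs x A <-> exists2 e, 0 < e & forall y, D x y < e -> A y.

Lemma nbhs_by_within (X Y : topologicalType) DX DY (A : set X) (f : X -> Y) :
  nbhs_by DX -> nbhs_by DY ->
  {within A, continuous f} <->
  forall x, A x -> forall e, 0 < e -> exists2 d, 0 < d &
    forall y, A y -> DX x y < d -> DY (f x) (f y) < e.
Proof.
move=> nX nY; split.
  move=> /subspace_continuousP cf x Ax e e0.
  have /cf : nbhs (f x) [set z | DY (f x) z < e] by apply/nY; exists e.
  by move=> /(_ Ax) /nX[d d0 dP]; exists d => // y Ay /dP /(_ Ay).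
move=> cf; apply/subspace_continuousP => x Ax B /nY[e e0 eB].
have [d d0 dP] := cf x Ax e e0.
by apply/nX; exists d => // y xy Ay; exact/eB/dP.
Qed.

Lemma nbhs_by_continuous (X Y : topologicalType) DX DY (f : X -> Y) x :
  nbhs_by DX -> nbhs_by DY ->
  {for x, continuous f} <->
  forall e, 0 < e -> exists2 d, 0 < d &
    forall y, DX x y < d -> DY (f x) (f y) < e.
Proof.
move=> nX nY; split.
  move=> cf e e0.
  have /cf : nbhs (f x) [set z | DY (f x) z < e] by apply/nY; exists e.
  by move=> /nX[d d0 dP]; exists d.
move=> cf B /nY[e e0 eB]; have [d d0 dP] := cf e e0.
by apply/nX; exists d => // y xy; exact/eB/dP.
Qed.

Lemma nbhs_by_prod (X Y : topologicalType) DX DY :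
  nbhs_by DX -> nbhs_by DY ->
  @nbhs_by (X * Y)%type (fun z w => Num.max (DX z.1 w.1) (DY z.2 w.2)).
Proof.
move=> nX nY [x y] A; split.
  move=> [[B C]] /= [/nX[d d0 dP] /nY[e e0 eP]] BC; exists (Num.min d e).
    by rewrite lt_min d0.
  move=> [x' y'] /=; rewrite gt_max !lt_min => /andP[/andP[xd _] /andP[_ ye]].
  by apply: BC; split => /=; [exact: dP|exact: eP].
move=> [e e0 eP].
exists ([set x' | DX x x' < e], [set y' | DY y y' < e]).
  by split; [apply/nX|apply/nY]; exists e.
by move=> [x' y'] /= [xe ye]; apply: eP => /=; rewrite gt_max xe.
Qed.

End NbhsBy.

Section ScalarsMore.
Context {R : realType} {k : scalar_kind}.
Local Notation K := (scalars R k).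

Lemma ltr_sofr (a b : R) : (sofr a < sofr b :> K) = (a < b).
Proof.
rewrite !lt_def ler_sofr; congr (_ && _); congr negb.
by apply/eqP/eqP => [|->//]; exact: (can_inj (@sofrK R k)).
Qed.

Lemma sofr_gt0 (a : R) : (0 < sofr a :> K) = (0 < a).
Proof. by rewrite -(sofr0 (k := k)) ltr_sofr. Qed.

Lemma sre_ge0 (x : K) : 0 <= x -> 0 <= sre x.
Proof. by move=> /ler_sre; rewrite -[X in sre X <= _](sofr0 (k := k)) sofrK. Qed.

Lemma sre_gt0 (x : K) : 0 < x -> 0 < sre x.
Proof. by move=> x0; rewrite -(sofr_gt0 (sre x)) sofr_sre ?ltW. Qed.

Lemma sofrN (a : R) : sofr (k := k) (- a) = - sofr a.
Proof. by apply/eqP; rewrite -subr_eq0 opprK -sofrD addNr sofr0. Qed.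

Lemma sofr_eq0 (a : R) : (sofr a == 0 :> K) = (a == 0).
Proof. by rewrite -(sofr0 (k := k)) (inj_eq (can_inj (@sofrK R k))). Qed.

Lemma sre_norm (a : K) : `|sre a| <= sre `|a|.
Proof.
move: a; rewrite /sre /scalars; case: k => //= -[a b] /=.
by rewrite -sqrtr_sqr ler_wsqrtr// lerDl sqr_ge0.
Qed.

Lemma sreN (a : K) : sre (- a) = - sre a.
Proof.
apply/eqP; rewrite -subr_eq0 opprK -sreD addNr.
by rewrite -[X in sre X](sofr0 (k := k)) sofrK.
Qed.

Lemma rnorm_sofr (a : R) : sre `|sofr (k := k) a| = `|a|.
Proof. by rewrite sofr_norm sofrK. Qed.

Lemma rnormZr (E : normedModType K) (a : R) (x : E) :
  rnorm (sofr a *: x) = `|a| * rnorm x.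
Proof. by rewrite rnormZ rnorm_sofr. Qed.

Lemma rnormB (E : normedModType K) (x y : E) : rnorm (x - y) = rnorm (y - x).
Proof. by rewrite -rnormN opprB. Qed.

Lemma rnorm_gt0 (E : normedModType K) (x : E) : (0 < rnorm x) = (x != 0).
Proof.
rewrite lt_def rnorm_ge0 andbT; congr negb.
by apply/eqP/eqP => [/rnorm0_eq0|->]//; rewrite rnorm0.
Qed.

Lemma rnorm_triangle (E : normedModType K) (y x z : E) :
  rnorm (x - z) <= rnorm (x - y) + rnorm (y - z).
Proof. by rewrite -{1}(subrK y x) -addrA rnormD. Qed.

Lemma ler_normK (E F : normedModType K) (x : E) (y : F) (c : R) :
  (`|x| <= sofr c * `|y|) = (rnorm x <= c * rnorm y).
Proof. by rewrite -!sofr_rnorm -sofrM ler_sofr. Qed.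

Lemma nbhs_rnorm (E : normedModType K) :
  nbhs_by (fun x y : E => rnorm (x - y)).
Proof.
move=> x A; split.
  move=> /nbhs_ballP[e /= e0 eA]; exists (sre e); first exact: sre_gt0.
  move=> y; rewrite -(ltr_sofr (rnorm _)) sofr_rnorm sofr_sre ?ltW// => xy.
  by apply: eA; rewrite -ball_normE.
move=> [e e0 eA]; apply/nbhs_ballP; exists (sofr e); first by rewrite /= sofr_gt0.
move=> y; rewrite -ball_normE /= -sofr_rnorm ltr_sofr; exact: eA.
Qed.

End ScalarsMore.

Lemma nbhs_gr_dist (R : realType) (k : scalar_kind) (H : hilbertType R k) :
  nbhs_by (@gr_dist R k H).
Proof.
move=> x A; split.
  by move=> /nbhs_ballP[e /= e0 eA]; exists e => // y xy; exact: eA.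
by move=> [e e0 eA]; apply/nbhs_ballP; exists e => //= y xy; exact: eA.
Qed.

Lemma nbhs_real_norm (R : realType) (E : normedModType R) :
  nbhs_by (fun x y : E => `|x - y|).
Proof.
move=> x A; split.
  move=> /nbhs_ballP[e /= e0 eA]; exists e => // y xy; apply: eA.
  by rewrite -ball_normE.
move=> [e e0 eA]; apply/nbhs_ballP; exists e => //= y xy; apply: eA.
by move: xy; rewrite -ball_normE.
Qed.

(** * Completeness by fast Cauchy sequences *)

Section FastSequences.
Context {R : realType}.

Definition hpow (n : nat) : R := 2^-1 ^+ n.

Lemma hpow_gt0 n : 0 < hpow n.
Proof. by rewrite exprn_gt0// invr_gt0. Qed.

Lemma hpowS n : hpow n.+1 = hpow n / 2.
Proof. by rewrite /hpow exprSr. Qed.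

Lemma hpow0 : hpow 0 = 1.
Proof. by []. Qed.

Lemma hpow_le m n : (m <= n)%N -> hpow n <= hpow m.
Proof. by move=> mn; rewrite /hpow ler_wiXn2l ?invr_ge0 ?invf_le1 ?ler1n. Qed.

Lemma hpow_small (e : R) : 0 < e -> exists n, hpow n < e.
Proof.
move=> e0; exists (Num.truncn e^-1).+1; set n := _.+1.
have en : e^-1 < n%:R by exact: truncnS_gt.
have n2 : n%:R <= 2 ^+ n :> R by rewrite -natrX ler_nat ltnW// ltn_expl.
rewrite /hpow exprVn invf_plt ?posrE ?exprn_gt0//.
exact: lt_le_trans n2.
Qed.

Lemma hpow_smallM (C e : R) : 0 <= C -> 0 < e -> exists n, C * hpow n < e.
Proof.
move=> C0 e0; have C1 : 0 < C + 1 by rewrite ltr_wpDl.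
have [n ne] := hpow_small (divr_gt0 e0 C1); exists n.
move: ne; rewrite ltr_pdivlMr//; have := hpow_gt0 n; nra.
Qed.

Context {k : scalar_kind}.
Local Notation K := (scalars R k).

Lemma fast_cauchy (E : normedModType K) (C : R) (u : nat -> E) :
  (forall n, rnorm (u n.+1 - u n) <= C * hpow n) ->
  forall m n, (n <= m)%N -> rnorm (u m - u n) <= 2 * C * hpow n.
Proof.
move=> uC m n /subnK <-; elim: (m - n)%N => [|j] {m}.
  rewrite add0n subrr rnorm0.
  by have := le_trans (rnorm_ge0 _) (uC n); lra.
suff S i : rnorm (u (i + n)%N - u n) <= 2 * C * (hpow n - hpow (i + n)).
  move=> _; apply: (le_trans (S _)).
  have := le_trans (rnorm_ge0 _) (uC (j.+1 + n)%N); lra.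
elim: i => [|i IH]; first by rewrite !add0n !subrr rnorm0 mulr0.
apply: (le_trans (rnorm_triangle (u (i + n)%N) _ _)).
by have := uC (i + n)%N; rewrite addSn hpowS; lra.
Qed.

Lemma fast_cvg (E : normedModType K) (C : R) (u : nat -> E) : banach E ->
  (forall n, rnorm (u n.+1 - u n) <= C * hpow n) ->
  exists l, forall n, rnorm (l - u n) <= 2 * C * hpow n.
Proof.
move=> Ec uC; have uE := fast_cauchy uC.
have C0 : 0 <= 2 * C.
  by have := le_trans (rnorm_ge0 _) (uC 0%N); rewrite hpow0; lra.
have /Ec /cvg_ex[l ul] : cauchy (u @ \oo).
  apply: cauchy_exP => e e0.
  have [n ne] := hpow_smallM C0 (sre_gt0 e0).
  exists (u n), n => // m /= nm; rewrite -ball_normE /= -sofr_rnorm.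
  rewrite -(sofr_sre (ltW e0)) ltr_sofr rnormB.
  exact: le_lt_trans (uE _ _ nm) ne.
exists l => n; apply/ler_addgt0Pr => e e0.
have : nbhs l [set x | rnorm (l - x) < e] by apply/nbhs_rnorm; exists e.
move=> /ul[N _ /= NP].
have lm := NP (maxn n N) (leq_maxr _ _).
apply: (le_trans (rnorm_triangle (u (maxn n N)) _ _)).
by rewrite addrC lerD ?uE ?leq_maxl ?ltW.
Qed.

(** The centers of smaller and smaller balls of a Cauchy filter form a fast Cauchy
    sequence. *)
Lemma fast_banach (E : normedModType K) :
  (forall u : nat -> E, (forall n, rnorm (u n.+1 - u n) <= hpow n) ->
     exists C l, forall n, rnorm (l - u n) <= C * hpow n) -> banach E.
Proof.
move=> Ef F FF /cauchyP Fc.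
have /choice[u uP] n : exists x : E, F [set y | rnorm (x - y) < hpow n.+1].
  have e0 : 0 < sofr (hpow n.+1) :> K by rewrite sofr_gt0 hpow_gt0.
  have [x Fx] := Fc _ e0; exists x; apply: filterS Fx => y.
  by rewrite -ball_normE /= -sofr_rnorm ltr_sofr.
have [C [l lu]] : exists C l, forall n, rnorm (l - u n) <= C * hpow n.
  apply: Ef => n.
  have Fz : F ([set y | rnorm (u n - y) < hpow n.+1] `&`
               [set y | rnorm (u n.+1 - y) < hpow n.+2]) by exact: filterI.
  have [z [/= z1 z2]] := filter_ex Fz.
  apply: (le_trans (rnorm_triangle z _ _)).
  rewrite (rnormB z); move: z1 z2 (hpow_gt0 n); rewrite !hpowS; lra.
have C0 : 0 <= C by have := le_trans (rnorm_ge0 _) (lu 0%N); rewrite hpow0 mulr1.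
apply/cvg_ex; exists l => A /nbhs_rnorm[e e0 eA].
have [|n ne] := @hpow_smallM (C + 1) e _ e0; first by lra.
apply: filterS (uP n) => y /= uy; apply: eA.
apply: (le_lt_trans (rnorm_triangle (u n) _ _)).
have := lu n; have := hpow_gt0 n; move: uy; rewrite hpowS; lra.
Qed.

Lemma complete_banach (E : completeNormedModType K) : banach E.
Proof. by move=> F FF; exact: cauchy_cvg. Qed.

End FastSequences.

(** * Orthogonal projections *)

Section InnerMore.
Context {R : realType} {k : scalar_kind} {H : hilbertType R k}.
Implicit Types x y z : H.
Local Notation K := (scalars R k).

Lemma sconjD (a b : K) : sconj (a + b) = sconj a + sconj b.
Proof.
rewrite /sconj; move: a b; rewrite /scalars; case: k => // a b.
exact: (rmorphD (@conjc R)).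
Qed.

Lemma sconjM (a b : K) : sconj (a * b) = sconj a * sconj b.
Proof.
rewrite /sconj; move: a b; rewrite /scalars; case: k => // a b.
exact: (rmorphM (@conjc R)).
Qed.

Lemma inner0r x : inner x 0 = 0.
Proof. exact/inner_eq0C/inner0l. Qed.

Lemma innerDr x y z : inner x (y + z) = inner x y + inner x z.
Proof. by rewrite innerC innerDl sconjD -!innerC. Qed.

Lemma innerNl x y : inner (- x) y = - inner x y.
Proof. by rewrite -scaleN1r innerZl mulN1r. Qed.

Lemma innerBl x y z : inner (x - y) z = inner x z - inner y z.
Proof. by rewrite innerDl innerNl. Qed.

Lemma innerNr x y : inner x (- y) = - inner x y.
Proof. by apply/eqP; rewrite -addr_eq0 -innerDr addNr inner0r. Qed.

Lemma innerBr x y z : inner x (y - z) = inner x y - inner x z.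
Proof. by rewrite innerDr innerNr. Qed.

Lemma innerZr (a : K) x y : inner x (a *: y) = sconj a * inner x y.
Proof. by rewrite innerC innerZl sconjM -innerC. Qed.

Lemma rnorm_inner x : inner x x = sofr (rnorm x ^+ 2).
Proof. by rewrite inner_norm -sofr_rnorm expr2 -sofrM -expr2. Qed.

Lemma rpythagoras x y : inner x y = 0 ->
  rnorm (x + y) ^+ 2 = rnorm x ^+ 2 + rnorm y ^+ 2.
Proof.
move=> xy; apply: (can_inj (@sofrK R k)).
by rewrite sofrD !(expr2, sofrM) !sofr_rnorm -!expr2 pythagoras.
Qed.

Lemma parallelogram x y :
  rnorm (x + y) ^+ 2 + rnorm (x - y) ^+ 2 = 2 * rnorm x ^+ 2 + 2 * rnorm y ^+ 2.
Proof.
apply: (can_inj (@sofrK R k)).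
rewrite !mulr_natl !mulr2n !sofrD -!rnorm_inner.
by rewrite !(innerBl, innerBr, innerDl, innerDr); ring.
Qed.

Lemma rcauchy_schwarz x y : sre `|inner x y| <= rnorm x * rnorm y.
Proof.
by rewrite -(ler_sofr (k := k)) sofr_sre// sofrM !sofr_rnorm cauchy_schwarz.
Qed.

(** The vectors of [W] nearest to [x] satisfy the parallelogram inequality, so a
    minimizing sequence is Cauchy. *)
Lemma orthproj_exists (W : Gr H) x : exists2 y, W y & orth W (x - y).
Proof.
pose D := [set rnorm (x - w) | w in Gr_set W].
have D0 : D !=set0 by exists (rnorm (x - 0)), 0 => //; exact: Gr0.
have Dlb : has_lbound D by exists 0 => _ [w _ <-]; exact: rnorm_ge0.
pose d := inf D.
have dle w : W w -> d <= rnorm (x - w) by move=> Ww; apply: ge_inf => //; exists w.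
have d0 : 0 <= d by apply: lb_le_inf => // _ [w _ <-]; exact: rnorm_ge0.
have dapp e : 0 < e -> exists2 w, W w & rnorm (x - w) ^+ 2 < d ^+ 2 + e.
  move=> e0.
  pose c := Num.min 1 (e / (2 * d + 2)).
  have c0 : 0 < c by rewrite lt_min ltr01 divr_gt0// ltr_wpDl// mulr_ge0.
  have c1 : c <= 1 by rewrite ge_min lexx.
  have ce : c * (2 * d + 2) <= e.
    by rewrite -ler_pdivlMr ?ge_min ?lexx ?orbT// ltr_wpDl// mulr_ge0.
  have [_ [w Ww <-] wd] := inf_adherent c0 (conj D0 Dlb).
  exists w => //; have := rnorm_ge0 (x - w); rewrite -/d in wd; nra.
have /choice[u uP] n : exists w, W w /\ rnorm (x - w) ^+ 2 < d ^+ 2 + hpow n ^+ 2 / 4.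
  have [|w Ww wd] := dapp (hpow n ^+ 2 / 4); last by exists w.
  by rewrite divr_gt0// exprn_gt0// hpow_gt0.
have [|y uy] := @fast_cvg R k H 1 u (@complete_banach _ _ H).
  move=> n; have [Wn un] := uP n; have [Wm um] := uP n.+1.
  have := parallelogram (x - u n) (x - u n.+1).
  have -> : x - u n - (x - u n.+1) = u n.+1 - u n by rewrite opprB addrC addrA subrK.
  have -> : x - u n + (x - u n.+1) = sofr 2 *: (x - sofr 2^-1 *: (u n + u n.+1)) :> H.
    have s2 : sofr 2 = 1 + 1 :> K by rewrite -[2]/(1 + 1) sofrD sofr1.
    rewrite scalerBr scalerA -sofrM mulfV ?pnatr_eq0// sofr1 scale1r s2.
    by rewrite scalerDl scale1r addrACA -opprD.
  have Wh : W (sofr 2^-1 *: (u n + u n.+1)) by apply: GrZ; exact: GrD.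
  have := dle _ Wh; move: um; rewrite rnormZr ger0_norm// hpowS mul1r => um dh eq.
  rewrite -ler_sqr ?nnegrE ?rnorm_ge0 ?ltW ?hpow_gt0//.
  have : d ^+ 2 <= rnorm (x - sofr 2^-1 *: (u n + u n.+1)) ^+ 2.
    by rewrite ler_sqr ?nnegrE ?rnorm_ge0.
  have := hpow_gt0 (R := R) n; move: eq um un; nra.
have Wy : W y.
  apply: (Gr_closed (g := W)) => A /nbhs_rnorm[e e0 eA].
  have [n ne] := hpow_smallM (ler0n R 2) e0.
  exists (u n); split; first exact: (uP n).1.
  by apply: eA; apply: le_lt_trans (uy n) _; rewrite mulr1.
have yd : rnorm (x - y) <= d.
  apply/ler_addgt0Pr => e e0.
  have [n ne] := hpow_smallM (ler0n R 3) e0.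
  apply: (le_trans (rnorm_triangle (u n) _ _)).
  have [_ un] := uP n; have := uy n; rewrite (rnormB y).
  have : rnorm (x - u n) <= d + hpow n.
    rewrite -ler_sqr ?nnegrE ?rnorm_ge0 ?addr_ge0 ?(ltW (hpow_gt0 _))//.
    have := hpow_gt0 (R := R) n; move: un; nra.
  by lra.
exists y => // w Ww; have [->|w0] := eqVneq w 0; first by rewrite inner0r.
have nw : `|w| != 0 by rewrite normr_eq0.
pose t := inner (x - y) w / `|w| ^+ 2.
have ort : inner (x - y - t *: w) (t *: w) = 0.
  by rewrite innerZr innerBl innerZl inner_norm /t divfK ?expf_neq0// subrr mulr0.
have := rpythagoras ort; rewrite subrK => eq.
have := dle _ (GrD Wy (GrZ t Ww)); rewrite opprD addrA => le1.
have : rnorm (t *: w) <= 0.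
  have := rnorm_ge0 (t *: w); have := rnorm_ge0 (x - y); nra.
rewrite le_eqVlt ltNge rnorm_ge0 orbF => /eqP/rnorm0_eq0/eqP.
rewrite scaler_eq0 (negbTE w0) orbF /t mulf_eq0 invr_eq0 expf_eq0 /= (negbTE nw) orbF.
by move/eqP.
Qed.

Lemma orth_proj (W : Gr H) x : orth W (x - orthproj W x).
Proof.
rewrite /orthproj; case: xgetP => [y _ []//|] /(_ _) no.
by have [y Wy yx] := orthproj_exists W x; case: (no y).
Qed.

Lemma orthprojE (W : Gr H) x y : W y -> orth W (x - y) -> orthproj W x = y.
Proof.
move=> Wy yx; apply/eqP; rewrite -subr_eq0; apply/eqP/inner_eq0.
have Wd : W (orthproj W x - y) by apply: GrB => //; exact: proj_in.
have {1}-> : orthproj W x - y = (x - y) - (x - orthproj W x).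
  by rewrite opprB [RHS]addrC addrA subrK.
by rewrite innerBl yx// orth_proj// subrr.
Qed.

Lemma orthproj_linear (W : Gr H) : linear (orthproj W).
Proof.
move=> a x y; apply: orthprojE; first by apply: GrP; exact: proj_in.
rewrite opprD addrACA -scalerBr; apply: (@GrP _ _ _ (orth W)); exact: orth_proj.
Qed.

End InnerMore.

(** * Bounded and compact operators *)

Section OperatorsMore.
Context {R : realType} {k : scalar_kind}.
Local Notation K := (scalars R k).
Implicit Types E F G : normedModType K.

Lemma bounded_linear_of E F (f : E -> F) (C : R) : linear f ->
  (forall x, rnorm (f x) <= C * rnorm x) -> bounded_linear f.
Proof. by move=> lf fC; split=> //; exists (sofr C) => x; rewrite ler_normK. Qed.

Lemma linear_fun0 E F (f : E -> F) : linear f -> f 0 = 0.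
Proof. by move=> lf; have := lf (-1) 0 0; rewrite scaler0 addr0 scaleN1r addNr. Qed.

Lemma linear_funZ E F (f : E -> F) : linear f -> forall a x, f (a *: x) = a *: f x.
Proof.
by move=> lf a x; have := lf a x 0; rewrite !addr0 (linear_fun0 lf) addr0.
Qed.

Lemma linear_funD E F (f : E -> F) : linear f -> {morph f : x y / x + y}.
Proof. by move=> lf x y; have := lf 1 x y; rewrite !scale1r. Qed.

Lemma linear_funN E F (f : E -> F) : linear f -> {morph f : x / - x}.
Proof. by move=> lf x; rewrite -scaleN1r linear_funZ// scaleN1r. Qed.

Lemma linear_funB E F (f : E -> F) : linear f -> {morph f : x y / x - y}.
Proof. by move=> lf x y; rewrite linear_funD// linear_funN. Qed.

Lemma opnorm_bound E F (f : E -> F) x : bounded_linear f ->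
  rnorm (f x) <= opnorm f * rnorm x.
Proof.
move=> fb; have lf := fb.1.
have [->|x0] := eqVneq x 0; first by rewrite linear_fun0// !rnorm0 mulr0.
have nx : 0 < rnorm x by rewrite rnorm_gt0.
rewrite -ler_pdivrMr//.
have := @opnorm_ub _ _ _ _ f (sofr (rnorm x)^-1 *: x) (bounded_linear_ball fb).
rewrite linear_funZ// rnormZr ger0_norm ?invr_ge0 ?(ltW nx)// mulrC; apply.
rewrite /unit_ball /= rnorm_le1 rnormZr ger0_norm ?invr_ge0 ?(ltW nx)//.
by rewrite mulVf// lt0r_neq0.
Qed.

Lemma opnorm_ge0 E F (f : E -> F) : bounded_linear f -> 0 <= opnorm f.
Proof.
move=> fb; apply: le_trans (opnorm_ub (bounded_linear_ball fb) (unit_ball0 (E := E))).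
exact: rnorm_ge0.
Qed.

Lemma opnorm_lebound E F (f : E -> F) C : 0 <= C ->
  (forall x, rnorm (f x) <= C * rnorm x) -> opnorm f <= C.
Proof.
move=> C0 fC; apply: opnorm_le => x; rewrite /unit_ball /= rnorm_le1 => x1.
by apply: (le_trans (fC x)); rewrite -[leRHS]mulr1 ler_wpM2l.
Qed.

Lemma bounded_linearB E F (f g : E -> F) : bounded_linear f -> bounded_linear g ->
  bounded_linear (fun x => f x - g x).
Proof.
move=> fb gb; rewrite (_ : (fun _ => _) = fun x => -1 *: g x + f x).
  exact: bounded_linearP.
by apply/funext => x; rewrite scaleN1r addrC.
Qed.

Lemma bounded_linear_comp E F G (g : F -> G) (f : E -> F) :
  bounded_linear g -> bounded_linear f -> bounded_linear (g \o f).
Proof.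
move=> gb fb; apply: (@bounded_linear_of _ _ _ (opnorm g * opnorm f)).
  by move=> a x y /=; rewrite fb.1 gb.1.
move=> x /=; apply: (le_trans (opnorm_bound _ gb)); rewrite -mulrA.
by rewrite ler_wpM2l ?opnorm_ge0// opnorm_bound.
Qed.

Definition tbounded F (A : set F) : Prop :=
  forall e : R, 0 < e -> exists s : seq F, forall x, A x ->
    exists2 c, c \in s & rnorm (x - c) < e.

Lemma precompact_tbounded F (A : set F) : precompact A -> tbounded A.
Proof.
rewrite precompactE compact_cover => cA e e0.
have [||D _ DA] := cA F [set: F] (fun c => ball c (sofr e)).
- by move=> i _; exact: ball_open.
- by move=> x _; exists x => //; apply: ballxx; rewrite sofr_gt0.
exists (enum_fset D) => x Ax; have [c /= cD] := DA _ (subset_closure Ax).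
rewrite -ball_normE /= -sofr_rnorm ltr_sofr => xc; exists c => //.
by rewrite rnormB.
Qed.

Lemma ultra_seq (T : Type) (F : set_system T) (I : eqType) (s : seq I)
    (B : I -> set T) : UltraFilter F ->
  F [set x | exists2 c, c \in s & B c x] -> exists c, F (B c).
Proof.
move=> FU; elim: s => [|c s IH] Fs.
  have [x [d]] := filter_ex Fs; by rewrite in_nil.
have [Fc|Fc] := in_ultra_setVsetC (B c) FU; first by exists c.
apply: IH; have Fi : F ([set x | exists2 d, d \in c :: s & B d x] `&` ~` B c).
  exact: filterI.
apply: filterS Fi => x [[d]]; rewrite in_cons => /orP[/eqP->//|ds Bd _].
by exists d.
Qed.

(** An ultrafilter that contains a totally bounded set is Cauchy, as it contains one of
    the finitely many balls of each net. *)
Lemma tbounded_precompact F (A : set F) : banach F -> tbounded A -> precompact A.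
Proof.
move=> Fc tA; rewrite precompactE compact_ultra => U UU UA.
have PU : ProperFilter U by exact: ultra_proper.
have /Fc/cvg_ex[l Ul] : cauchy U.
  apply: cauchy_exP => e e0; pose d := sre e / 2.
  have d0 : 0 < d by rewrite divr_gt0// sre_gt0.
  have [s sA] := tA _ d0.
  have [|c Uc] := @ultra_seq _ U _ s (fun c => ball c e) UU; last by exists c.
  apply: filterS UA => x /(_ (ball x (sofr d))) [|y [Ay]].
    by apply: nbhsx_ballx; rewrite sofr_gt0.
  rewrite -ball_normE /= -sofr_rnorm ltr_sofr => xy.
  have [c cs yc] := sA _ Ay; exists c => //.
  rewrite -sofr_rnorm -(sofr_sre (ltW e0)) ltr_sofr rnormB.
  by apply: (le_lt_trans (rnorm_triangle y _ _)); rewrite [ltRHS]splitr ltrD.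
exists l; split=> //.
rewrite closureE => B [clB AB]; rewrite closure_id in clB.
rewrite clB => C lC; have UC := Ul _ lC.
have /filter_ex[x [Ax Cx]] : U (closure A `&` C) by exact: filterI.
by exists x; split=> //; rewrite clB; exact: (closure_subset AB).
Qed.

Lemma compact_map_tbounded E F (f : E -> F) : compact_map f ->
  tbounded (f @` @unit_ball _ _ E).
Proof. exact: precompact_tbounded. Qed.

Lemma compact_map_scaled E F (f : E -> F) (C e : R) : linear f -> compact_map f ->
  0 < C -> 0 < e ->
  exists s : seq F, forall x, rnorm x <= C -> exists2 c, c \in s & rnorm (f x - c) < e.
Proof.
move=> lf /compact_map_tbounded tf C0 e0.
have [s sP] := tf _ (divr_gt0 e0 C0).
exists [seq sofr C *: c | c <- s] => x xC.
have [|c cs xc] := sP (f (sofr C^-1 *: x)).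
  exists (sofr C^-1 *: x) => //; rewrite /unit_ball /= rnorm_le1 rnormZr.
  by rewrite ger0_norm ?invr_ge0 ?(ltW C0)// mulrC ler_pdivrMr// mul1r.
exists (sofr C *: c); first exact: map_f.
have -> : f x = sofr C *: f (sofr C^-1 *: x).
  by rewrite linear_funZ// scalerA -sofrM divff ?lt0r_neq0// sofr1 scale1r.
by rewrite -scalerBr rnormZr ger0_norm ?(ltW C0)// mulrC -ltr_pdivlMr.
Qed.

Lemma compact_map_precomp E F G (f : F -> G) (g : E -> F) : banach G ->
  linear f -> compact_map f -> bounded_linear g -> compact_map (f \o g).
Proof.
move=> Gc lf cf gb; apply: tbounded_precompact => // e e0.
have C0 : 0 < opnorm g + 1 by rewrite ltr_wpDl ?opnorm_ge0.
have [s sP] := compact_map_scaled lf cf C0 e0.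
exists s => _ [x + <-]; rewrite /unit_ball /= rnorm_le1 => x1; apply: sP.
apply: (le_trans (opnorm_bound _ gb)).
have := opnorm_ge0 gb; have := rnorm_ge0 x; nra.
Qed.

Lemma compact_map_postcomp E F G (g : F -> G) (f : E -> F) : banach G ->
  compact_map f -> bounded_linear g -> compact_map (g \o f).
Proof.
move=> Gc /compact_map_tbounded tf gb; apply: tbounded_precompact => // e e0.
have C0 : 0 < opnorm g + 1 by rewrite ltr_wpDl ?opnorm_ge0.
have [s sP] := tf _ (divr_gt0 e0 C0).
exists [seq g c | c <- s] => _ [x x1 <-].
have [|c cs xc] := sP (f x); first by exists x.
exists (g c); first exact: map_f.
rewrite /= -linear_funB; last exact: gb.1.
apply: (le_lt_trans (opnorm_bound _ gb)).
move: xc; rewrite ltr_pdivlMr//; have := opnorm_ge0 gb; have := rnorm_ge0 (f x - c).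
nra.
Qed.

Lemma compact_mapB E F (f g : E -> F) : compact_map f -> compact_map g ->
  compact_map (fun x => f x - g x).
Proof.
move=> fc gc; rewrite (_ : (fun _ => _) = fun x => -1 *: g x + f x).
  exact: compact_mapP.
by apply/funext => x; rewrite scaleN1r addrC.
Qed.

Lemma compact_mapD E F (f g : E -> F) : compact_map f -> compact_map g ->
  compact_map (fun x => f x + g x).
Proof.
move=> fc gc; rewrite (_ : (fun _ => _) = fun x => 1 *: g x + f x).
  exact: compact_mapP.
by apply/funext => x; rewrite scale1r addrC.
Qed.

Lemma compact_map_closed E F (f : E -> F) : banach F ->
  (forall e : R, 0 < e -> exists2 g : E -> F, compact_map g &
     forall x, unit_ball x -> rnorm (f x - g x) <= e) -> compact_map f.
Proof.
move=> Fc fg; apply: tbounded_precompact => // e e0.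
have [|g /compact_map_tbounded gc gP] := fg (e / 2); first by rewrite divr_gt0.
have [|s sP] := gc (e / 2); first by rewrite divr_gt0.
exists s => _ [x x1 <-]; have [|c cs xc] := sP (g x); first by exists x.
exists c => //; apply: (le_lt_trans (rnorm_triangle (g x) _ _)).
by rewrite [ltRHS]splitr ler_ltD// gP.
Qed.

(** The limit is built point by point; this serves for the completeness of both spaces
    of operators, bounded and compact. *)
Lemma fast_operator E F (u : nat -> E -> F) : banach F ->
  (forall n, bounded_linear (u n)) ->
  (forall n x, rnorm (u n.+1 x - u n x) <= hpow n * rnorm x) ->
  exists2 l : E -> F, bounded_linear l &
    forall n x, rnorm (l x - u n x) <= 2 * hpow n * rnorm x.
Proof.
move=> Fc ub uC.
have /choice[l lP] x : exists y, forall n, rnorm (y - u n x) <= 2 * hpow n * rnorm x.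
  have [|y yP] := @fast_cvg R k F (rnorm x) (fun n => u n x) Fc.
    by move=> n; rewrite mulrC.
  by exists y => n; apply: le_trans (yP n) _; lra.
exists l => //; apply: (@bounded_linear_of _ _ _ (2 + opnorm (u 0%N))).
  move=> a x y; apply/eqP; rewrite -subr_eq0; apply/eqP/rnorm0_eq0/eqP.
  rewrite eq_le rnorm_ge0 andbT; apply/ler_addgt0Pl => e e0; rewrite addr0.
  pose C := 2 * rnorm (a *: x + y) + 2 * sre `|a| * rnorm x + 2 * rnorm y.
  have C0 : 0 <= C.
    by rewrite !addr_ge0 ?mulr_ge0 ?rnorm_ge0 ?sre_ge0.
  have [n /ltW ne] := hpow_smallM C0 e0; apply: le_trans ne.
  have -> : l (a *: x + y) - (a *: l x + l y) = (l (a *: x + y) - u n (a *: x + y))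
      - (a *: (l x - u n x) + (l y - u n y)).
    rewrite (ub n).1 scalerBr.
    by rewrite [in RHS]addrACA -opprD opprB addrA subrK.
  apply: (le_trans (rnormD _ _)); rewrite rnormN.
  have := lP (a *: x + y) n; have := lP x n; have := lP y n.
  have := rnormD (a *: (l x - u n x)) (l y - u n y); rewrite rnormZ.
  have := sre_ge0 (normr_ge0 a); have := hpow_gt0 (R := R) n; rewrite /C.
  set A := sre _; set B := rnorm (l x - _); set X := rnorm x.
  move=> h0 A0 h1 h2 h3 h4.
  have : A * B <= A * (2 * hpow n * X) by rewrite ler_wpM2l.
  lra.
move=> x; rewrite mulrDl -{1}(subrK (u 0%N x) (l x)).
apply: (le_trans (rnormD _ _)); rewrite lerD ?opnorm_bound//.
by apply: le_trans (lP x 0%N) _; rewrite hpow0 mulr1.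
Qed.

Lemma rnorm_Lb E F (f : Lb E F) : rnorm f = opnorm f.
Proof. exact: sofrK. Qed.

Lemma rnorm_Lc E F (f : Lc E F) : rnorm f = opnorm f.
Proof. exact: sofrK. Qed.

Lemma Lb_in E F (f : E -> F) : bounded_linear f -> exists g : Lb E F, g = f :> (E -> F).
Proof. by move=> /asboolP fb; exists (MkLb fb). Qed.

Lemma Lc_in E F (f : E -> F) : bounded_linear f -> compact_map f ->
  exists g : Lc E F, g = f :> (E -> F).
Proof. by move=> fb fc; have /asboolP P := conj fb fc; exists (MkLc P). Qed.

Lemma banach_Lb E F : banach F -> banach (Lb E F).
Proof.
move=> Fc; apply: fast_banach => u uP.
have [||l lb lP] := @fast_operator E F (fun n => u n) Fc.
- by move=> n; exact: Lb_bounded.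
- move=> n x; have := uP n; rewrite rnorm_Lb => un.
  apply: le_trans (ler_wpM2r (rnorm_ge0 _) un).
  exact: (opnorm_bound x (Lb_bounded (u n.+1 - u n))).
have [g gE] := Lb_in lb; exists 2, g => n; rewrite rnorm_Lb.
apply: opnorm_lebound; first by rewrite mulr_ge0 ?(ltW (hpow_gt0 _)).
by move=> x; rewrite -gE in lP; exact: lP.
Qed.

Lemma banach_Lc E F : banach F -> banach (Lc E F).
Proof.
move=> Fc; apply: fast_banach => u uP.
have [||l lb lP] := @fast_operator E F (fun n => u n) Fc.
- by move=> n; exact: Lc_bounded.
- move=> n x; have := uP n; rewrite rnorm_Lc => un.
  apply: le_trans (ler_wpM2r (rnorm_ge0 _) un).
  exact: (opnorm_bound x (Lc_bounded (u n.+1 - u n))).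
have lc : compact_map l.
  apply: compact_map_closed => // e e0.
  have [n ne] := hpow_smallM (ler0n R 2) e0.
  exists (u n); first exact: Lc_compact.
  move=> x; rewrite /unit_ball /= rnorm_le1 => x1; apply: le_trans (lP n x) _.
  have := hpow_gt0 (R := R) n; have := rnorm_ge0 x; nra.
have [g gE] := Lc_in lb lc; exists 2, g => n; rewrite rnorm_Lc.
apply: opnorm_lebound; first by rewrite mulr_ge0 ?(ltW (hpow_gt0 _)).
by move=> x; rewrite -gE in lP; exact: lP.
Qed.

End OperatorsMore.

(** * The gap between two subspaces *)

Section Geometry.
Context {R : realType} {k : scalar_kind} {H : hilbertType R k}.
Local Notation K := (scalars R k).
Implicit Types (V W Y Z : Gr H) (x y z : H).

Lemma Gr_ext V W : (forall x, V x <-> W x) -> V = W.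
Proof.
move=> VW; have : Gr_set V = Gr_set W by apply/funext => x; apply/propext.
case: V W {VW} => [A Al Ac] [B Bl Bc] /= AB; subst B.
by rewrite (Prop_irrelevance Al Bl) (Prop_irrelevance Ac Bc).
Qed.

Lemma Gr_limit W (u : nat -> H) (l : H) (C : R) : 0 <= C -> (forall n, W (u n)) ->
  (forall n, rnorm (l - u n) <= C * hpow n) -> W l.
Proof.
move=> C0 Wu ul; apply: (Gr_closed (g := W)) => A /nbhs_rnorm[e e0 eA].
have [n ne] := hpow_smallM C0 e0.
by exists (u n); split=> //; apply: eA; exact: le_lt_trans ne.
Qed.

Definition projB W x y := linear_funB (orthproj_linear W) x y.
Definition projD W x y := linear_funD (orthproj_linear W) x y.
Definition proj0 W := linear_fun0 (orthproj_linear W).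

Lemma orth_orth W x : W x -> orth (orth W) x.
Proof. by move=> Wx y Wy; apply/inner_eq0C/Wy. Qed.

Lemma proj_orth W x : orthproj (orth W) x = x - orthproj W x.
Proof.
apply: orthprojE; first exact: orth_proj.
by rewrite opprB addrC subrK; apply: orth_orth; exact: proj_in.
Qed.

Lemma proj_split W x : x = orthproj W x + orthproj (orth W) x.
Proof. by rewrite proj_orth addrC subrK. Qed.

Lemma proj_orth0 W x : orth W x -> orthproj W x = 0.
Proof. by move=> Wx; apply: orthprojE; [exact: Gr0|rewrite subr0]. Qed.

Lemma orth_proj0 W x : W x -> orthproj (orth W) x = 0.
Proof. by move=> Wx; rewrite proj_orth proj_id ?subrr. Qed.

Lemma proj_adj W x y : inner (orthproj W x) y = inner x (orthproj W y).
Proof.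
have h u v : inner (orthproj W u) (v - orthproj W v) = 0.
  by apply: inner_eq0C; apply: orth_proj; exact: proj_in.
rewrite -[y in LHS](subrK (orthproj W y)) innerDr h add0r.
rewrite -[x in RHS](subrK (orthproj W x)) innerDl.
by rewrite [X in _ = X + _]inner_eq0C ?h// add0r.
Qed.

Lemma proj_norm2 W x :
  rnorm x ^+ 2 = rnorm (orthproj W x) ^+ 2 + rnorm (orthproj (orth W) x) ^+ 2.
Proof.
rewrite {1}(proj_split W x) rpythagoras//.
by apply: inner_eq0C; apply: (proj_in (orth W)); exact: proj_in.
Qed.

Lemma proj_bounded W : bounded_linear (orthproj W).
Proof.
apply: (@bounded_linear_of _ _ _ _ _ 1); first exact: orthproj_linear.
by move=> x; rewrite mul1r ler_proj.
Qed.

Lemma gr_dist_bound V W x :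
  rnorm (orthproj V x - orthproj W x) <= gr_dist V W * rnorm x.
Proof.
exact: (opnorm_bound x (bounded_linearB (proj_bounded V) (proj_bounded W))).
Qed.

Lemma gr_distC V W : gr_dist V W = gr_dist W V.
Proof. exact: (@metric_sym R (Gr H) V W). Qed.

Lemma gr_dist_ge0 V W : 0 <= gr_dist V W.
Proof. exact: (@mdist_ge0 R (Gr H) V W). Qed.

Lemma gr_dist_triangle Y V W : gr_dist V W <= gr_dist V Y + gr_dist Y W.
Proof. exact: (@metric_triangle R (Gr H) V Y W). Qed.

Lemma projB_split Y Z x : orthproj Y x - orthproj Z x =
  orthproj Y (orthproj (orth Z) x) - orthproj (orth Y) (orthproj Z x).
Proof.
rewrite -{1}(subrK (orthproj Z x) x) -proj_orth projD.
by rewrite (proj_orth Y) opprB addrA.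
Qed.

(** The operator [P_Y - P_Z] is the difference of [P_Y P_{Z^\perp}] and of
    [P_{Y^\perp} P_Z], whose ranges are orthogonal, and [P_Y P_{Z^\perp}] has the norm of its
    adjoint [P_{Z^\perp} P_Y]. *)
Lemma gap Y Z (c : R) : 0 <= c ->
  (forall z, Z z -> rnorm (orthproj (orth Y) z) <= c * rnorm z) ->
  (forall y, Y y -> rnorm (orthproj (orth Z) y) <= c * rnorm y) ->
  gr_dist Y Z <= c.
Proof.
move=> c0 hZ hY; apply: opnorm_lebound => // x.
rewrite -ler_sqr ?nnegrE ?rnorm_ge0 ?mulr_ge0 ?rnorm_ge0//.
rewrite projB_split rpythagoras; last first.
  rewrite innerNr; apply/eqP; rewrite oppr_eq0; apply/eqP/inner_eq0C.
  by apply: (proj_in (orth Y)); exact: proj_in.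
rewrite rnormN exprMn (proj_norm2 Z x) mulrDr addrC -!exprMn.
rewrite lerD// ler_sqr ?nnegrE ?rnorm_ge0 ?mulr_ge0 ?rnorm_ge0//.
  by apply: hZ; exact: proj_in.
set u := orthproj (orth Z) x.
have [->|v0] := eqVneq (orthproj Y u) 0; first by rewrite rnorm0 mulr_ge0 ?rnorm_ge0.
have nv : 0 < rnorm (orthproj Y u) by rewrite rnorm_gt0.
rewrite -(ler_pM2l nv) -expr2.
have -> : rnorm (orthproj Y u) ^+ 2 =
    sre `|inner (orthproj (orth Z) (orthproj Y u)) u|.
  rewrite proj_adj [orthproj (orth Z) u](@proj_id _ _ _ (orth Z)); last exact: proj_in.
  rewrite -{2}[orthproj Y u](@proj_id _ _ _ Y); last exact: proj_in.
  by rewrite proj_adj rnorm_inner rnorm_sofr ger0_norm// exprn_ge0// rnorm_ge0.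
apply: (le_trans (rcauchy_schwarz _ _)); rewrite mulrCA mulrA.
by rewrite ler_wpM2r ?rnorm_ge0// hY//; exact: proj_in.
Qed.

Lemma banach_subsp W : banach (subsp W).
Proof.
apply: fast_banach => u uP.
have [|l lP] := @fast_cvg R k H 1 (fun n => u n : H) (@complete_banach _ _ H).
  by move=> n; rewrite mul1r; exact: uP.
have Wl : l \in Gr_pred W.
  apply: mem_set; apply: (@Gr_limit W (fun n => u n : H) l 2) => //.
    by move=> n; apply: set_mem; exact: subsp_prop.
  by move=> n; rewrite -[2]mulr1; exact: lP.
exists 2, (MkSubsp Wl) => n; rewrite -[2]mulr1; exact: (lP n).
Qed.

Lemma subspP W (w : subsp W) : W w.
Proof. by apply: set_mem; exact: subsp_prop. Qed.

Lemma subsp_in W x : W x -> exists w : subsp W, w = x :> H.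
Proof. by move=> Wx; exists (MkSubsp (mem_set Wx)). Qed.

Lemma subsp_inj W (u v : subsp W) : u = v :> H -> u = v.
Proof. by move=> uv; exact: val_inj. Qed.

Lemma subspD W (u v : subsp W) : (u + v)%R = (u : H) + (v : H) :> H.
Proof. by []. Qed.

Lemma subspB W (u v : subsp W) : (u - v)%R = (u : H) - (v : H) :> H.
Proof. by []. Qed.

Lemma subspZ W a (u : subsp W) : (a *: u)%R = a *: (u : H) :> H.
Proof. by []. Qed.

Lemma rnorm_subsp W (u : subsp W) : rnorm u = rnorm (u : H).
Proof. by []. Qed.

Lemma subsp_bounded W : bounded_linear (@subsp_val R k H W).
Proof.
by apply: (@bounded_linear_of _ _ _ _ _ 1) => [a x y|x]//; rewrite mul1r.
Qed.

Lemma orthprojS_bounded W : bounded_linear (orthprojS W).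
Proof.
apply: (@bounded_linear_of _ _ _ _ _ 1) => [a x y|x].
  by apply: subsp_inj; exact: orthproj_linear.
by rewrite mul1r rnorm_subsp ler_proj.
Qed.

Lemma orthprojSK W (w : subsp W) : orthprojS W w = w.
Proof. by apply: subsp_inj; rewrite /= proj_id//; exact: subspP. Qed.

Section Near.
Variables W Y : Gr H.
Hypothesis WY : gr_dist W Y < 1.

Lemma proj_below y : Y y -> (1 - gr_dist W Y) * rnorm y <= rnorm (orthproj W y).
Proof.
move=> Yy; have := gr_dist_bound W Y y; rewrite [orthproj Y y]proj_id//.
by have := rnorm_triangle (orthproj W y) y 0; rewrite !subr0 rnormB; lra.
Qed.

Lemma proj_inj y y' : Y y -> Y y' -> orthproj W y = orthproj W y' -> y = y'.
Proof.
move=> Yy Yy' /eqP; rewrite -subr_eq0 -projB => /eqP p0.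
have := proj_below (GrB Yy Yy'); rewrite p0 rnorm0.
have := rnorm_ge0 (y - y'); move: WY => d1 n0 dn.
have /rnorm0_eq0/eqP : rnorm (y - y') = 0 by nra.
by rewrite subr_eq0 => /eqP.
Qed.

(** As [P_W] is bounded below on [Y], its range is closed. *)
Lemma proj_range_closed : closed [set x | exists2 y, Y y & orthproj W y = x].
Proof.
move=> x clx; pose d := 1 - gr_dist W Y; have d0 : 0 < d by rewrite subr_gt0.
have /choice[u uP] n : exists y, Y y /\ rnorm (x - orthproj W y) < hpow n.
  have [|z [[y Yy <-] xz]] := clx [set z | rnorm (x - z) < hpow n].
    by apply/nbhs_rnorm; exists (hpow n) => //; exact: hpow_gt0.
  by exists y.
have [|l lP] := @fast_cvg R k H (2 / d) u (@complete_banach _ _ H).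
  move=> n; have [Yn xn] := uP n; have [Ym xm] := uP n.+1.
  have := proj_below (GrB Ym Yn); rewrite projB => h.
  rewrite mulrAC ler_pdivlMr// mulrC; apply: (le_trans h).
  apply: (le_trans (rnorm_triangle x _ _)); rewrite (rnormB _ x).
  by move: xm; rewrite hpowS; have := hpow_gt0 (R := R) n; lra.
have C0 : 0 <= 2 * (2 / d) by rewrite !mulr_ge0// invr_ge0 ltW.
exists l.
  by apply: (@Gr_limit Y u l _ C0) => n; [exact: (uP n).1|exact: lP].
apply/esym/eqP; rewrite -subr_eq0; apply/eqP/rnorm0_eq0/eqP.
rewrite eq_le rnorm_ge0 andbT; apply/ler_addgt0Pl => e e0; rewrite addr0.
have C1 : 0 <= 1 + 2 * (2 / d) by rewrite addr_ge0.
have [n ne] := hpow_smallM C1 e0.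
apply: (le_trans (rnorm_triangle (orthproj W (u n)) _ _)).
rewrite -projB; have := ler_proj W (u n - l); rewrite (rnormB _ l).
have := lP n; have := (uP n).2; move: ne; lra.
Qed.

(** A vector of [W] orthogonal to this range is orthogonal to [Y], hence equal to its
    image by [P_W - P_Y], whose norm is less than 1. *)
Lemma proj_surj w : W w -> exists2 y, Y y & orthproj W y = w.
Proof.
move=> Ww.
have Zsub : submod_closed [pred x | x \in [set x | exists2 y, Y y & orthproj W y = x]].
  split; first by apply: mem_set; exists 0; [exact: Gr0|rewrite proj0].
  move=> a x x' /set_mem[y Yy <-] /set_mem[y' Yy' <-]; apply: mem_set.
  by exists (a *: y + y'); [exact: GrP|rewrite orthproj_linear].
pose Z := MkGr Zsub proj_range_closed.
have [y Yy yw] : Z (orthproj Z w) := proj_in Z w.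
have Wd : W (w - orthproj Z w) by apply: GrB => //; rewrite -yw; exact: proj_in.
have dY : orth Y (w - orthproj Z w).
  move=> v Yv; rewrite -[w - _](proj_id Wd) proj_adj; apply: orth_proj.
  by exists v.
have := gr_dist_bound W Y (w - orthproj Z w).
rewrite (proj_id Wd) (proj_orth0 dY) subr0 => le1.
have /rnorm0_eq0/eqP : rnorm (w - orthproj Z w) = 0.
  have := rnorm_ge0 (w - orthproj Z w); move: WY le1; nra.
by rewrite subr_eq0 => /eqP ->; exists y.
Qed.

Lemma proj_bij : set_bij (Gr_set Y) (Gr_set W) (orthproj W).
Proof.
split.
- by move=> y _; exact: proj_in.
- by move=> y y' /set_mem Yy /set_mem Yy'; exact: proj_inj.
- by move=> w /proj_surj[y Yy <-]; exists y.
Qed.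

Lemma graph_mapE y : Y y -> graph_map W Y (orthprojS W y) = orthprojS (orth W) y.
Proof.
move=> Yy; rewrite /graph_map; congr orthprojS; apply: xget_unique => //.
move=> z [Yz] /(congr1 (@subsp_val _ _ _ _)) /= zy; exact: proj_inj.
Qed.

(** Thus [Y] is the graph of [graph_map W Y]. *)
Lemma graph_mapP (w : subsp W) : Y ((w : H) + (graph_map W Y w : H)).
Proof.
have [y Yy yw] := proj_surj (subspP w).
have <- : orthprojS W y = w by exact: subsp_inj.
by rewrite (graph_mapE Yy) /= -proj_split.
Qed.

Lemma graph_map_bound (w : subsp W) :
  (1 - gr_dist W Y) * rnorm ((w : H) + (graph_map W Y w : H)) <= rnorm w.
Proof.
have := proj_below (graph_mapP w); rewrite projD proj_id; last exact: subspP.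
by rewrite proj_orth0 ?addr0//; exact: (subspP (graph_map W Y w)).
Qed.

Lemma graph_map_linear : linear (graph_map W Y).
Proof.
move=> a u v; pose y := a *: ((u : H) + (graph_map W Y u : H)) +
  ((v : H) + (graph_map W Y v : H)).
have Yy : Y y by apply: GrP; exact: graph_mapP.
have pW (w : subsp W) : orthproj W ((w : H) + (graph_map W Y w : H)) = w.
  rewrite projD proj_id; last exact: subspP.
  by rewrite proj_orth0 ?addr0//; exact: (subspP (graph_map W Y w)).
have pW' (w : subsp W) : orthproj (orth W) ((w : H) + (graph_map W Y w : H)) =
    graph_map W Y w.
  by rewrite proj_orth pW addrC addKr.
have -> : a *: u + v = orthprojS W y.
  by apply: subsp_inj; rewrite /= orthproj_linear !pW.
by rewrite graph_mapE//; apply: subsp_inj; rewrite /= orthproj_linear !pW'.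
Qed.

Lemma graph_map_bounded : bounded_linear (graph_map W Y).
Proof.
apply: (@bounded_linear_of _ _ _ _ _ (1 - gr_dist W Y)^-1); first exact: graph_map_linear.
move=> w; rewrite mulrC ler_pdivlMr ?subr_gt0// mulrC.
apply: le_trans (graph_map_bound w); rewrite ler_wpM2l ?subr_ge0 ?(ltW WY)//.
rewrite rnorm_subsp -ler_sqr ?nnegrE ?rnorm_ge0// [leRHS]rpythagoras.
  by rewrite lerDr exprn_ge0// rnorm_ge0.
by apply: inner_eq0C; apply: (subspP (graph_map W Y w)); exact: subspP.
Qed.

End Near.

End Geometry.

(** * Graphs of operators *)

Section Charts.
Context {R : realType} {k : scalar_kind} {H : hilbertType R k}.
Local Notation K := (scalars R k).
Implicit Types (V W Y Z : Gr H) (x y z : H).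

Lemma proj_addl W (w : subsp W) (v : subsp (orth W)) :
  orthproj W ((w : H) + (v : H)) = w.
Proof.
rewrite projD proj_id; last exact: subspP.
by rewrite proj_orth0 ?addr0//; exact: (subspP v).
Qed.

Lemma proj_addr W (w : subsp W) (v : subsp (orth W)) :
  orthproj (orth W) ((w : H) + (v : H)) = v.
Proof. by rewrite proj_orth proj_addl addrC addKr. Qed.

Lemma rnorm_add W (w : subsp W) (v : subsp (orth W)) :
  rnorm ((w : H) + (v : H)) ^+ 2 = rnorm w ^+ 2 + rnorm v ^+ 2.
Proof.
by rewrite rpythagoras//; apply: inner_eq0C; apply: (subspP v); exact: subspP.
Qed.

Lemma rnorm_addl W (w : subsp W) (v : subsp (orth W)) :
  rnorm w <= rnorm ((w : H) + (v : H)).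
Proof.
rewrite -ler_sqr ?nnegrE ?rnorm_ge0// rnorm_add lerDl exprn_ge0//.
exact: rnorm_ge0.
Qed.

Section GraphOf.
Variable W : Gr H.
Implicit Types f g : subsp W -> subsp (orth W).

Definition gr_of_set f : set H := [set x | orthprojS (orth W) x = f (orthprojS W x)].

Lemma gr_of_add f (w : subsp W) : gr_of_set f ((w : H) + (f w : H)).
Proof.
rewrite /gr_of_set /=; have -> : orthprojS W ((w : H) + (f w : H)) = w.
  by apply: subsp_inj; exact: proj_addl.
by apply: subsp_inj; exact: proj_addr.
Qed.

Lemma gr_of_eq f x : gr_of_set f x ->
  x = (orthprojS W x : H) + (f (orthprojS W x) : H).
Proof. by move=> <- /=; exact: proj_split. Qed.

Lemma gr_of_submod f : bounded_linear f -> submod_closed [pred x | x \in gr_of_set f].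
Proof.
move=> [lf _]; split.
  by apply: mem_set; rewrite /gr_of_set /= !(linear_fun0 (orthprojS_bounded _).1) linear_fun0.
move=> a x y /set_mem fx /set_mem fy; apply: mem_set.
by rewrite /gr_of_set /= !(orthprojS_bounded _).1 lf fx fy.
Qed.

Lemma gr_of_closed f : bounded_linear f -> closed (gr_of_set f).
Proof.
move=> fb x clx; apply/eqP; rewrite -subr_eq0; apply/eqP/rnorm0_eq0/eqP.
rewrite eq_le rnorm_ge0 andbT; apply/ler_addgt0Pl => e e0; rewrite addr0.
have C0 : 0 < 1 + opnorm f by rewrite ltr_wpDr ?opnorm_ge0.
have [|z [fz xz]] := clx [set z | rnorm (x - z) < e / (1 + opnorm f)].
  by apply/nbhs_rnorm; exists (e / (1 + opnorm f)); rewrite ?divr_gt0.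
have -> : orthprojS (orth W) x - f (orthprojS W x) =
    orthprojS (orth W) (x - z) - f (orthprojS W (x - z)).
  rewrite !(linear_funB (orthprojS_bounded _).1) (linear_funB fb.1).
  by rewrite fz opprB addrA subrK.
apply: (le_trans (rnormD _ _)); rewrite rnormN.
have := ler_proj (orth W) (x - z); have := ler_proj W (x - z).
have := opnorm_bound (orthprojS W (x - z)) fb; have := opnorm_ge0 fb.
rewrite !rnorm_subsp /=; move: xz; rewrite /= ltr_pdivlMr//; nra.
Qed.

Definition gr_of f (fb : bounded_linear f) : Gr H :=
  MkGr (gr_of_submod fb) (gr_of_closed fb).

(** A point [w + g w] of the graph of [g] differs from the point [w + f w] of the graph
    of [f] by [g w - f w]. Hence the inverses of the charts are 1-Lipschitz. *)
Lemma gr_dist_graphs f g (fb : bounded_linear f) (gb : bounded_linear g) (c : R) :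
  0 <= c -> (forall w, rnorm (f w - g w) <= c * rnorm w) ->
  gr_dist (gr_of fb) (gr_of gb) <= c.
Proof.
have wlog f1 g1 (f1b : bounded_linear f1) (g1b : bounded_linear g1) z :
    0 <= c -> (forall w, rnorm (f1 w - g1 w) <= c * rnorm w) -> gr_of g1b z ->
    rnorm (orthproj (orth (gr_of f1b)) z) <= c * rnorm z.
  move=> c0 fg /gr_of_eq zE; set w := orthprojS W z in zE.
  have -> : z = ((w : H) + (f1 w : H)) + ((g1 w : H) - (f1 w : H)).
    by rewrite addrA addrAC addrK.
  rewrite projD orth_proj0 ?add0r; last exact: gr_of_add.
  apply: (le_trans (ler_proj _ _)).
  rewrite -subspB -rnorm_subsp rnormB; apply: (le_trans (fg w)).
  by rewrite ler_wpM2l// addrA addrAC addrK rnorm_addl.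
move=> c0 fg; apply: gap => // z; first exact: wlog.
by apply: wlog => // w; rewrite rnormB.
Qed.

Lemma gr_of0 (fb : bounded_linear (fun _ : subsp W => 0 : subsp (orth W))) :
  gr_of fb = W.
Proof.
apply: Gr_ext => x; split.
  by move=> /gr_of_eq ->; rewrite addr0; exact: subspP.
by move=> Wx; apply: subsp_inj; exact: orth_proj0.
Qed.

(** With [a] the norm of [f], the gap between [W] and the graph of [f] is at most
    [a / sqrt (1 + a^2)]. *)
Lemma gr_of_ball f (fb : bounded_linear f) : gr_dist W (gr_of fb) < 1.
Proof.
pose a := opnorm f; have a0 : 0 <= a by exact: opnorm_ge0.
have a1 : 0 < 1 + a ^+ 2 by rewrite ltr_wpDr ?exprn_ge0.
pose c := Num.sqrt (a ^+ 2 / (1 + a ^+ 2)).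
have c0 : 0 <= c by exact: sqrtr_ge0.
have c2 : c ^+ 2 = a ^+ 2 / (1 + a ^+ 2).
  by rewrite sqr_sqrtr// divr_ge0 ?exprn_ge0 ?(ltW a1).
have c1 : c < 1.
  rewrite -ltr_sqr ?nnegrE// c2 expr1n ltr_pdivrMr// mul1r; lra.
apply: le_lt_trans c1; apply: gap => // [z /gr_of_eq zE|w Ww].
  set w := orthprojS W z in zE; rewrite zE proj_addr -rnorm_subsp.
  rewrite -ler_sqr ?nnegrE ?mulr_ge0 ?rnorm_ge0// exprMn c2 rnorm_add.
  rewrite mulrAC ler_pdivlMr//.
  have : rnorm (f w) ^+ 2 <= a ^+ 2 * rnorm w ^+ 2.
    by rewrite -exprMn ler_sqr ?nnegrE ?mulr_ge0 ?rnorm_ge0// opnorm_bound.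
  by lra.
have [{Ww}w' <-] := subsp_in Ww; move: w' => {}w.
(* Among the multiples of [w + f w], the one above [t w] is the nearest to [w] when
   [|f w| = a |w|]. *)
pose t := (1 + a ^+ 2)^-1; pose v := sofr t *: w.
have wE : (w : H) = ((v : H) + (f v : H)) + (((w - v)%R : H) + ((- f v)%R : H)).
  by rewrite subspB addrACA subrr addr0 addrC subrK.
rewrite {1}wE projD orth_proj0 ?add0r; last exact: gr_of_add.
apply: (le_trans (ler_proj _ _)).
rewrite -ler_sqr ?nnegrE ?mulr_ge0 ?rnorm_ge0// exprMn c2 rnorm_add rnormN.
have t1 : t * (1 + a ^+ 2) = 1 by rewrite mulVf// lt0r_neq0.
have t0 : 0 < t by rewrite invr_gt0.
have wv : rnorm (w - v) = (1 - t) * rnorm w.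
  rewrite -{1}[w]scale1r -{1}(sofr1 (k := k)) -scalerBl -sofrN -sofrD rnormZr.
  by rewrite ger0_norm//; move: t1; have := exprn_ge0 2 a0; nra.
have fv : rnorm (f v) ^+ 2 <= (a * (t * rnorm w)) ^+ 2.
  rewrite ler_sqr ?nnegrE ?mulr_ge0 ?rnorm_ge0 ?(ltW t0)//.
  by have := opnorm_bound v fb; rewrite rnormZr ger0_norm ?(ltW t0).
rewrite wv -rnorm_subsp -/t; apply: (le_trans (lerD (lexx _) fv)).
rewrite !exprMn [X in _ <= X](_ : _ = (1 - t) * rnorm w ^+ 2); last by move: t1; nra.
have := exprn_ge0 2 (rnorm_ge0 w); set X := rnorm w ^+ 2 => X0.
have -> : (1 - t) ^+ 2 * X + a ^+ 2 * (t ^+ 2 * X) = (1 - t) * X; last by [].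
have -> : a ^+ 2 * (t ^+ 2 * X) = t * (t * (1 + a ^+ 2) - t) * X by ring.
by rewrite t1; ring.
Qed.

Lemma graph_map_gr_of f (fb : bounded_linear f) : graph_map W (gr_of fb) = f.
Proof.
apply/funext => w; have <- : orthprojS W ((w : H) + (f w : H)) = w.
  by apply: subsp_inj; exact: proj_addl.
rewrite graph_mapE; [|exact: gr_of_ball|exact: gr_of_add].
by apply: subsp_inj; rewrite [LHS]proj_addr; congr (f _ : H); apply: subsp_inj; rewrite /= proj_addl.
Qed.

Lemma graph_map_lift_bound Y (w : subsp W) : gr_dist W Y < 1 ->
  rnorm ((w : H) + (graph_map W Y w : H)) <= (1 - gr_dist W Y)^-1 * rnorm w.
Proof.
move=> WY; rewrite mulrC ler_pdivlMr ?subr_gt0// mulrC; exact: graph_map_bound.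
Qed.

(** With [y'] and [s] the points of [Y'] and of [Y] above [w], and [S] the inverse of
    [P_W|_Y], one has [y' - s = (1 - S P_W) (P_{Y'} - P_Y) y']. *)
Lemma graph_map_close Y Y' : gr_dist W Y < 1 -> gr_dist W Y' < 1 ->
  (1 + (1 - gr_dist W Y)^-1) * gr_dist Y Y' <= 2^-1 ->
  forall w, rnorm (graph_map W Y' w - graph_map W Y w) <=
    2 * ((1 + (1 - gr_dist W Y)^-1) * (1 - gr_dist W Y)^-1) * gr_dist Y Y' * rnorm w.
Proof.
move=> WY WY' small w.
pose C := (1 - gr_dist W Y)^-1; rewrite -/C in small *.
pose y' := (w : H) + (graph_map W Y' w : H).
pose s := (w : H) + (graph_map W Y w : H).
pose u := y' - orthproj Y y'; pose v := orthprojS W u.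
have Y'y : Y' y' by exact: graph_mapP.
have us : y' - s = u - ((v : H) + (graph_map W Y v : H)).
  have : orthproj Y y' = s - ((v : H) + (graph_map W Y v : H)).
    have wv : orthprojS W (orthproj Y y') = w - v.
      apply: subsp_inj; rewrite subspB /= /u projB /y' proj_addl.
      by rewrite subKr.
    have wv' : orthproj W (orthproj Y y') = (w - v)%R by rewrite -wv.
    rewrite [LHS](proj_split W) wv'.
    have -> : orthproj (orth W) (orthproj Y y') = graph_map W Y (w - v).
      by rewrite -wv graph_mapE//; exact: proj_in.
    rewrite (linear_funB (graph_map_bounded WY).1) !subspB.
    by rewrite /s opprD addrACA.
  move=> /eqP; rewrite eq_sym subr_eq => /eqP ->.
  by rewrite opprD addrA.
have C0 : 0 <= C by rewrite invr_ge0 subr_ge0 ltW.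
have g0 := gr_dist_ge0 Y Y'.
have nu : rnorm u <= gr_dist Y Y' * rnorm y'.
  by rewrite gr_distC; have := gr_dist_bound Y' Y y'; rewrite (proj_id Y'y).
have nv : rnorm ((v : H) + (graph_map W Y v : H)) <= C * rnorm u.
  apply: (le_trans (graph_map_lift_bound v WY)).
  by rewrite ler_wpM2l// rnorm_subsp ler_proj.
have ns : rnorm s <= C * rnorm w by exact: graph_map_lift_bound.
have -> : rnorm (graph_map W Y' w - graph_map W Y w) = rnorm (y' - s).
  rewrite rnorm_subsp subspB; congr rnorm.
  by rewrite /y' /s opprD addrACA subrr add0r.
have ny' : rnorm y' <= rnorm s + rnorm (y' - s).
  by rewrite -{1}(subrK s y') addrC rnormD.
have n1 : rnorm (y' - s) <= (1 + C) * rnorm u.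
  by rewrite us; apply: (le_trans (rnormD _ _)); rewrite rnormN mulrDl mul1r lerD.
have n2 : rnorm (y' - s) <= (1 + C) * gr_dist Y Y' * rnorm y'.
  by apply: (le_trans n1); rewrite -mulrA ler_wpM2l// addr_ge0.
move: n2 ny' ns small; set D := (1 + C) * gr_dist Y Y'.
have D0 : 0 <= D by rewrite mulr_ge0// addr_ge0.
have -> : 2 * ((1 + C) * C) * gr_dist Y Y' * rnorm w = 2 * D * (C * rnorm w).
  by rewrite /D; ring.
have := rnorm_ge0 y'; have := rnorm_ge0 s; have := rnorm_ge0 (y' - s).
set a := rnorm (y' - s); set b := rnorm y'; set c := rnorm s; set Cw := C * _.
move=> a0 c0 b0 aDb bca cw D2.
have : D * b <= D * (c + a) by rewrite ler_wpM2l.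
have : D * c <= D * Cw by rewrite ler_wpM2l.
have : D * a <= 2^-1 * a by rewrite ler_wpM2r.
lra.
Qed.

(** On [Y] the operator [P_W^\perp] coincides with [P_Y - P_W]. *)
Lemma graph_map_compact Y : gr_dist W Y < 1 ->
  compact_map (fun x => orthproj Y x - orthproj W x) -> compact_map (graph_map W Y).
Proof.
move=> WY cYW; pose S := fun w : subsp W => (w : H) + (graph_map W Y w : H).
have -> : graph_map W Y = orthprojS (orth W) \o
    (fun x => orthproj Y x - orthproj W x) \o S.
  apply/funext => w; apply: subsp_inj; rewrite [RHS]/= /S (@proj_id _ _ _ Y); last exact: graph_mapP.
  by rewrite -proj_orth proj_addr (@proj_id _ _ _ (orth W))//; exact: (subspP (graph_map W Y w)).
have lS : linear S.
  move=> a u v; rewrite /S (graph_map_linear WY) !subspD !subspZ.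
  by rewrite scalerDr addrACA.
apply: compact_map_precomp.
- exact: banach_subsp.
- by move=> a u v /=; rewrite !orthproj_linear opprD addrACA -scalerBr (orthprojS_bounded _).1.
- by apply: compact_map_postcomp => //; [exact: banach_subsp|exact: orthprojS_bounded].
- by apply: (bounded_linear_of lS) => w; exact: graph_map_lift_bound.
Qed.

End GraphOf.

(** From [|T* x|^2 <= |T T* x| |x|], a finite net for the image of the ball by [T T*]
    gives one for its image by [T*]. *)
Lemma compact_adjoint (T T' : H -> H) : compact_map T -> linear T -> bounded_linear T' ->
  (forall x y, inner (T x) y = inner x (T' y)) -> compact_map T'.
Proof.
move=> cT lT bT' adj.
have cTT' : compact_map (T \o T').
  by apply: compact_map_precomp => //; exact: complete_banach.
apply: tbounded_precompact; first exact: complete_banach.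
move=> e e0.
have e1 : 0 < e ^+ 2 / 4 by rewrite divr_gt0// exprn_gt0.
have [s sP] := compact_map_tbounded cTT' e1.
(* Each center of the net is replaced by a point of the ball that is close to it. *)
have /choice[p pP] c : exists x : H, (exists2 x', unit_ball x' & rnorm (T (T' x') - c) < e ^+ 2 / 4) ->
    unit_ball x /\ rnorm (T (T' x) - c) < e ^+ 2 / 4.
  have [[x' x1 xc]|no] := pselect (exists2 x', unit_ball x' & rnorm (T (T' x') - c) < e ^+ 2 / 4).
    by exists x'.
  by exists 0.
exists [seq T' (p c) | c <- s] => _ [x x1 <-].
have [|c cs xc] := sP (T (T' x)); first by exists x.
have [|p1 pc] := pP c; first by exists x.
exists (T' (p c)); first exact: map_f.
rewrite -(linear_funB bT'.1) -ltr_sqr ?nnegrE ?rnorm_ge0 ?(ltW e0)//.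
have -> : rnorm (T' (x - p c)) ^+ 2 = sre `|inner (T (T' (x - p c))) (x - p c)|.
  by rewrite adj rnorm_inner rnorm_sofr ger0_norm// exprn_ge0// rnorm_ge0.
apply: (le_lt_trans (rcauchy_schwarz _ _)).
have n2 : rnorm (x - p c) <= 2.
  apply: (le_trans (rnormD _ _)); rewrite rnormN (_ : 2 = 1 + 1)// lerD//.
    by rewrite -rnorm_le1.
  by rewrite -rnorm_le1.
have nT : rnorm (T (T' (x - p c))) < e ^+ 2 / 2.
  rewrite (linear_funB bT'.1) (linear_funB lT).
  apply: (le_lt_trans (rnorm_triangle c _ _)); rewrite (rnormB c).
  lra.
have := rnorm_ge0 (T (T' (x - p c))); have := rnorm_ge0 (x - p c); nra.
Qed.

(** Let [Y] be the graph of [f]. In [P_Y - P_W = P_Y P_W^\perp - P_Y^\perp P_W], the last term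
    is [- P_Y^\perp f P_W], and [P_Y P_W^\perp] is the adjoint of [P_W^\perp P_Y = f P_W P_Y]. *)
Lemma gr_of_compact W (f : subsp W -> subsp (orth W)) (fb : bounded_linear f) :
  compact_map f -> compact_map (fun x => orthproj (gr_of fb) x - orthproj W x).
Proof.
move=> fc; set Y := gr_of fb.
have Hc : banach H := @complete_banach _ _ H.
have vb V := @subsp_bounded R k H V.
have c1 : compact_map (fun x => orthproj (orth Y) (orthproj W x)).
  rewrite (_ : (fun _ => _) = (fun x => - orthproj (orth Y) x) \o (@subsp_val _ _ _ _) \o
      f \o orthprojS W); last first.
    apply/funext => x /=; apply/eqP; rewrite -addr_eq0 -projD; apply/eqP.
    by apply: orth_proj0; exact: (gr_of_add f (orthprojS W x)).
  apply: compact_map_precomp => //.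
  - by move=> a x y /=; rewrite fb.1 ?(subspD, subspZ) orthproj_linear opprD scalerN.
  - apply: compact_map_postcomp => //; apply: (@bounded_linear_of _ _ _ _ _ 1).
      by move=> a x y /=; rewrite ?(subspD, subspZ) orthproj_linear opprD scalerN.
    by move=> x /=; rewrite mul1r rnormN; exact: ler_proj.
  - exact: orthprojS_bounded.
have c2 : compact_map (fun x => orthproj (orth W) (orthproj Y x)).
  rewrite (_ : (fun _ => _) = (@subsp_val _ _ _ _) \o f \o (orthprojS W \o orthproj Y)).
    apply: compact_map_precomp => //.
    - by move=> a x y /=; rewrite fb.1.
    - exact: compact_map_postcomp.
    - by apply: bounded_linear_comp; [exact: orthprojS_bounded|exact: proj_bounded].
  apply/funext => x /=; have /gr_of_eq {1}-> := proj_in Y x.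
  exact: proj_addr.
have c3 : compact_map (fun x => orthproj Y (orthproj (orth W) x)).
  apply: compact_adjoint c2 _ _ _.
  - by move=> a x y; rewrite !orthproj_linear.
  - by apply: bounded_linear_comp; exact: proj_bounded.
  - by move=> x y; rewrite !proj_adj.
rewrite (_ : (fun _ => _) = fun x => orthproj Y (orthproj (orth W) x) -
    orthproj (orth Y) (orthproj W x)); first exact: compact_mapB.
by apply/funext => x; exact: projB_split.
Qed.

Lemma Grc_diff V W Y : Grc V W ->
  Grc V Y <-> compact_map (fun x => orthproj Y x - orthproj W x).
Proof.
move=> VW; split=> [VY|WY].
  rewrite (_ : (fun _ => _) = fun x => (orthproj Y x - orthproj V x) -
      (orthproj W x - orthproj V x)); first exact: compact_mapB.
  by apply/funext => x; rewrite opprB addrA subrK.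
rewrite /Grc /= (_ : (fun _ => _) = fun x => (orthproj Y x - orthproj W x) +
    (orthproj W x - orthproj V x)); first exact: compact_mapD.
by apply/funext => x; rewrite addrA subrK.
Qed.

End Charts.

(** * The charts are homeomorphisms *)

Section ChartHomeo.
Context {R : realType} {k : scalar_kind} {H : hilbertType R k}.
Local Notation K := (scalars R k).
Implicit Types (V W Y Z : Gr H) (x y z : H).

Lemma mem_graph_map W Y x : gr_dist W Y < 1 ->
  Y x <-> gr_of_set (graph_map W Y) x.
Proof.
move=> WY; split=> [Yx|/gr_of_eq ->]; last exact: graph_mapP.
by rewrite /gr_of_set /= graph_mapE.
Qed.

(** The charts with bounded operators and those with compact operators are dealt with
    at once: [fn] turns a point of the model space into an operator. *)
Lemma homeo_graph_chart W (E : normedModType K) (fn : E -> subsp W -> subsp (orth W))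
    (fnb : forall a, bounded_linear (fn a)) (U : set (Gr H)) (phi : Gr H -> E) :
  injective fn ->
  (forall a b, rnorm (a - b) = opnorm (fun w => fn a w - fn b w)) ->
  (forall Y, U Y -> gr_dist W Y < 1) ->
  (forall Y, U Y -> fn (phi Y) = graph_map W Y) ->
  (forall a, U (gr_of (fnb a))) ->
  [/\ homeo_on U [set: E] phi, {within [set: E], continuous (fun a => gr_of (fnb a))},
    forall Y, U Y -> gr_of (fnb (phi Y)) = Y & forall a, phi (gr_of (fnb a)) = a].
Proof.
move=> inj hn U1 phiE Ug.
have gK Y : U Y -> gr_of (fnb (phi Y)) = Y.
  move=> UY; apply: Gr_ext => x; rewrite (mem_graph_map _ (U1 _ UY)) -phiE//.
have Kg a : phi (gr_of (fnb a)) = a.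
  by apply: inj; rewrite phiE// graph_map_gr_of.
have cg : {within [set: E], continuous (fun a => gr_of (fnb a))}.
  apply/(nbhs_by_within _ _ (@nbhs_rnorm _ _ E) (@nbhs_gr_dist _ _ H)).
  move=> a _ e e0; exists e => // b _ ab; apply: le_lt_trans ab.
  apply: gr_dist_graphs => [|w]; first exact: rnorm_ge0.
  by rewrite hn; apply: (@opnorm_bound _ _ _ _ (fun w => fn a w - fn b w)) ; exact: bounded_linearB.
split=> //; split.
- split=> [//|Y Y' /set_mem UY /set_mem UY' YY'|a _].
    by rewrite -(gK _ UY) -(gK _ UY') YY'.
  by exists (gr_of (fnb a)).
- apply/(nbhs_by_within _ _ (@nbhs_gr_dist _ _ H) (@nbhs_rnorm _ _ E)).
  move=> Y UY e e0; have WY := U1 _ UY; set d := gr_dist W Y in WY.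
  have C0 : 0 < (1 - d)^-1 by rewrite invr_gt0 subr_gt0.
  set C := (1 - d)^-1 in C0.
  have C1 : 0 < 1 + C by rewrite ltr_wpDr ?ltW.
  have D0 : 0 < 2 * ((1 + C) * C) by rewrite !mulr_gt0.
  exists (Num.min (2^-1 / (1 + C)) (e / (2 * ((1 + C) * C)))).
    by rewrite lt_min !divr_gt0 ?invr_gt0.
  move=> Y' UY'; rewrite lt_min !ltr_pdivlMr// => /andP[s1 s2].
  rewrite rnormB hn; apply: le_lt_trans s2; apply: opnorm_lebound.
    by rewrite mulr_ge0 ?gr_dist_ge0 ?(ltW D0).
  move=> w; rewrite !phiE// [X in _ <= X * _]mulrC; apply: graph_map_close => //.
    exact: U1.
  by rewrite -/d -/C mulrC ltW.
- exists (fun a => gr_of (fnb a)) => // Y /set_mem; exact: gK.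
Qed.

Lemma chartE W Y : gr_dist W Y < 1 -> chart W Y = graph_map W Y :> (_ -> _).
Proof. by move=> WY; apply: insubdK; apply/asboolP; exact: graph_map_bounded. Qed.

Lemma chartcE V W Y : Grc V W -> Grc V Y -> gr_dist W Y < 1 ->
  chartc W Y = graph_map W Y :> (_ -> _).
Proof.
move=> VW VY WY; apply: insubdK; apply/asboolP; split.
  exact: graph_map_bounded.
by apply: graph_map_compact => //; apply/(Grc_diff _ VW).
Qed.

Lemma Grc_graph V W (f : subsp W -> subsp (orth W)) (fb : bounded_linear f) :
  Grc V W -> compact_map f -> Grc V (gr_of fb).
Proof. by move=> VW fc; apply/(Grc_diff _ VW)/gr_of_compact. Qed.

Lemma homeo_chart W :
  [/\ homeo_on (ball W 1) [set: Lb (subsp W) (subsp (orth W))] (chart W),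
    {within [set: Lb (subsp W) (subsp (orth W))], continuous (fun a => gr_of (Lb_bounded a))},
    forall Y, ball W 1 Y -> gr_of (Lb_bounded (chart W Y)) = Y
    & forall a, chart W (gr_of (Lb_bounded a)) = a].
Proof.
apply: homeo_graph_chart => //.
- by move=> a b ab; exact: val_inj.
- by move=> a b; rewrite rnorm_Lb.
- exact: chartE.
- by move=> a; exact: gr_of_ball.
Qed.

Lemma homeo_chartc V W : Grc V W ->
  [/\ homeo_on (ball W 1 `&` Grc V) [set: Lc (subsp W) (subsp (orth W))] (chartc W),
    {within [set: Lc (subsp W) (subsp (orth W))], continuous (fun a => gr_of (Lc_bounded a))},
    forall Y, (ball W 1 `&` Grc V) Y -> gr_of (Lc_bounded (chartc W Y)) = Y
    & forall a, chartc W (gr_of (Lc_bounded a)) = a].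
Proof.
move=> VW; apply: homeo_graph_chart => //.
- by move=> a b ab; exact: val_inj.
- by move=> a b; rewrite rnorm_Lc.
- by move=> Y [].
- by move=> Y [WY VY]; exact: (chartcE VW).
- move=> a; split; first exact: gr_of_ball.
  by apply: Grc_graph => //; exact: Lc_compact.
Qed.

End ChartHomeo.

(** * The transition maps are analytic *)

Section Transition.
Context {R : realType} {k : scalar_kind} {H : hilbertType R k}.
Local Notation K := (scalars R k).
Variables (V W1 W2 Y0 : Gr H).
Hypothesis VW1 : Grc V W1.
Hypothesis VW2 : Grc V W2.
Hypothesis VY0 : Grc V Y0.
Hypothesis WY2 : gr_dist W2 Y0 < 1.

Local Notation L1 := (Lc (subsp W1) (subsp (orth W1))).
Local Notation L2 := (Lc (subsp W2) (subsp (orth W2))).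
Local Notation G0 := (graph_map W2 Y0).

(** The point of [Y0] above [u] in [W2] is also above [lift0 u] in [W1]. *)
Definition lift0 (u : subsp W2) : subsp W1 := orthprojS W1 ((u : H) + (G0 u : H)).

Lemma lift0_bounded : bounded_linear lift0.
Proof.
apply: (@bounded_linear_of _ _ _ _ _ (1 - gr_dist W2 Y0)^-1).
  move=> a u v; rewrite /lift0 (graph_map_linear WY2) !(subspD, subspZ).
  by rewrite addrACA -scalerDr (orthprojS_bounded _).1.
move=> u; apply: le_trans (graph_map_lift_bound _ WY2).
by rewrite rnorm_subsp ler_proj.
Qed.

Definition shear (h : L1) (u : subsp W2) : subsp W2 := - orthprojS W2 (h (lift0 u)).

Definition skew (z : subsp (orth W1)) : subsp (orth W2) :=
  orthprojS (orth W2) z - G0 (orthprojS W2 z).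

Lemma skew_bounded : bounded_linear skew.
Proof.
apply: bounded_linearB.
  by apply: (bounded_linear_comp (orthprojS_bounded _) (subsp_bounded _)).
apply: (bounded_linear_comp (graph_map_bounded WY2)).
by apply: (bounded_linear_comp (orthprojS_bounded _) (subsp_bounded _)).
Qed.

(** The product [shear (v (n-1)) ... shear (v 0)]. *)
Fixpoint shears n : ('I_n -> L1) -> subsp W2 -> subsp W2 :=
  match n with
  | 0%N => fun _ u => u
  | n'.+1 => fun v u => shears (fun i : 'I_n' => v (lift ord0 i)) (shear (v ord0) u)
  end.

Definition transition_fun n (v : 'I_n.+1 -> L1) (u : subsp W2) : subsp (orth W2) :=
  skew (v ord0 (lift0 (shears (fun i : 'I_n => v (lift ord0 i)) u))).

(** If [Y0] is the graph of [A0], the chart at [W2] maps the graph of [A0 + h] to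
    [G0 + skew h lift0 (1 - shear h)^-1], and the coefficients below are those of the
    Neumann series. *)
Definition transition_coef n : ('I_n -> L1) -> L2 :=
  match n with
  | 0%N => fun _ => chartc W2 Y0
  | n'.+1 => fun v => insubd 0 (transition_fun v)
  end.

Lemma Lc_linear (h : L1) : linear h.
Proof. exact: (Lc_bounded h).1. Qed.

Lemma shear_linear h : linear (shear h).
Proof.
move=> a u v; rewrite /shear lift0_bounded.1 Lc_linear subspD subspZ.
by rewrite (orthprojS_bounded _).1 opprD scalerN.
Qed.

Lemma shearP a (h g : L1) u : shear (a *: h + g) u = a *: shear h u + shear g u.
Proof.
rewrite /shear [(a *: h + g) _]/(a *: h (lift0 u) + g (lift0 u)).
by rewrite subspD subspZ (orthprojS_bounded _).1 opprD scalerN.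
Qed.

Lemma shear_bound h u : rnorm (shear h u) <= opnorm lift0 * rnorm h * rnorm u.
Proof.
rewrite /shear rnormN rnorm_subsp; apply: (le_trans (ler_proj _ _)).
rewrite -rnorm_subsp; apply: (le_trans (opnorm_bound _ (Lc_bounded h))).
rewrite rnorm_Lc -mulrA mulrCA ler_wpM2l ?(opnorm_ge0 (Lc_bounded h))//.
exact: opnorm_bound lift0_bounded.
Qed.

Lemma shears_linear n (v : 'I_n -> L1) : linear (shears v).
Proof.
elim: n v => [|n IH] v a x y //=; by rewrite shear_linear IH.
Qed.

Lemma eta_lift0 n (v : 'I_n.+1 -> L1) h :
  (fun i : 'I_n => [eta v with ord0 |-> h] (lift ord0 i)) = fun i => v (lift ord0 i).
Proof. by apply/funext => i. Qed.

Lemma eta_liftS n (v : 'I_n.+1 -> L1) h j :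
  (fun i : 'I_n => [eta v with lift ord0 j |-> h] (lift ord0 i)) =
  [eta (fun i => v (lift ord0 i)) with j |-> h].
Proof. by apply/funext => i /=; rewrite (inj_eq lift_inj). Qed.

Lemma eta_ord0 n (v : 'I_n.+1 -> L1) h j : [eta v with lift ord0 j |-> h] ord0 = v ord0.
Proof. by []. Qed.

Lemma shears_multilinear n i (v : 'I_n -> L1) a h g u :
  shears [eta v with i |-> a *: h + g] u =
  a *: shears [eta v with i |-> h] u + shears [eta v with i |-> g] u.
Proof.
elim: n i v u => [[]//|n IH] i v u; case: (unliftP ord0 i) => [j|] -> {i}.
  by cbn [shears]; rewrite !eta_liftS !eta_ord0 IH.
by cbn [shears]; rewrite !eta_lift0 /= ?eqxx shearP shears_linear.
Qed.

Lemma shears_bound n (v : 'I_n -> L1) u :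
  rnorm (shears v u) <= (\prod_i (opnorm lift0 * rnorm (v i))) * rnorm u.
Proof.
elim: n v u => [|n IH] v u /=; first by rewrite big_ord0 mul1r.
apply: (le_trans (IH _ _)); rewrite big_ord_recl [X in _ <= X * _]mulrC -mulrA.
rewrite ler_wpM2l//; last exact: shear_bound.
by apply: prodr_ge0 => i _; rewrite mulr_ge0 ?rnorm_ge0 ?(opnorm_ge0 lift0_bounded).
Qed.

Lemma shears_bounded n (v : 'I_n -> L1) : bounded_linear (shears v).
Proof. exact: (bounded_linear_of (@shears_linear n v) (@shears_bound n v)). Qed.

Lemma transition_fun_bound n (v : 'I_n.+1 -> L1) u :
  rnorm (transition_fun v u) <=
    opnorm skew * opnorm lift0 ^+ n.+1 * (\prod_i rnorm (v i)) * rnorm u.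
Proof.
have b0 := opnorm_ge0 lift0_bounded; have s0 := opnorm_ge0 skew_bounded.
apply: (le_trans (opnorm_bound _ skew_bounded)).
set x := shears _ u.
have nx : rnorm x <= opnorm lift0 ^+ n * \prod_(i < n) rnorm (v (lift ord0 i)) * rnorm u.
  apply: (le_trans (shears_bound _ _)).
  by rewrite big_split /= prodr_const card_ord.
have nl : rnorm (lift0 x) <= opnorm lift0 * (opnorm lift0 ^+ n *
    \prod_(i < n) rnorm (v (lift ord0 i)) * rnorm u).
  by apply: (le_trans (opnorm_bound _ lift0_bounded)); rewrite ler_wpM2l.
rewrite big_ord_recl -!mulrA ler_wpM2l//.
apply: (le_trans (opnorm_bound _ (Lc_bounded _))); rewrite -rnorm_Lc.
apply: (le_trans (ler_wpM2l (rnorm_ge0 _) nl)).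
by rewrite le_eqVlt; apply/orP; left; apply/eqP; rewrite exprS; ring.
Qed.

Lemma transition_coefE n (v : 'I_n.+1 -> L1) : transition_coef v = transition_fun v :> (_ -> _).
Proof.
apply: insubdK; apply/asboolP.
have e : transition_fun v = skew \o v ord0 \o (lift0 \o shears (fun i : 'I_n => v (lift ord0 i))).
  by [].
have lb : bounded_linear (lift0 \o shears (fun i : 'I_n => v (lift ord0 i))).
  exact: bounded_linear_comp lift0_bounded (shears_bounded _).
have sb : bounded_linear (skew \o v ord0).
  exact: bounded_linear_comp skew_bounded (Lc_bounded _).
have sc : compact_map (skew \o v ord0).
  by apply: compact_map_postcomp skew_bounded; [exact: banach_subsp|exact: Lc_compact].
rewrite e; split; first exact: bounded_linear_comp.
by apply: compact_map_precomp => //; [exact: banach_subsp|exact: sb.1].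
Qed.

Lemma transition_coef_multilinear n : multilinear (@transition_coef n).
Proof.
case: n => [[]//|n] i v a h g; apply: val_inj; apply/funext => u.
have -> : \val (a *: transition_coef [eta v with i |-> h] + transition_coef [eta v with i |-> g]) u
    = a *: transition_fun [eta v with i |-> h] u + transition_fun [eta v with i |-> g] u.
  by rewrite -!transition_coefE.
rewrite -[LHS]/(transition_coef [eta v with i |-> a *: h + g] u) transition_coefE.
rewrite /transition_fun; case: (unliftP ord0 i) => [j|] -> {i}.
  by rewrite !eta_liftS !eta_ord0 shears_multilinear lift0_bounded.1 Lc_linear skew_bounded.1.
rewrite !eta_lift0 /= ?eqxx.
by rewrite skew_bounded.1.
Qed.

Lemma shears_const n (h : L1) u : shears (fun _ : 'I_n => h) u = iter n (shear h) u :> subsp W2.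
Proof. by elim: n u => [|n IH] u //=; rewrite IH -iterSr. Qed.

Lemma shears_constS n (h : L1) u :
  shears (fun _ : 'I_n.+1 => h) u = shear h (shears (fun _ : 'I_n => h) u).
Proof. by rewrite !shears_const. Qed.

(** The remainder of the series is the difference of the two graph maps, composed with
    the [n]-th power of [shear h], which tends to 0 geometrically for small [h]. *)
Lemma transition_partial_sum (A0 h : L1) n u :
  gr_of (Lc_bounded A0) = Y0 -> gr_dist W2 (gr_of (Lc_bounded (A0 + h))) < 1 ->
  (\sum_(0 <= i < n.+1) transition_coef (fun _ : 'I_i => h)) u =
    graph_map W2 (gr_of (Lc_bounded (A0 + h))) u +
    (G0 (shears (fun _ : 'I_n => h) u) -
     graph_map W2 (gr_of (Lc_bounded (A0 + h))) (shears (fun _ : 'I_n => h) u)).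
Proof.
set Y1 := gr_of (Lc_bounded (A0 + h)) => A0Y W2Y1; set G1 := graph_map W2 Y1.
(* The point of [Y1] above [lift0 x] in [W1] is the one of [Y0], moved by [h (lift0 x)]. *)
have key x : G1 (x - shear h x) = G0 x + orthprojS (orth W2) (h (lift0 x)).
  pose y := ((x : H) + (G0 x : H)) + (h (lift0 x) : H).
  have Y1y : Y1 y.
    have Y0x : Y0 ((x : H) + (G0 x : H)) by exact: graph_mapP.
    have : gr_of_set A0 ((x : H) + (G0 x : H)) by move: Y0x; rewrite -A0Y.
    move=> /gr_of_eq; rewrite -/(lift0 x) => e.
    rewrite /y e -addrA; exact: (gr_of_add (A0 + h) (lift0 x)).
  have <- : orthprojS W2 y = x - shear h x.
    apply: subsp_inj; rewrite -[LHS]/(orthproj W2 y) projD proj_addl; congr (_ + _).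
    by rewrite /shear opprK.
  rewrite /G1 graph_mapE//; apply: subsp_inj.
  by rewrite -[LHS]/(orthproj (orth W2) y) projD proj_addr.
elim: n => [|n IH].
  by rewrite big_nat1 /= (chartcE VW2 VY0 WY2) addrC subrK.
rewrite big_nat_recr //.
transitivity ((\sum_(0 <= i < n.+1) transition_coef (fun _ : 'I_i => h)) u +
  transition_coef (fun _ : 'I_n.+1 => h) u); first by [].
rewrite IH shears_constS; set x := shears _ u.
rewrite -addrA; congr (_ + _).
rewrite transition_coefE /transition_fun -/x.
have l0 := graph_map_linear WY2; have l1 := graph_map_linear W2Y1.
have := key x; rewrite /G1 (linear_funB l1) -/G1 => /eqP; rewrite subr_eq => /eqP ->.
rewrite /skew.
have -> : orthprojS W2 (h (lift0 x)) = - shear h x by rewrite /shear opprK.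
rewrite (linear_funN l0) opprK.
by rewrite !opprD !addrA subrr add0r -addrA addrACA addNr add0r addrC.
Qed.

Lemma transition_analytic (A0 : L1) : gr_of (Lc_bounded A0) = Y0 ->
  analytic_at (fun A : L1 => chartc W2 (gr_of (Lc_bounded A))) A0.
Proof.
move=> A0Y.
have b0 := opnorm_ge0 lift0_bounded; have s0 := opnorm_ge0 skew_bounded.
set b := opnorm lift0 in b0 *; set s := opnorm skew in s0 *.
pose r := Num.min (2 * (b + 1))^-1 (1 - gr_dist W2 Y0).
have b1 : 0 < b + 1 by rewrite ltr_wpDl.
have r0 : 0 < r by rewrite lt_min subr_gt0 WY2 invr_gt0 mulr_gt0.
have br : b * r <= 2^-1.
  have : r * (2 * (b + 1)) <= 1.
    by rewrite -ler_pdivlMr ?mulr_gt0// mul1r ge_min lexx.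
  move: r0; lra.
pose C := rnorm (chartc W2 Y0) + s.
exists transition_coef, (sofr r), (sofr C); split.
- by rewrite sofr_gt0.
- exact: transition_coef_multilinear.
- move=> n v.
  have -> : \prod_i `|v i| = sofr (\prod_i rnorm (v i)).
    elim: n v => [|n IH] v; first by rewrite !big_ord0 sofr1.
    by rewrite !big_ord_recl sofrM sofr_rnorm IH.
  have -> : sofr r ^+ n = sofr (r ^+ n) :> K.
    by elim: n {v} => [|n IH]; rewrite ?expr0 ?sofr1// !exprS sofrM IH.
  rewrite -sofr_rnorm -!sofrM ler_sofr.
  case: n v => [|n] v.
    by rewrite big_ord0 expr0 !mulr1 lerDl.
  have p0 : 0 <= \prod_i rnorm (v i) by apply: prodr_ge0 => i _; exact: rnorm_ge0.
  have : rnorm (transition_coef v) <= s * b ^+ n.+1 * \prod_i rnorm (v i).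
    rewrite rnorm_Lc; apply: opnorm_lebound; first by rewrite !mulr_ge0 ?exprn_ge0.
    by move=> u; rewrite transition_coefE; exact: transition_fun_bound.
  have br1 : b ^+ n.+1 * r ^+ n.+1 <= 1.
    by rewrite -exprMn exprn_ile1// ?mulr_ge0 ?(ltW r0)//; lra.
  move=> /(ler_wpM2r (exprn_ge0 n.+1 (ltW r0))) /le_trans; apply.
  rewrite mulrAC ler_wpM2r// -mulrA.
  apply: (@le_trans _ _ s); last by rewrite lerDr rnorm_ge0.
  by rewrite -[leRHS]mulr1 ler_wpM2l.
- move=> h; rewrite -sofr_rnorm ltr_sofr lt_min => /andP[hb hd].
  set A1 := A0 + h.
  have d01 : gr_dist Y0 (gr_of (Lc_bounded A1)) <= rnorm h.
    rewrite -A0Y; apply: gr_dist_graphs => [|w]; first exact: rnorm_ge0.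
    have -> : A0 w - A1 w = - h w.
      by rewrite [A1 w]/(A0 w + h w) opprD addrA subrr add0r.
    by rewrite rnormN rnorm_Lc opnorm_bound//; exact: Lc_bounded.
  have W2Y1 : gr_dist W2 (gr_of (Lc_bounded A1)) < 1.
    by apply: (le_lt_trans (gr_dist_triangle Y0 _ _)); move: hd d01; lra.
  have VY1 : Grc V (gr_of (Lc_bounded A1)).
    by apply: Grc_graph => //; exact: Lc_compact.
  have g0 := graph_map_bounded WY2; have g1 := graph_map_bounded W2Y1.
  pose D := opnorm G0 + opnorm (graph_map W2 (gr_of (Lc_bounded A1))).
  have D0 : 0 <= D by rewrite addr_ge0 ?opnorm_ge0.
  have bound n : rnorm (chartc W2 (gr_of (Lc_bounded A1)) -
      \sum_(0 <= i < n.+1) transition_coef (fun _ : 'I_i => h)) <= D * hpow n.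
    rewrite rnorm_Lc; apply: opnorm_lebound => [|u].
      by rewrite mulr_ge0// ltW// hpow_gt0.
    set Sn := \sum_(0 <= i < n.+1) _.
    change (rnorm (chartc W2 (gr_of (Lc_bounded A1)) u - Sn u) <= D * hpow n * rnorm u).
    rewrite (chartcE VW2 VY1 W2Y1) /Sn (@transition_partial_sum A0)// opprD addrA subrr add0r rnormN.
    set x := shears _ u; have nx : rnorm x <= hpow n * rnorm u.
      apply: (le_trans (shears_bound _ _)).
      rewrite ler_wpM2r ?rnorm_ge0// prodr_const card_ord -/b /hpow.
      rewrite lerXn2r ?nnegrE ?mulr_ge0 ?rnorm_ge0 ?invr_ge0//.
      have : rnorm h * (2 * (b + 1)) <= 1.
        by rewrite -ler_pdivlMr ?mulr_gt0// mul1r ltW.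
      have := rnorm_ge0 h; lra.
    apply: (@le_trans _ _ (D * rnorm x)); last by rewrite -mulrA ler_wpM2l.
    apply: (le_trans (rnormD _ _)); rewrite rnormN mulrDl.
    by rewrite lerD ?opnorm_bound.
  move=> B /nbhs_rnorm[e e0 eB].
  have [n ne] := hpow_smallM D0 e0.
  exists n.+1 => // -[//|m] /= nm; apply: eB.
  apply: (le_lt_trans (bound m)); apply: le_lt_trans ne.
  by rewrite ler_wpM2l// hpow_le.
Qed.

End Transition.

(** * The atlas *)

Section Atlas.
Context {R : realType} {k : scalar_kind} {H : hilbertType R k}.
Implicit Types (V W Y : Gr H).

Lemma open_ball_gr W : open (ball W 1).
Proof.
rewrite openE => Y WY; apply/(@nbhs_gr_dist _ _ H).
exists (1 - gr_dist W Y); first by rewrite subr_gt0; exact: WY.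
move=> Z YZ; apply: (le_lt_trans (gr_dist_triangle Y _ _)).
by move: YZ; rewrite ltrBrDl.
Qed.

Lemma Grc_charts V W : Grc V W ->
  (forall Y : Gr H, ball W 1 Y -> Grc V Y ->
     [/\ set_bij (Gr_set Y) (Gr_set W) (orthproj W),
         bounded_linear (graph_map W Y)
       & compact_map (graph_map W Y)]) /\
  homeo_on (ball W 1 `&` Grc V)
    [set: Lc (subsp W) (subsp (orth W))] (chartc W).
Proof.
move=> VW; split=> [Y WY VY|]; last by have [] := homeo_chartc VW.
split; first exact: proj_bij.
  exact: graph_map_bounded.
by apply: graph_map_compact => //; apply/(Grc_diff _ VW).
Qed.

Lemma Grc_atlas V :
  analytic_atlas (Grc V) (Grc V)
    (fun W : Gr H => Lc (subsp W) (subsp (orth W)))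
    (fun W : Gr H => ball W 1 `&` Grc V) chartc.
Proof.
have imT W : Grc V W -> chartc W @` (ball W 1 `&` Grc V) = setT.
  move=> VW; have [[[_ _ sur] _ _] _ _ _] := homeo_chartc VW.
  by apply/seteqP; split.
split.
- move=> W _; apply: banach_Lc; exact: banach_subsp.
- apply/seteqP; split=> [W VW|Y [W VW []]//]; exists W => //; split=> //.
  exact: ballxx.
- by move=> W VW; exists (ball W 1) => //; exact: open_ball_gr.
- by move=> W VW; rewrite imT//; exact: openT.
- by move=> W VW; rewrite imT//; have [] := homeo_chartc VW.
- move=> W1 W2 VW1 VW2; have [_ _ gK1 _] := homeo_chartc VW1.
  exists (fun A => chartc W2 (gr_of (Lc_bounded A))).
    move=> A0 [Y [[WY1 VY] [WY2 _]] <-].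
    by apply: (@transition_analytic _ _ _ V W1 W2 Y) => //; exact: gK1.
  by move=> Y /set_mem[YU1 YU2] /=; rewrite gK1.
Qed.

End Atlas.

(** * Quotients of Banach spaces *)

Record closed_subspace (R : realType) (k : scalar_kind) (X : normedModType (scalars R k)) :=
  ClosedSubspace {
    cs_set :> X -> Prop;
    cs0 : cs_set 0;
    csP : forall a x y, cs_set x -> cs_set y -> cs_set (a *: x + y);
    cs_closed : closed (cs_set : set X) }.

Section Quotient.
Context {R : realType} {k : scalar_kind}.
Local Notation K := (scalars R k).
Variables (X : completeNormedModType K) (S : closed_subspace X).
Implicit Types x y z : X.

Lemma csD x y : S x -> S y -> S (x + y).
Proof. by move=> Sx Sy; rewrite -[x]scale1r; exact: csP. Qed.

Lemma csZ a x : S x -> S (a *: x).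
Proof. by move=> Sx; rewrite -[_ *: _]addr0; apply: csP => //; exact: cs0. Qed.

Lemma csN x : S x -> S (- x).
Proof. by move=> Sx; rewrite -scaleN1r; exact: csZ. Qed.

Lemma csB x y : S x -> S y -> S (x - y).
Proof. by move=> Sx Sy; apply: csD => //; exact: csN. Qed.

(** The elements of the quotient are represented by one chosen vector in each coset. *)
Definition canon x : X := choose (fun y => `[< S (x - y) >]) x.

Lemma canonP x : S (x - canon x).
Proof.
have Sx : `[< S (x - x) >] by apply/asboolP; rewrite subrr; exact: cs0.
exact/asboolP/(@chooseP X (fun y => `[< S (x - y) >]) x Sx).
Qed.

Lemma canon_eq x y : S (x - y) -> canon x = canon y.
Proof.
move=> xy; rewrite /canon.
rewrite (@eq_choose _ _ (fun z => `[< S (y - z) >])); last first.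
  move=> z; apply/asboolP/asboolP => [xz|yz].
    rewrite -(subrK x y) -addrA; apply: csD => //; rewrite -opprB; exact: csN.
  by rewrite -(subrK y x) -addrA; apply: csD.
apply: choose_id; apply/asboolP; last by rewrite subrr; exact: cs0.
by rewrite -opprB; exact: csN.
Qed.

Lemma canonK x : canon (canon x) == canon x.
Proof. by apply/eqP/canon_eq; rewrite -opprB; apply/csN/canonP. Qed.

Record quot := Quot { qrep : X ; _ : canon qrep == qrep }.

HB.instance Definition _ := [isSub for qrep].
HB.instance Definition _ := [Choice of quot by <:].

Definition qpi x : quot := Quot (canonK x).

Lemma qrepK a : qpi (qrep a) = a.
Proof. by apply: val_inj; case: a => x /= /eqP. Qed.

Lemma qpi_eq x y : qpi x = qpi y <-> S (x - y).
Proof.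
split=> [[xy]|xy]; last by apply: val_inj; exact: canon_eq.
have -> : x - y = (x - canon x) - (y - canon y).
  by rewrite xy opprB addrA subrK.
by apply: csB; exact: canonP.
Qed.

Lemma qrep_qpi x : S (x - qrep (qpi x)).
Proof. exact: canonP. Qed.

Let qzero := qpi 0.
Let qopp a := qpi (- qrep a).
Let qadd a b := qpi (qrep a + qrep b).
Let qscale (c : K) a := qpi (c *: qrep a).

Let qaddE x y : qadd (qpi x) (qpi y) = qpi (x + y).
Proof.
apply/qpi_eq; rewrite -opprB; apply: csN.
by rewrite opprD addrACA; apply: csD; exact: qrep_qpi.
Qed.

Let qscaleE c x : qscale c (qpi x) = qpi (c *: x).
Proof.
by apply/qpi_eq; rewrite -scalerBr; apply: csZ; rewrite -opprB; apply/csN/qrep_qpi.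
Qed.

Let qaddA : associative qadd.
Proof.
by move=> a b c; rewrite -(qrepK a) -(qrepK b) -(qrepK c) !qaddE addrA.
Qed.
Let qaddC : commutative qadd.
Proof. by move=> a b; rewrite /qadd addrC. Qed.
Let qadd0 : left_id qzero qadd.
Proof. by move=> a; rewrite -(qrepK a) qaddE add0r. Qed.
Let qaddN : left_inverse qzero qopp qadd.
Proof. by move=> a; rewrite -{2}(qrepK a) qaddE addNr. Qed.

HB.instance Definition _ := GRing.isZmodule.Build quot qaddA qaddC qadd0 qaddN.

Let qscaleA a b v : qscale a (qscale b v) = qscale (a * b) v.
Proof. by rewrite -(qrepK v) !qscaleE scalerA. Qed.
Let qscale1 : left_id 1 qscale.
Proof. by move=> v; rewrite -(qrepK v) qscaleE scale1r. Qed.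
Let qscaleDr : right_distributive qscale +%R.
Proof.
move=> a u v; rewrite -(qrepK u) -(qrepK v).
by rewrite -![(_ + _ : quot)]/(qadd _ _) !(qscaleE, qaddE) scalerDr.
Qed.
Let qscaleDl v : {morph qscale^~ v : a b / a + b}.
Proof.
move=> a b; rewrite -(qrepK v).
by rewrite -[(_ + _ : quot)]/(qadd _ _) !(qscaleE, qaddE) scalerDl.
Qed.

HB.instance Definition _ := GRing.Zmodule_isLmodule.Build K quot
  qscaleA qscale1 qscaleDr qscaleDl.

Lemma qpiP c x y : qpi (c *: x + y) = c *: qpi x + qpi y.
Proof. by rewrite -[RHS]/(qadd (qscale c (qpi x)) (qpi y)) qscaleE qaddE. Qed.

Definition cs_dist x : R := inf [set rnorm (x - z) | z in cs_set S].

Lemma cs_dist_le x z : S z -> cs_dist x <= rnorm (x - z).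
Proof.
move=> Sz; apply: ge_inf; last by exists z.
by exists 0 => _ [y _ <-]; exact: rnorm_ge0.
Qed.

Lemma cs_dist_ge x c : (forall z, S z -> c <= rnorm (x - z)) -> c <= cs_dist x.
Proof.
move=> xc; apply: lb_le_inf; last by move=> _ [z Sz <-]; exact: xc.
by exists (rnorm (x - 0)), 0 => //; exact: cs0.
Qed.

Lemma cs_dist_near x e : 0 < e -> exists2 z, S z & rnorm (x - z) < cs_dist x + e.
Proof.
move=> e0; have [|_ [z Sz <-] ze] := @inf_adherent _ [set rnorm (x - z) | z in cs_set S] e e0.
  split; first by exists (rnorm (x - 0)), 0 => //; exact: cs0.
  by exists 0 => _ [y _ <-]; exact: rnorm_ge0.
by exists z.
Qed.

Lemma cs_dist_ge0 x : 0 <= cs_dist x.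
Proof. by apply: cs_dist_ge => z _; exact: rnorm_ge0. Qed.

Lemma cs_dist_coset x y : S (x - y) -> cs_dist x = cs_dist y.
Proof.
have h u v : S (u - v) -> cs_dist u <= cs_dist v.
  move=> uv; apply: cs_dist_ge => z Sz.
  rewrite (_ : v - z = u - ((u - v) + z)); first by apply: cs_dist_le; exact: csD.
  by rewrite opprD opprB addrA [u + _]addrC subrK.
move=> xy; apply/eqP; rewrite eq_le !h//.
by rewrite -opprB; exact: csN.
Qed.

Lemma cs_distD x y : cs_dist (x + y) <= cs_dist x + cs_dist y.
Proof.
apply/ler_addgt0Pr => e e0; have e2 : 0 < e / 2 by rewrite divr_gt0.
have [z Sz xz] := cs_dist_near x e2; have [w Sw yw] := cs_dist_near y e2.
apply: (le_trans (cs_dist_le (x + y) (csD Sz Sw))).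
by rewrite opprD addrACA; apply: (le_trans (rnormD _ _)); lra.
Qed.

Lemma cs_distZ_le c x : cs_dist (c *: x) <= sre `|c| * cs_dist x.
Proof.
apply/ler_addgt0Pr => e e0.
have c0 : 0 < sre `|c| + 1 by rewrite ltr_wpDl ?sre_ge0.
have [z Sz xz] := cs_dist_near x (divr_gt0 e0 c0).
apply: (le_trans (cs_dist_le _ (csZ c Sz))).
rewrite -scalerBr rnormZ.
apply: (le_trans (ler_wpM2l (sre_ge0 (normr_ge0 c)) (ltW xz))).
rewrite mulrDr lerD2l mulrA ler_pdivrMr// mulrC ler_wpM2l ?(ltW e0)//.
by rewrite lerDl.
Qed.

Lemma cs_distZ c x : cs_dist (c *: x) = sre `|c| * cs_dist x.
Proof.
have [->|c0] := eqVneq c 0.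
  rewrite scale0r normr0 -[X in sre X](sofr0 (k := k)) sofrK mul0r.
  apply/eqP; rewrite eq_le cs_dist_ge0 andbT.
  by apply: (le_trans (cs_dist_le 0 (cs0 S))); rewrite subrr rnorm0.
apply/eqP; rewrite eq_le cs_distZ_le/=.
have := cs_distZ_le c^-1 (c *: x); rewrite scalerA mulVf// scale1r.
have c1 : 0 < sre `|c| by apply: sre_gt0; rewrite normr_gt0.
have s1 : sre (1 : K) = 1 by rewrite -[X in sre X](sofr1 (k := k)) sofrK.
by rewrite -(ler_pM2l c1) mulrA -sreM// -normrM divff// normr1 s1 mul1r.
Qed.

Lemma cs_dist0 x : cs_dist x = 0 -> S x.
Proof.
move=> x0; apply: (@cs_closed _ _ _ S) => A /nbhs_rnorm[e e0 eA].
have [z Sz] := cs_dist_near x e0; rewrite x0 add0r => xz.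
by exists z; split=> //; exact: eA.
Qed.

Let qnorm (a : quot) : K := sofr (cs_dist (qrep a)).

Let qnormE x : qnorm (qpi x) = sofr (cs_dist x).
Proof.
by congr sofr; apply: cs_dist_coset; rewrite -opprB; apply/csN/qrep_qpi.
Qed.

Let qnormD a b : qnorm (a + b) <= qnorm a + qnorm b.
Proof. by rewrite [a + b]/(qadd a b) qnormE -sofrD ler_sofr cs_distD. Qed.

Let qnormZ (c : K) a : qnorm (c *: a) = `|c| * qnorm a.
Proof.
rewrite [c *: a]/(qscale c a) qnormE cs_distZ sofrM; congr (_ * _).
exact: sofr_sre.
Qed.

Let qnorm0 a : qnorm a = 0 -> a = 0.
Proof.
move=> /eqP; rewrite sofr_eq0 => /eqP/cs_dist0 Sa.
by rewrite -(qrepK a); apply/qpi_eq; rewrite subr0.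
Qed.

HB.instance Definition _ := Lmodule_isNormed.Build K quot qnormD qnormZ qnorm0.

Lemma rnorm_qpi x : rnorm (qpi x) = cs_dist x.
Proof. by rewrite /rnorm -[sre _]/(sre (qnorm (qpi x))) qnormE sofrK. Qed.

Lemma rnorm_qpi_le x : rnorm (qpi x) <= rnorm x.
Proof. by rewrite rnorm_qpi -[x in leRHS]subr0 cs_dist_le//; exact: cs0. Qed.

Lemma qpi_lift (a : quot) : exists2 x, qpi x = a & rnorm x <= 2 * rnorm a.
Proof.
have [->|a0] := eqVneq a 0.
  by exists 0; [exact: linear_fun0 qpiP|rewrite !rnorm0 mulr0].
have na : 0 < rnorm a by rewrite rnorm_gt0.
have [z Sz] := cs_dist_near (qrep a) na; rewrite -rnorm_qpi qrepK => az.
exists (qrep a - z); last by lra.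
by rewrite -[RHS]qrepK; apply/qpi_eq; rewrite addrAC subrr add0r; exact: csN.
Qed.

Lemma banach_quot : banach quot.
Proof.
apply: fast_banach => u uP.
have /choice[l lP] (a : quot) : exists x, qpi x = a /\ rnorm x <= 2 * rnorm a.
  by have [x ? ?] := qpi_lift a; exists x.
pose v := fix v n := match n with 0%N => l (u 0%N) | n'.+1 => v n' + l (u n'.+1 - u n') end.
have vu n : qpi (v n) = u n.
  elim: n => [|n IH] /=; first exact: (lP _).1.
  by rewrite (linear_funD qpiP) IH (lP _).1 addrC subrK.
have [|x xP] := @fast_cvg R k X 2 v (@complete_banach _ _ X).
  move=> n; rewrite /= addrC addKr; apply: (le_trans (lP _).2).
  by rewrite ler_wpM2l.
exists (2 * 2), (qpi x) => n; rewrite -vu -(linear_funB qpiP).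
exact: le_trans (rnorm_qpi_le _) (xP n).
Qed.

HB.instance Definition _ := Uniform_isComplete.Build quot banach_quot.

End Quotient.

(** * Continuous sections of linear surjections *)

Lemma well_order_lt (X : eqType) : exists lt : X -> X -> Prop,
  (forall x y, x <> y -> lt x y \/ lt y x) /\
  forall P : X -> Prop, (exists x, P x) ->
    exists2 x, P x & forall y, lt y x -> ~ P y.
Proof.
have [r wo] := well_ordering_principle X.
have anti x y : r x y && r y x -> x = y.
  have woT : wo_chain r predT by move=> A _; exact: wo.
  by apply: (wo_chain_antisymmetric woT).
exists (fun x y => r x y /\ x <> y); split.
  move=> x y xy; have [|z [[zA zmin] _]] := wo [pred z | (z == x) || (z == y)].
    by exists x; rewrite inE eqxx.
  have rx : r z x by apply: zmin; rewrite inE eqxx.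
  have ry : r z y by apply: zmin; rewrite inE eqxx orbT.
  move: zA; rewrite inE => /orP[] /eqP zE; rewrite zE in rx ry; [left|right]; split=> //.
  by move=> /esym.
move=> P [x Px]; have [|z [[/asboolP Pz zmin] _]] := wo [pred z | `[< P z >]].
  by exists x; exact/asboolP.
exists z => // y [yz ne] Py; apply: ne; apply: anti; rewrite yz.
by apply: zmin; exact/asboolP.
Qed.

Section BartleGraves.
Context {R : realType}.

Definition fast_complete (E : normedModType R) : Prop :=
  forall (C : R) (u : nat -> E), (forall n, `|u n.+1 - u n| <= C * hpow n) ->
    exists l, forall n, `|l - u n| <= 2 * C * hpow n.

Lemma fast_complete_real : fast_complete R^o.
Proof.
move=> C u uC; have Rc : @banach (scalars R RealScalars) R^o.
  by move=> F FF; exact: (@cauchy_cvg R^o).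
exact: (@fast_cvg R RealScalars R^o C u Rc uC).
Qed.

Lemma uniform_fast (Q : topologicalType) (E : normedModType R) (C : R) (u : nat -> Q -> E) :
  fast_complete E -> (forall n, continuous (u n)) ->
  (forall n q, `|u n.+1 q - u n q| <= C * hpow n) ->
  exists2 l : Q -> E, continuous l & forall n q, `|l q - u n q| <= 2 * C * hpow n.
Proof.
move=> Ec uc uC.
have /choice[l lP] q : exists y, forall n, `|y - u n q| <= 2 * C * hpow n.
  exact: (Ec C (fun n => u n q)).
exists l => // q B /nbhs_real_norm[e e0 eB].
have C0 : 0 <= 4 * C.
  by have := le_trans (normr_ge0 _) (uC 0%N q); rewrite hpow0; lra.
have [n ne] := hpow_smallM C0 e0.
have [d d0 dn] : exists2 d : R, 0 < d & d + 4 * C * hpow n <= e.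
  by exists (e - 4 * C * hpow n); rewrite ?subr_gt0// subrK.
have : nbhs (u n q) [set z | `|u n q - z| < d] by apply/nbhs_real_norm; exists d.
move=> /(uc n q); rewrite /= nbhs_filterE /=; apply: filterS => z /= uz; apply: eB.
have -> : l q - l z = (l q - u n q) + (u n q - u n z) - (l z - u n z).
  by rewrite addrA subrK opprB addrA subrK.
apply: (le_lt_trans (ler_normB _ _)).
have := ler_normD (l q - u n q) (u n q - u n z).
have := lP q n; have := lP z n; lra.
Qed.

Section Partition.
Variables (Q : normedModType R) (lt : Q -> Q -> Prop).
Hypothesis lt_total : forall x y, x <> y -> lt x y \/ lt y x.
Hypothesis lt_least : forall P : Q -> Prop, (exists x, P x) ->
  exists2 x, P x & forall y, lt y x -> ~ P y.
Implicit Types x y z : Q.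

(** The distance from [y] to the centers that precede [x], truncated at [1]. *)
Definition before x y : R := inf ([set 1] `|` [set `|x' - y| | x' in [set x' | lt x' x]]).

Let before_lb x y : has_lbound ([set 1] `|` [set `|x' - y| | x' in [set x' | lt x' x]]).
Proof. by exists 0 => _ [->|[x' _ <-]]//; exact: ler01. Qed.

Lemma before_le1 x y : before x y <= 1.
Proof. by apply: (ge_inf (before_lb x y)); left. Qed.

Lemma before_le x x' y : lt x' x -> before x y <= `|x' - y|.
Proof. by move=> x'x; apply: (ge_inf (before_lb x y)); right; exists x'. Qed.

Lemma before_ge x y c : c <= 1 -> (forall x', lt x' x -> c <= `|x' - y|) -> c <= before x y.
Proof.
move=> c1 cx; apply: lb_le_inf; first by exists 1; left.
by move=> _ [->//|[x' x'x <-]]; exact: cx.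
Qed.

Lemma before_lip x y z : before x y <= before x z + `|y - z|.
Proof.
rewrite -lerBlDr; apply: before_ge => [|x' x'x].
  by rewrite lerBlDr (le_trans (before_le1 _ _))// lerDl.
rewrite lerBlDr (le_trans (before_le _ x'x))//.
have -> : x' - y = (x' - z) - (y - z) by rewrite opprB addrA subrK.
exact: ler_normB.
Qed.

(** Positive where [y] is at distance less than [1 - 2^-n] from [x], and at distance
    more than [1 - 2^-(n+1)] from the previous centers. *)
Definition bump n x y : R :=
  Num.max 0 (Num.min (1 - hpow n - `|x - y|) (before x y - (1 - hpow n.+1))).

Lemma bump_ge0 n x y : 0 <= bump n x y.
Proof. by rewrite /bump le_max lexx. Qed.

Lemma bump_le1 n x y : bump n x y <= 1.
Proof.
rewrite /bump ge_max ler01 ge_min; apply/orP; left.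
by have := hpow_gt0 (R := R) n; have := normr_ge0 (x - y); lra.
Qed.

Lemma bump_gt0 n x y : 0 < bump n x y ->
  `|x - y| < 1 - hpow n /\ 1 - hpow n.+1 < before x y.
Proof.
by rewrite /bump lt_max ltxx /= lt_min !subr_gt0 => /andP[].
Qed.

Lemma bump_lip_le n x y z : bump n x y <= bump n x z + `|y - z|.
Proof.
rewrite /bump ge_max addr_ge0 ?le_max ?lexx//=.
set m := Num.min _ _; set m' := Num.min _ _.
apply: (@le_trans _ _ (m' + `|y - z|)); last by rewrite lerD2r le_max lexx orbT.
rewrite -lerBlDr /m' le_min !lerBlDr; apply/andP; split.
  rewrite /m ge_min; apply/orP; left.
  have -> : x - z = (x - y) + (y - z) by rewrite addrA subrK.
  by have := ler_normD (x - y) (y - z); lra.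
rewrite /m ge_min; apply/orP; right.
by have := before_lip x y z; lra.
Qed.

Lemma bump_lip n x y z : `|bump n x y - bump n x z| <= `|y - z|.
Proof.
rewrite ler_norml; have := bump_lip_le n x y z; have := bump_lip_le n x z y.
by rewrite (distrC z y); lra.
Qed.

Lemma bump_cover y : exists n x, 0 < bump n x y.
Proof.
have [|x xy xmin] := lt_least (P := fun x => `|x - y| < 1).
  by exists y; rewrite subrr normr0.
have [n ne] : exists n, hpow n < 1 - `|x - y| by apply: hpow_small; rewrite subr_gt0.
exists n, x; rewrite /bump lt_max lt_min !subr_gt0 orbC.
rewrite (_ : `|x - y| < _); last by lra.
apply/orP; left => /=; apply: (@lt_le_trans _ _ 1).
  by have := hpow_gt0 (R := R) n.+1; lra.
apply: before_ge => // x' /xmin /negP; by rewrite -leNgt.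
Qed.

(** For a given [n], the bumps have supports at mutual distances at least [2^-(n+1)]. *)
Lemma bump_disjoint n x x' y z : 0 < bump n x y -> 0 < bump n x' z ->
  `|y - z| < hpow n.+1 -> x = x'.
Proof.
have h u u' v w : 0 < bump n u v -> 0 < bump n u' w -> lt u' u ->
    `|v - w| < hpow n.+1 -> False.
  move=> /bump_gt0[_ b1] /bump_gt0[b2 _] /(before_le v) b3 vw.
  have : `|u' - v| <= `|u' - w| + `|v - w|.
    have -> : u' - v = (u' - w) - (v - w) by rewrite opprB addrA subrK.
    exact: ler_normB.
  have := hpow_gt0 (R := R) n; move: b1 b2 b3 vw; rewrite hpowS; lra.
move=> bx bx' yz; apply: contrapT => /lt_total[xx'|x'x].
  by apply: (h _ _ _ _ bx' bx xx'); rewrite distrC.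
exact: (h _ _ _ _ bx bx' x'x).
Qed.

(** If no bump of rank [n] is positive at [y], they all vanish there, and so does
    [weight n y], whatever the center. *)
Definition center n y : Q := xget 0 [set x | 0 < bump n x y].

Definition weight n y : R := bump n (center n y) y.

Lemma center_near n y : 0 < weight n y -> `|center n y - y| < 1.
Proof. by move=> /bump_gt0[b _]; have := hpow_gt0 (R := R) n; lra. Qed.

Lemma weight_gt0 y : exists n, 0 < weight n y.
Proof.
have [n [x bx]] := bump_cover y; exists n; rewrite /weight /center.
by case: xgetP => [z _ //|/(_ x)].
Qed.

Lemma center_unique n x y : (forall x', 0 < bump n x' y -> x' = x) ->
  weight n y = bump n x y /\ (0 < bump n x y -> center n y = x).
Proof.
move=> ux; rewrite /weight /center; case: xgetP => [z _ /= zy|no].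
  by rewrite (ux _ zy).
have b0 x' : bump n x' y = 0.
  by apply/eqP; rewrite eq_le bump_ge0 andbT leNgt; apply/negP/no.
by rewrite !b0 ltxx.
Qed.

(** Near each point only one center is active. *)
Lemma center_local n y z : `|y - z| < hpow n.+1 -> exists x,
  [/\ weight n y = bump n x y, weight n z = bump n x z,
      0 < bump n x y -> center n y = x & 0 < bump n x z -> center n z = x].
Proof.
move=> yz.
have yy : `|y - y| < hpow n.+1 by rewrite subrr normr0 hpow_gt0.
have zz : `|z - z| < hpow n.+1 by rewrite subrr normr0 hpow_gt0.
have zy : `|z - y| < hpow n.+1 by rewrite distrC.
suff [x [ux vx]] : exists x, (forall x', 0 < bump n x' y -> x' = x) /\
    (forall x', 0 < bump n x' z -> x' = x).
  exists x; have [? ?] := center_unique ux.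
  by have [? ?] := center_unique vx.
have [[x xy]|ny] := pselect (exists x, 0 < bump n x y).
  exists x; split=> x' bx'; first exact: (bump_disjoint bx' xy).
  exact: (bump_disjoint bx' xy).
have [[x xz]|nz] := pselect (exists x, 0 < bump n x z).
  exists x; split=> x' bx'; last exact: (bump_disjoint bx' xz).
  by case: ny; exists x'.
by exists 0; split=> x' bx'; [case: ny|case: nz]; exists x'.
Qed.

Variables (E : normedModType R) (a : Q -> E) (A : R).
Hypothesis aA : forall x, `|a x| <= A.

Lemma weighted_cont n : continuous (fun y => weight n y *: a (center n y)).
Proof.
move=> y B /nbhs_real_norm[e e0 eB]; apply/nbhs_real_norm.
have A0 : 0 < A + 1.
  by have := le_trans (normr_ge0 _) (aA 0); lra.
exists (Num.min (hpow n.+1) (e / (A + 1))); first by rewrite lt_min hpow_gt0 divr_gt0.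
move=> z; rewrite lt_min ltr_pdivlMr// => /andP[yz ze]; apply: eB.
have [x [-> -> cy cz]] := center_local yz.
have act w : (0 < bump n x w -> center n w = x) ->
    bump n x w *: a (center n w) = bump n x w *: a x.
  move=> cw; have [->|b0] := eqVneq (bump n x w) 0; first by rewrite !scale0r.
  by rewrite cw// lt_def b0 bump_ge0.
rewrite !act// -scalerBl normrZ; apply: le_lt_trans ze.
have := bump_lip n x y z; have := aA x; have := normr_ge0 (a x).
have := normr_ge0 (y - z); have := normr_ge0 (bump n x y - bump n x z); nra.
Qed.

Lemma weighted_sum : fast_complete E -> exists2 l : Q -> E, continuous l &
  forall n q, `|l q - \sum_(i < n) hpow i *: (weight i q *: a (center i q))| <=
    2 * A * hpow n.
Proof.
move=> Ec; pose t n q := hpow n *: (weight n q *: a (center n q)).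
apply: (@uniform_fast Q E A (fun n q => \sum_(i < n) t i q)) => // [n|n q].
  elim: n => [|n IH].
    by move=> q; under eq_fun do rewrite big_ord0; exact: cvg_cst.
  move=> q; under eq_fun do rewrite big_ord_recr /=.
  by apply: cvgD; [exact: IH|apply: cvgZr; exact: weighted_cont].
rewrite big_ord_recr /= [X in X - _]addrC addrK /t !normrZ.
rewrite ger0_norm ?(ltW (hpow_gt0 _))// ger0_norm ?bump_ge0//.
rewrite mulrC ler_wpM2r ?(ltW (hpow_gt0 _))//.
have := aA (center n q); have := bump_ge0 n (center n q) q.
have := bump_le1 n (center n q) q; rewrite -/(weight n q).
by have := normr_ge0 (a (center n q)); nra.
Qed.

End Partition.

Section Selection.
Variables (X Q : normedModType R) (p : X -> Q).
Hypothesis Xc : fast_complete X.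
Hypothesis plin : linear p.
Hypothesis pnorm : forall x, `|p x| <= `|x|.
Hypothesis plift : forall q, exists2 x, p x = q & `|x| <= 2 * `|q|.

Let pB x y : p (x - y) = p x - p y.
Proof. by rewrite addrC -scaleN1r plin scaleN1r addrC. Qed.

Let p0 : p 0 = 0.
Proof. by rewrite -(subrr 0) pB subrr. Qed.

Let pZ c x : p (c *: x) = c *: p x.
Proof. by rewrite -[c *: x]addr0 plin p0 addr0. Qed.

Let pD x y : p (x + y) = p x + p y.
Proof. by rewrite -[x]scale1r plin !scale1r. Qed.

(** The value at [q] is a convex combination of preimages of points at distance less
    than [1] from [q]; the series that defines it is not locally finite, but it
    converges uniformly. *)
Lemma approximate_section : exists f : Q -> X,
  [/\ continuous f, exists C : R, forall q, `|f q| <= C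
    & forall q, `|q| <= 2 -> `|p (f q) - q| <= 1].
Proof.
have [lt [lt_total lt_least]] := well_order_lt Q.
(* A center at distance less than 1 from the ball of radius 2 has norm less than 3, and
   a preimage of norm at most 6. *)
have /choice[a aP] (x : Q) : exists b : X, `|b| <= 6 /\ (`|x| <= 3 -> p b = x).
  have [x3|x3] := pselect (`|x| <= 3); last by exists 0; rewrite normr0.
  have [b pb bx] := plift x; exists b; split=> //.
  by apply: (le_trans bx); move: x3; lra.
pose w := weight lt.
have w0 n q : 0 <= w n q by exact: bump_ge0.
have w1 n q : w n q <= 1 by exact: bump_le1.
pose c := center lt.
pose u n q : X := \sum_(i < n) hpow i *: (w i q *: a (c i q)).
pose v n q : R := \sum_(i < n) hpow i * w i q.
have h0 n : 0 < hpow n :> R by exact: hpow_gt0.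
have [num numc numP] : exists2 l : Q -> X, continuous l &
    forall n q, `|l q - u n q| <= 2 * 6 * hpow n.
  by apply: weighted_sum => // x; have [] := aP x.
have [den denc denP] : exists2 l : Q -> R^o, continuous l &
    forall n q, `|l q - v n q| <= 2 * 1 * hpow n.
  have [|l lc lP] := @weighted_sum Q lt lt_total R^o (fun=> 1) 1 _ fast_complete_real.
    by move=> x; rewrite normr1.
  exists l => // n q; have := lP n q.
  congr (`|_ - _| <= _); apply: eq_bigr => i _.
  by rewrite -[RHS]mulr1 -mulrA.
have vS n q : v n.+1 q = v n q + hpow n * w n q by rewrite /v big_ord_recr.
have uS n q : u n.+1 q = u n q + hpow n *: (w n q *: a (c n q)) by rewrite /u big_ord_recr.
have hw n q : 0 <= hpow n * w n q by rewrite mulr_ge0// ltW.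
have v_le m n q : (n <= m)%N -> v n q <= v m q.
  move=> /subnK <-; elim: (m - n)%N => [//|i IH].
  by rewrite addSn vS; apply: (le_trans IH); rewrite lerDl.
have v_den n q : v n q <= den q.
  apply/ler_addgt0Pr => e e0; have [m me] := hpow_smallM (ler0n R 2) e0.
  apply: (le_trans (v_le _ _ q (leq_maxl n m))).
  have := denP (maxn n m) q; have := hpow_le (R := R) (leq_maxr n m).
  by rewrite mulr1 ler_norml => hm /andP[]; move: me; lra.
have den0 q : 0 < den q.
  have [n wn] := weight_gt0 lt_least q.
  apply: (lt_le_trans _ (v_den n.+1 q)); rewrite vS.
  by apply: ltr_wpDl; [apply: sumr_ge0|rewrite mulr_gt0].
have num_le q : `|num q| <= 6 * den q.
  apply/ler_addgt0Pr => e e0; have [m me] := hpow_smallM (ler0n R 12) e0.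
  have : `|u m q| <= 6 * v m q.
    elim: m {me} => [|m IH]; first by rewrite /u /v !big_ord0 normr0 mulr0.
    rewrite uS vS mulrDr; apply: (le_trans (ler_normD _ _)); rewrite lerD//.
    rewrite !normrZ ger0_norm ?(ltW (h0 _))// ger0_norm// mulrA mulrC ler_wpM2r//.
    by have [] := aP (c m q).
  have := numP m q; have := v_den m q.
  have : `|num q| <= `|num q - u m q| + `|u m q|.
    by rewrite -{1}(subrK (u m q) (num q)) ler_normD.
  by move: me; lra.
have close q : `|q| <= 2 -> `|p (num q) - den q *: q| <= den q.
  move=> q2; apply/ler_addgt0Pr => e e0; have [m me] := hpow_smallM (ler0n R 16) e0.
  have : `|p (u m q) - v m q *: q| <= v m q.
    elim: m {me} => [|m IH].
      by rewrite /u /v !big_ord0 p0 scale0r subrr normr0.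
    rewrite uS vS pD scalerDl opprD addrACA.
    apply: (le_trans (ler_normD _ _)); rewrite lerD// !pZ scalerA -scalerBr normrZ.
    rewrite ger0_norm//; have [->|wm] := eqVneq (w m q) 0; first by rewrite mulr0 mul0r.
    have /center_near cq : 0 < weight lt m q by rewrite lt_def wm /=; exact: w0.
    rewrite ler_piMr// (aP _).2; first exact: ltW.
    have := ler_normD (c m q - q) q; rewrite subrK; move: cq; rewrite -/(c m q); lra.
  have -> : p (num q) - den q *: q =
      p (num q - u m q) + ((p (u m q) - v m q *: q) - (den q - v m q) *: q).
    by rewrite pB scalerBl opprB [X in _ = _ + X]addrA subrK addrA subrK.
  have := ler_normD (p (num q - u m q)) ((p (u m q) - v m q *: q) - (den q - v m q) *: q).
  have := ler_normB (p (u m q) - v m q *: q) ((den q - v m q) *: q).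
  rewrite normrZ; have := numP m q; have := denP m q; have := v_den m q.
  have := pnorm (num q - u m q).
  have : `|den q - v m q| * `|q| <= `|den q - v m q| * 2 by rewrite ler_wpM2l.
  by move: me; rewrite mulr1; lra.
exists (fun q => (den q)^-1 *: num q); split.
- move=> q; apply: cvgZ; last exact: numc.
  by apply: cvgV; [rewrite lt0r_neq0|exact: denc].
- exists 6 => q; rewrite normrZ normfV gtr0_norm// mulrC ler_pdivrMr//.
- move=> q /close cq; rewrite pZ.
  have -> : (den q)^-1 *: p (num q) - q = (den q)^-1 *: (p (num q) - den q *: q).
    by rewrite scalerBr scalerA mulVf ?scale1r// lt0r_neq0.
  by rewrite normrZ normfV gtr0_norm// mulrC ler_pdivrMr// mul1r.
Qed.

(** The theorem of Bartle and Graves. Each step corrects the previous one by an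
    approximate section at scale [2^-n]; the limit is a section over the ball of radius
    2, which is extended to the whole space by rescaling. *)
Theorem continuous_section : exists2 s : Q -> X, continuous s & forall q, p (s q) = q.
Proof.
have [f [fc [C fC] fP]] := approximate_section.
pose s := fix s n q : X := match n with
  | 0%N => 0
  | n'.+1 => s n' q + hpow n' *: f ((hpow n')^-1 *: (q - p (s n' q))) end.
have h0 n : 0 < hpow n :> R by exact: hpow_gt0.
have pc : continuous p.
  move=> x B /nbhs_real_norm[e e0 eB]; apply/nbhs_real_norm; exists e => // y xy.
  by apply: eB; rewrite -pB (le_lt_trans (pnorm _)).
have [l lc lP] : exists2 l : Q -> X, continuous l &
    forall n q, `|l q - s n q| <= 2 * C * hpow n.
  apply: uniform_fast => // [|n q].
    elim=> [|n IH] q /=; first exact: cvg_cst.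
    apply: cvgD; first exact: IH.
    apply: cvgZr; apply: (@cvg_comp _ _ _ _ f _ _ _ _ (fc _)).
    apply: cvgZr; apply: cvgB; first exact: cvg_id.
    by apply: (@cvg_comp _ _ _ _ p _ _ _ (IH q)); exact: pc.
  rewrite /= addrAC subrr add0r normrZ gtr0_norm// mulrC ler_wpM2r//.
  exact: ltW.
have ls q : `|q| <= 2 -> p (l q) = q.
  move=> q2; have sP n : `|q - p (s n q)| <= 2 * hpow n.
    elim: n => [|n IH]; first by rewrite /= p0 subr0 hpow0 mulr1.
    pose r := (hpow n)^-1 *: (q - p (s n q)).
    have r2 : `|r| <= 2 by rewrite normrZ normfV gtr0_norm// mulrC ler_pdivrMr.
    have -> : q - p (s n.+1 q) = - (hpow n *: (p (f r) - r)).
      have hr : hpow n *: r = q - p (s n q).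
        by rewrite /r scalerA mulfV ?scale1r// lt0r_neq0.
      by rewrite /= -/r pD pZ scalerBr hr opprB opprD addrA.
    rewrite normrN normrZ gtr0_norm// hpowS.
    by have := fP r r2; have := h0 n; nra.
  apply/eqP; rewrite -subr_eq0 -normr_le0; apply/ler_addgt0Pl => e e0; rewrite addr0.
  have C0 : 0 <= 2 * C + 2 by have := le_trans (normr_ge0 _) (fC 0); lra.
  have [n ne] := hpow_smallM C0 e0.
  have -> : p (l q) - q = p (l q - s n q) - (q - p (s n q)).
    by rewrite pB opprB addrA subrK.
  apply: (le_trans (ler_normB _ _)).
  by have := pnorm (l q - s n q); have := lP n q; have := sP n; move: ne; lra.
have n0 (q : Q) : 0 < 1 + `|q| by rewrite ltr_pwDl.
exists (fun q => (1 + `|q|) *: l ((1 + `|q|)^-1 *: q)).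
  have nc (q : Q) : 1 + `|z| @[z --> q] --> 1 + `|q|.
    by apply: cvgD; [exact: cvg_cst|exact: norm_continuous].
  move=> q; apply: cvgZ; first exact: nc.
  apply: (@cvg_comp _ _ _ _ l _ _ _ _ (lc _)).
  by apply: cvgZ; [apply: cvgV; [rewrite lt0r_neq0|exact: nc]|exact: cvg_id].
move=> q; rewrite pZ ls ?scalerA ?mulfV ?scale1r ?lt0r_neq0//.
rewrite normrZ normfV gtr0_norm// mulrC ler_pdivrMr//.
by have := normr_ge0 q; lra.
Qed.

End Selection.
End BartleGraves.

(** * Topological splitting of the compact operators *)

Section QuotientSection.
Context {R : realType} {k : scalar_kind}.
Local Notation K := (scalars R k).

(** The theorem of Bartle and Graves is applied to the real spaces underlying [X] and its
    quotient. *)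
Lemma quotient_section (X : completeNormedModType K) (S : closed_subspace X) :
  exists (Q : completeNormedModType K) (p : X -> Q) (s : Q -> X),
    [/\ linear p, forall x, rnorm (p x) <= rnorm x, forall x, p x = 0 <-> S x,
      forall q, p (s q) = q
    & forall q (e : R), 0 < e -> exists2 d : R, 0 < d &
        forall r, rnorm (q - r) < d -> rnorm (s q - s r) < e].
Proof.
have [||||s sc sP] := @continuous_section R (realify X) (realify (quot S)) (qpi S).
- move=> C u uC; exact: (@fast_cvg R k X C u (complete_banach (E := X)) uC).
- by move=> a x y; exact: (qpiP S (sofr a)).
- by move=> x; exact: rnorm_qpi_le.
- by move=> q; have [x] := qpi_lift q; exists x.
exists (quot S), (qpi S), s; split=> //.
- by move=> a x y; exact: qpiP.
- by move=> x; exact: rnorm_qpi_le.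
- move=> x; have p0 : qpi S 0 = 0 by exact: (linear_fun0 (@qpiP _ _ _ S)).
  by rewrite -p0; split=> [/qpi_eq|Sx]; [|apply/qpi_eq]; rewrite subr0.
- move=> q e e0; exact: ((nbhs_by_continuous s q (@nbhs_real_norm R (realify (quot S)))
    (@nbhs_real_norm R (realify X))).1 (sc q) e e0).
Qed.

End QuotientSection.

Section CompleteInstances.
Context {R : realType} {k : scalar_kind}.
Local Notation K := (scalars R k).

HB.instance Definition _ (H : hilbertType R k) (W : Gr H) :=
  Uniform_isComplete.Build (subsp W) (@banach_subsp R k H W).

HB.instance Definition _ (E : normedModType K) (F : completeNormedModType K) :=
  Uniform_isComplete.Build (Lb E F) (banach_Lb (complete_banach (E := F))).

HB.instance Definition _ (E : normedModType K) (F : completeNormedModType K) :=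
  Uniform_isComplete.Build (Lc E F) (banach_Lc (complete_banach (E := F))).

End CompleteInstances.

Section CompactSubspace.
Context {R : realType} {k : scalar_kind}.
Local Notation K := (scalars R k).
Variables (E : normedModType K) (F : completeNormedModType K).

Lemma Lb_compact0 : compact_map (0 : Lb E F).
Proof. exact: compact_map0. Qed.

Lemma Lb_compactP a (f g : Lb E F) : compact_map f -> compact_map g ->
  compact_map (a *: f + g : Lb E F).
Proof. exact: compact_mapP. Qed.

Lemma Lb_compact_closed : closed [set f : Lb E F | compact_map f].
Proof.
move=> f clf; apply: compact_map_closed => [|e e0]; first exact: complete_banach.
have [|g [gc fg]] := clf [set g | rnorm (f - g) < e].
  by apply/nbhs_rnorm; exists e.
exists g => // x; rewrite /unit_ball /= rnorm_le1 => x1.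
have := opnorm_bound x (Lb_bounded (f - g)); rewrite -rnorm_Lb => h.
have := rnorm_ge0 (f - g); have := rnorm_ge0 x; move: fg h => /=.
change (rnorm ((f - g)%R x)) with (rnorm (f x - g x)); nra.
Qed.

Definition compact_subspace : closed_subspace (Lb E F) :=
  ClosedSubspace Lb_compact0 Lb_compactP Lb_compact_closed.

Definition Lc_to_Lb (f : Lc E F) : Lb E F :=
  MkLb (introT (asboolP _) (Lc_bounded f)).

Definition Lb_to_Lc (f : Lb E F) : Lc E F := insubd 0 (f : E -> F).

Lemma Lb_to_LcK (f : Lb E F) : compact_map f -> Lc_to_Lb (Lb_to_Lc f) = f.
Proof.
move=> fc; apply: val_inj; apply: insubdK; apply/asboolP; split=> //.
exact: Lb_bounded.
Qed.

Lemma Lc_to_LbK (f : Lc E F) : Lb_to_Lc (Lc_to_Lb f) = f.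
Proof. by apply: val_inj; apply: insubdK; exact: Lc_prop. Qed.

Lemma Lc_to_LbB (f g : Lc E F) : rnorm (Lc_to_Lb f - Lc_to_Lb g) = rnorm (f - g).
Proof. by rewrite rnorm_Lb rnorm_Lc. Qed.

(** With a continuous section [s] of the quotient map [p], the operator [A] corresponds to
    the pair [(A - (s (p A) - s 0), p A)]; the term [s 0] makes a compact operator [A]
    correspond to [(A, 0)]. *)
Lemma compact_splitting :
  exists (Q : completeNormedModType K) (Phi : Lb E F -> Lc E F * Q) (Psi : Lc E F * Q -> Lb E F),
    [/\ cancel Phi Psi, cancel Psi Phi, forall A, (Phi A).2 = 0 <-> compact_map A,
      forall A (e : R), 0 < e -> exists2 d : R, 0 < d & forall B, rnorm (A - B) < d ->
        Num.max (rnorm ((Phi A).1 - (Phi B).1)) (rnorm ((Phi A).2 - (Phi B).2)) < e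
    & forall z (e : R), 0 < e -> exists2 d : R, 0 < d & forall z',
        Num.max (rnorm (z.1 - z'.1)) (rnorm (z.2 - z'.2)) < d ->
        rnorm (Psi z - Psi z') < e].
Proof.
have [Q [p [s [pl pn pker sP sc]]]] := quotient_section compact_subspace.
have pB := linear_funB pl; have pD := linear_funD pl.
pose r A := A - (s (p A) - s 0).
have rC A : compact_map (r A) by apply/pker; rewrite /r !pB !sP subr0 subrr.
exists Q, (fun A => (Lb_to_Lc (r A), p A)), (fun z => Lc_to_Lb z.1 + (s z.2 - s 0)).
split=> /=.
- by move=> A /=; rewrite Lb_to_LcK// subrK.
- move=> [f q] /=.
  have pf : p (Lc_to_Lb f) = 0 by apply/pker; exact: Lc_compact.
  have pP : p (Lc_to_Lb f + (s q - s 0)) = q by rewrite pD pf add0r pB !sP subr0.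
  by rewrite /r pP addrK Lc_to_LbK.
- exact: pker.
- move=> A e e0.
  have e2 : 0 < e / 2 by rewrite divr_gt0.
  have [d d0 dP] := sc (p A) _ e2.
  exists (Num.min d (e / 2)); first by rewrite lt_min d0.
  move=> B; rewrite lt_min => /andP[n1 n2].
  have n3 : rnorm (p A - p B) <= rnorm (A - B) by rewrite -pB; exact: pn.
  rewrite gt_max; apply/andP; split; last by move: n2 n3; lra.
  rewrite -(Lc_to_LbB (Lb_to_Lc (r A)) (Lb_to_Lc (r B))).
  have -> : Lc_to_Lb (Lb_to_Lc (r A)) - Lc_to_Lb (Lb_to_Lc (r B)) = r A - r B.
    by congr (_ - _); exact: Lb_to_LcK.
  have sAB : s (p A) - s 0 - (s (p B) - s 0) = s (p A) - s (p B).
    by rewrite opprB addrA subrK.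
  have -> : r A - r B = (A - B) - (s (p A) - s (p B)).
    rewrite -sAB /r; set u := s (p A) - _; set v := s (p B) - _.
    by rewrite (opprD B) addrACA -(opprD u).
  apply: (le_lt_trans (rnormD _ _)); rewrite rnormN.
  have := dP (p B) (le_lt_trans n3 n1); move: n2; lra.
- move=> z e e0; have e2 : 0 < e / 2 by rewrite divr_gt0.
  have [d d0 dP] := sc z.2 _ e2.
  exists (Num.min d (e / 2)); first by rewrite lt_min d0.
  move=> z'; rewrite gt_max !lt_min => /andP[/andP[_ n1] /andP[n2 _]].
  have -> : Lc_to_Lb z.1 + (s z.2 - s 0) - (Lc_to_Lb z'.1 + (s z'.2 - s 0)) =
      (Lc_to_Lb z.1 - Lc_to_Lb z'.1) + (s z.2 - s z'.2).
    by rewrite opprD addrACA; congr (_ + _); rewrite opprB addrA subrK.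
  apply: (le_lt_trans (rnormD _ _)); rewrite Lc_to_LbB.
  by have := dP _ n2; move: n1; lra.
Qed.

End CompactSubspace.

Section C0.
Context {R : realType} {k : scalar_kind} {H : hilbertType R k}.
Local Notation K := (scalars R k).

Lemma Grc_C0_submanifold (V : Gr H) : C0_submanifold (Grc V).
Proof.
move=> W VW.
have [Q [Phi [Psi [PhiK PsiK ker Phic Psic]]]] :=
  compact_splitting (subsp W) (subsp (orth W)).
have nEQ := nbhs_by_prod (@nbhs_rnorm R k (Lc (subsp W) (subsp (orth W))))
  (@nbhs_rnorm R k Q).
have [[cbij ccont _] gcont gK Kg] := homeo_chart W.
pose phi Y := Phi (chart W Y); pose g z := gr_of (Lb_bounded (Psi z)).
have phig z : phi (g z) = z by rewrite /phi /g Kg PsiK.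
have gphi Y : ball W 1 Y -> g (phi Y) = Y by move=> WY; rewrite /g /phi PhiK gK.
have gball z : ball W 1 (g z) by exact: gr_of_ball.
have phiT : phi @` ball W 1 = setT.
  by apply/seteqP; split=> [z _|z _]; [exact: I|exists (g z)].
have phic : {within ball W 1, continuous phi}.
  apply/(nbhs_by_within _ _ (@nbhs_gr_dist _ _ H) nEQ) => Y WY e e0.
  have [d d0 dP] := Phic (chart W Y) e e0.
  have [c c0 cP] := (nbhs_by_within _ _ (@nbhs_gr_dist _ _ H)
    (@nbhs_rnorm R k (Lb (subsp W) (subsp (orth W))))).1 ccont _ WY _ d0.
  exists c => // Y' WY' YY'; apply: dP; exact: cP.
have gc : {within setT, continuous g}.
  apply/(nbhs_by_within _ _ nEQ (@nbhs_gr_dist _ _ H)) => z _ e e0.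
  have [c c0 cP] := (nbhs_by_within _ _
    (@nbhs_rnorm R k (Lb (subsp W) (subsp (orth W)))) (@nbhs_gr_dist _ _ H)).1 gcont
    (Psi z) I _ e0.
  have [d d0 dP] := Psic z c c0.
  exists d => // z' _ zz'; apply: cP => //; exact: dP.
exists (Lc (subsp W) (subsp (orth W))), Q, (ball W 1), phi; split.
- by split; [exact: open_ball_gr|exact: ballxx].
- by rewrite phiT; exact: openT.
- rewrite phiT; split; [split| |].
  + by move=> Y _; exact: I.
  + by move=> Y Y' /set_mem WY /set_mem WY' YY'; rewrite -(gphi _ WY) -(gphi _ WY') YY'.
  + by move=> z _; exists (g z); [exact: gball|exact: phig].
  + exact: phic.
  + by exists g; [move=> Y /set_mem; exact: gphi|exact: gc].
- rewrite phiT setTI; apply/seteqP; split=> [_ [Y [WY VY] <-]|z /= z0].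
    apply/ker; rewrite chartE//; apply: graph_map_compact => //.
    exact/(Grc_diff _ VW).
  exists (g z); last exact: phig.
  split; first exact: gball.
  by apply: Grc_graph => //; apply/ker; rewrite PsiK.
Qed.

End C0.

(** * Slice charts of class C1 and projections *)

Lemma diff_quotient (R : realType) (E F : normedModType R) (f : E -> F) x v (e : R) :
  differentiable f x -> 0 < e -> exists2 d : R, 0 < d & forall t : R, 0 < t < d ->
    `|'d f x v - t^-1 *: (f (t *: v + x) - f x)| < e.
Proof.
move=> df e0; have := @diff_derivable _ _ _ f x v df.
rewrite /derivable => /cvg_ex[l fl].
have dl : 'd f x v = l by rewrite -deriveE//; exact: cvg_lim fl.
have : nbhs l [set y | `|l - y| < e] by apply/nbhs_real_norm; exists e.
move=> /fl; rewrite /= => /nbhs_ballP[d /= d0 dP]; exists d => // t /andP[t0 td].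
rewrite dl; apply: (dP t) => /=; last by rewrite lt0r_neq0.
by rewrite -ball_normE /= sub0r normrN gtr0_norm.
Qed.

Lemma between0_min (R : realType) (a b : R) : 0 < a -> 0 < b ->
  exists2 t : R, 0 < t & t < a /\ t < b.
Proof.
move=> a0 b0; pose m := Num.min a b.
have m0 : 0 < m by rewrite lt_min a0.
have m2 : m / 2 < m by rewrite ltr_pdivrMr// ltr_pMr// ltr1n.
exists (m / 2); first by rewrite divr_gt0.
by move: m2; rewrite {2}/m lt_min => /andP[].
Qed.

Lemma small_scale (R : realType) (E : normedModType R) (x : E) (e : R) : 0 < e ->
  exists2 d : R, 0 < d & forall t : R, 0 < t -> t < d -> `|t *: x| < e.
Proof.
move=> e0; have a0 : 0 < `|x| + 1 by rewrite ltr_wpDl.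
exists (e / (`|x| + 1)); first by rewrite divr_gt0.
move=> t t0; rewrite ltr_pdivlMr// normrZ gtr0_norm//; apply: le_lt_trans.
by rewrite ler_wpM2l ?(ltW t0)// lerDl.
Qed.

Section NotC1.
Context {R : realType} {k : scalar_kind} {H : hilbertType R k}.
Local Notation K := (scalars R k).

Lemma Grc_refl (V : Gr H) : Grc V V.
Proof.
rewrite /Grc /= (_ : (fun _ => _) = fun=> 0); first exact: compact_map0.
by apply/funext => x; rewrite subrr.
Qed.

(** Let [D1] be the differential at [V] of a slice chart, read in the chart of [Gr H], and
    let [D2] be that of its inverse. As limits of difference quotients taken in the
    submanifold, [D1 A] is in [E * {0}] for [A] compact, and [D2 (e, 0)] is compact. So [D2]
    after the projection onto [E * {0}] after [D1] projects onto the compact operators. *)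
Lemma C1_submanifold_projection (V : Gr H) : C1_submanifold (Grc V) ->
  exists (P : Lb (subsp V) (subsp (orth V)) -> Lb (subsp V) (subsp (orth V))) (C : R),
    [/\ {morph P : A B / A + B}, forall A, rnorm (P A) <= C * rnorm A,
      forall A : Lb _ _, compact_map (P A) & forall A : Lb _ _, compact_map A -> P A = A].
Proof.
move=> /(_ V (Grc_refl V))[E [F [U [phi [[[Uo UV] phio [phib phic [g gK gc]] phiM] compat]]]]].
have [[tau1 [df1 _] t1] [tau2 [df2 _] t2]] := compat V.
pose L := realify (Lb (subsp V) (subsp (orth V))).
have [[_ _ _] gcont gr_chart chart_gr] := homeo_chart V.
have chart0 : chart V V = 0.
  rewrite -[LHS]chart_gr -[RHS]chart_gr; congr chart.
  rewrite gr_chart; last exact: ballxx.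
  by apply/esym/gr_of0.
have UVD : (U `&` ball V 1) V by split=> //; exact: ballxx.
pose z0 := phi V.
have d1 : differentiable tau1 (0 : L) by apply: df1; exists V.
have d2 : differentiable tau2 z0 by apply: df2; exists V.
have t10 : tau1 0 = z0 by rewrite -chart0; apply: t1; exact: mem_set.
have t20 : tau2 z0 = 0 by rewrite -chart0; apply: t2; exact: mem_set.
have [r r0 rP] : exists2 r : R, 0 < r & forall A : L, `|A| < r ->
    (U `&` ball V 1) (gr_of (Lb_bounded A)).
  have /(@nbhs_gr_dist _ _ H)[e e0 eU] : nbhs V U by apply: open_nbhs_nbhs.
  have [d d0 dP] := (nbhs_by_within _ _ (@nbhs_rnorm R k (Lb (subsp V) (subsp (orth V))))
    (@nbhs_gr_dist _ _ H)).1 gcont 0 I e e0.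
  exists d => // A Ad; split; last exact: gr_of_ball.
  apply: eU.
  have := dP (A : Lb (subsp V) (subsp (orth V))) I; rewrite sub0r rnormN => /(_ Ad).
  by rewrite (gr_of0 (Lb_bounded (0 : Lb (subsp V) (subsp (orth V))))).
have t1P A : `|A : L| < r -> tau1 A = phi (gr_of (Lb_bounded A)).
  by move=> /rP UA; have := t1 _ (mem_set UA); rewrite /comp chart_gr.
have t21 A : `|A : L| < r -> tau2 (tau1 A) = A.
  move=> Ar; rewrite t1P//; have := t2 _ (mem_set (rP _ Ar)).
  by rewrite /comp chart_gr.
have [k1 k10 k1P] := linear_lipschitz (diff_continuous d1).
have [k2 k20 k2P] := linear_lipschitz (diff_continuous d2).
pose D1 : L -> E * F := 'd tau1 (0 : L); pose D2 : E * F -> L := 'd tau2 z0.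
have D21 A : D2 (D1 A) = A.
  have d21 : differentiable (tau2 \o tau1) (0 : L).
    by apply: differentiable_comp => //; rewrite t10.
  have -> : D2 (D1 A) = 'd (tau2 \o tau1) (0 : L) A.
    by rewrite diff_comp ?t10.
  apply/eqP; rewrite -subr_eq0 -normr_le0; apply/ler_addgt0Pl => e e0; rewrite addr0.
  have [d d0 dP] := diff_quotient A d21 e0.
  have [d' d'0 d'P] := small_scale A r0.
  have [t t0 [td td']] := between0_min d0 d'0.
  have := dP t; rewrite t0 td => /(_ isT).
  rewrite addr0 /= t10 t20 subr0 t21; last exact: d'P.
  by rewrite scalerA mulVf ?lt0r_neq0// scale1r => /ltW.
have D1D : {morph D1 : A B / A + B} by exact: linearD.
have D2D : {morph D2 : A B / A + B} by exact: linearD.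
have z02 : z0.2 = 0.
  have : (phi @` (U `&` Grc V)) z0 by exists V => //; split=> //; exact: Grc_refl.
  by rewrite phiM => -[].
have scalec (t : R) (A : L) : compact_map (A : Lb (subsp V) (subsp (orth V))) ->
    compact_map ((t *: A : L) : Lb (subsp V) (subsp (orth V))).
  by move=> Ac; exact: (csZ (S := compact_subspace (subsp V) (subsp (orth V))) (sofr t) Ac).
have D1c (A : L) : compact_map (A : Lb (subsp V) (subsp (orth V))) -> (D1 A).2 = 0.
  move=> Ac; apply/eqP; rewrite -normr_le0; apply/ler_addgt0Pl => e e0; rewrite addr0.
  have [d d0 dP] := diff_quotient A d1 e0.
  have [d' d'0 d'P] := small_scale A r0.
  have [t t0 [td td']] := between0_min d0 d'0.
  have := dP t; rewrite t0 td => /(_ isT).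
  have tr := d'P t t0 td'.
  have : (phi @` (U `&` Grc V)) (tau1 (t *: A)).
    rewrite t1P//; exists (gr_of (Lb_bounded (t *: A : L))) => //.
    split; first by have [] := rP _ tr.
    by apply: Grc_graph; [exact: Grc_refl|exact: scalec].
  rewrite phiM => -[_ /= t12].
  rewrite addr0 t10 prod_normE gt_max => /andP[_] /=.
  by rewrite t12 z02 subrr scaler0 subr0 => /ltW.
pose P (A : Lb (subsp V) (subsp (orth V))) : Lb (subsp V) (subsp (orth V)) :=
  D2 ((D1 A).1, 0).
exists P, (k2 * k1); split.
- move=> A B; rewrite /P D1D -D2D; congr (D2 _); congr pair.
  by rewrite /= addr0.
- move=> A; apply: (le_trans (k2P _)); rewrite -mulrA ler_wpM2l ?(ltW k20)//.
  apply: le_trans (k1P A); rewrite !prod_normE /= normr0 ge_max le_max lexx /=.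
  by rewrite le_max normr_ge0.
- move=> A; apply: (@Lb_compact_closed R k (subsp V) (subsp (orth V))).
  move=> B /nbhs_rnorm[e e0 eB].
  pose v : E * F := ((D1 A).1, 0).
  have [d d0 dP] := diff_quotient v d2 e0.
  have nE := nbhs_by_prod (@nbhs_real_norm R E) (@nbhs_real_norm R F).
  have phiz0 : (phi @` U) z0 by exists V.
  have /nE[a a0 aP] : nbhs z0 (phi @` U) by apply: open_nbhs_nbhs.
  have [b b0 bP] := (nbhs_by_within _ _ nE (@nbhs_gr_dist _ _ H)).1 gc z0 phiz0 1 ltr01.
  have ab0 : 0 < Num.min a b by rewrite lt_min a0.
  have [c c0 cP] := small_scale v.1 ab0.
  have [t t0 [td tc]] := between0_min d0 c0.
  pose w := t *: v + z0.
  have w2 : w.2 = 0 by rewrite /w /= scaler0 add0r.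
  have := cP t t0 tc; rewrite lt_min => /andP[wa wb].
  have zw (m : R) : 0 < m -> `|t *: v.1| < m ->
      Num.max `|z0.1 - w.1| `|z0.2 - w.2| < m.
    move=> m0 tm; rewrite w2 z02 subrr normr0 gt_max m0 andbT.
    by rewrite /w /= opprD addrCA subrr addr0 normrN.
  have phiw := aP w (zw a a0 wa).
  have [Y [UY VY] Yw] : (phi @` (U `&` Grc V)) w by rewrite phiM.
  have VY1 : gr_dist V Y < 1.
    have gw : g w = Y by rewrite -Yw; apply: gK; exact: mem_set.
    have gz : g z0 = V by apply: gK; exact: mem_set.
    by have := bP w phiw (zw b b0 wb); rewrite gw gz.
  exists ((t^-1 *: (tau2 w - tau2 z0) : L) : Lb (subsp V) (subsp (orth V))); split.
    apply: scalec; rewrite t20 subr0.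
    have <- : chart V Y = tau2 w by rewrite -Yw; apply/esym; apply: t2; exact: mem_set.
    rewrite chartE//; apply: graph_map_compact => //.
  by apply: eB; apply: dP; rewrite t0.
- move=> A Ac; rewrite -[RHS]D21 /P -(D1c _ Ac).
  by case: (D1 A).
Qed.

End NotC1.

(** * Diagonal operators *)

Section ScalarNets.
Context {R : realType}.

Lemma real_net (C e : R) : 0 < e ->
  exists s : seq R, forall c, `|c| <= C -> exists2 c', c' \in s & `|c - c'| < e.
Proof.
move=> e0.
have cC : @tbounded R RealScalars R^o [set c : R^o | `|c| <= C].
  apply: precompact_tbounded; apply: compact_precompact; first exact: norm_hausdorff.
  have -> : [set c : R^o | `|c| <= C] = `[- C, C]%classic.
    by apply/seteqP; split=> c /=; rewrite in_itv /= ler_norml.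
  exact: segment_compact.
by have [s sP] := cC e e0; exists s => c /sP.
Qed.

Lemma scalar_net (k : scalar_kind) (C e : R) : 0 < e ->
  exists s : seq (scalars R k), forall c, sre `|c| <= C ->
    exists2 c', c' \in s & sre `|c - c'| < e.
Proof.
move=> e0; case: k => /=; first exact: real_net.
have e2 : 0 < e / 2 by rewrite divr_gt0.
have [s sP] := real_net C e2.
exists [seq (x +i* y)%C | x <- s, y <- s] => -[a b] /= cC.
have aC : `|a| <= C.
  by apply: le_trans cC; rewrite -sqrtr_sqr ler_wsqrtr// lerDl sqr_ge0.
have bC : `|b| <= C.
  by apply: le_trans cC; rewrite -sqrtr_sqr ler_wsqrtr// lerDr sqr_ge0.
have [x xs ax] := sP _ aC; have [y ys bY] := sP _ bC.
exists (x +i* y)%C; first by apply/allpairsP; exists (x, y).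
apply: (@le_lt_trans _ _ (`|a - x| + `|b - y|)); last by rewrite [ltRHS]splitr ltrD.
rewrite -[leRHS]ger0_norm ?addr_ge0// -sqrtr_sqr ler_wsqrtr//.
have := sqr_ge0 (a - x); have := normr_ge0 (a - x); have := normr_ge0 (b - y).
by rewrite -(real_normK (num_real (a - x))) -(real_normK (num_real (b - y))); nra.
Qed.

End ScalarNets.

Section Orthonormal.
Context {R : realType} {k : scalar_kind} {H : hilbertType R k}.
Local Notation K := (scalars R k).
Implicit Types (V W : Gr H) (x y : H).

Lemma rank_one_compact (E F : normedModType K) (phi : E -> K) (C : R) (v : F) : banach F ->
  (forall x : E, unit_ball x -> sre `|phi x| <= C) -> compact_map (fun x : E => phi x *: v).
Proof.
move=> Fc phiC; apply: tbounded_precompact => // e e0.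
have v0 : 0 < rnorm v + 1 by rewrite ltr_wpDl ?rnorm_ge0.
have [s sP] := scalar_net k C (divr_gt0 e0 v0).
exists [seq c *: v | c <- s] => _ [x x1 <-].
have [c cs xc] := sP _ (phiC x x1).
exists (c *: v); first exact: map_f.
rewrite -scalerBl rnormZ; move: xc; rewrite ltr_pdivlMr//; apply: le_lt_trans.
by rewrite ler_wpM2l ?sre_ge0// lerDl.
Qed.

Definition orthonormal_seq (e : nat -> H) : Prop :=
  forall i j, inner (e i) (e j) = (i == j)%:R.

Lemma inner_suml (I : Type) (r : seq I) (c : I -> K) (e : I -> H) y :
  inner (\sum_(i <- r) c i *: e i) y = \sum_(i <- r) c i * inner (e i) y.
Proof.
elim: r => [|i r IH]; first by rewrite !big_nil inner0l.
by rewrite !big_cons innerP IH.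
Qed.

(** Gram-Schmidt: a finite orthonormal family of [W] does not span [W]. *)
Lemma orthonormal_exists W : ~ finite_dim (Gr_set W) ->
  exists2 e : nat -> H, orthonormal_seq e & forall n, W (e n).
Proof.
move=> Winf.
pose good (s : seq H) := (forall i, (i < size s)%N -> W s`_i) /\
  forall i j, (i < size s)%N -> (j < size s)%N -> inner s`_i s`_j = (i == j)%:R.
have /choice[ext extP] (s : seq H) : exists x, good s ->
    [/\ W x, inner x x = 1 & forall i, (i < size s)%N -> inner x s`_i = 0].
  have [[sW so]|ns] := pselect (good s); last by exists 0.
  have [w Ww wn] : exists2 w, W w & w - \sum_(i < size s) inner w s`_i *: s`_i != 0.
    apply: contrapT => no; apply: Winf; exists s => x Wx.
    exists (fun i : 'I_(size s) => inner x s`_i); apply/eqP.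
    rewrite -subr_eq0; apply/negPn/negP => xn; apply: no; by exists x.
  set z := w - _ in wn.
  have nz : 0 < rnorm z by rewrite rnorm_gt0.
  have zs i : (i < size s)%N -> inner z s`_i = 0.
    move=> si; rewrite /z innerBl inner_suml (bigD1 (Ordinal si))//= so// eqxx mulr1.
    rewrite big1 ?addr0 ?subrr// => j ji; rewrite so// [_ == i](_ : _ = false) ?mulr0//.
    by apply/negbTE.
  exists (sofr (rnorm z)^-1 *: z) => _; split.
  - apply: GrZ; apply: GrB => //.
    elim/big_ind: _ => [|x y|i _]; [exact: Gr0|exact: GrD|apply: GrZ; exact: sW].
  - by rewrite rnorm_inner rnormZr ger0_norm ?invr_ge0 ?(ltW nz)// mulVf ?lt0r_neq0// expr1n sofr1.
  - by move=> i si; rewrite innerZl zs// mulr0.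
pose s := fix s n := if n is n'.+1 then rcons (s n') (ext (s n')) else [::].
pose e n := ext (s n).
have size_s n : size (s n) = n by elim: n => //= n IH; rewrite size_rcons IH.
have s_nth n i : (i < n)%N -> (s n)`_i = e i.
  elim: n => // n IH; rewrite ltnS leq_eqVlt /= nth_rcons size_s => /orP[/eqP ->|/[dup] ni ->].
    by rewrite ltnn eqxx.
  exact: IH.
have s_good n : good (s n).
  elim: n => [|n gn]; first by split.
  have [eW e1 eo] := extP _ gn; move: gn => [nW no].
  rewrite size_s in eo nW no.
  split; rewrite size_s => i.
    by rewrite ltnS leq_eqVlt => /orP[/eqP ->|/[dup] ni /nW]; rewrite !s_nth// ltnW.
  move=> j; rewrite ltnS leq_eqVlt => /orP[/eqP ->|ni]; rewrite ltnS leq_eqVlt => /orP[/eqP ->|nj].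
  - by rewrite s_nth// eqxx.
  - by rewrite !s_nth ?(ltn_trans nj)// -(s_nth n j nj) [inner _ _]eo// gtn_eqF.
  - rewrite !s_nth ?(ltn_trans ni)// -(s_nth n i ni) [inner _ _](inner_eq0C (eo _ ni)).
    by rewrite ltn_eqF.
  - by have := no i j ni nj; rewrite (s_nth n i) // (s_nth n j) // !s_nth ?ltnS ?(ltnW ni) ?(ltnW nj).
exists e => [i j|n].
  have [_] := s_good (maxn i j).+1; rewrite size_s => /(_ i j).
  rewrite !ltnS leq_maxl leq_maxr => /(_ isT isT).
  by rewrite !s_nth ?ltnS ?leq_maxl ?leq_maxr.
by have [+ _] := s_good n.+1; rewrite size_s => /(_ n (ltnSn n)); rewrite s_nth.
Qed.

End Orthonormal.

Section Diagonal.
Context {R : realType} {k : scalar_kind} {H : hilbertType R k}.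
Local Notation K := (scalars R k).
Implicit Types (x y : H).

Section Bessel.
Variable e : nat -> H.
Hypothesis eo : orthonormal_seq e.

Lemma rnorm_orthonormal n : rnorm (e n) = 1.
Proof.
have := rnorm_inner (e n); rewrite eo eqxx => /(congr1 sre).
rewrite -[X in sre X](sofr1 (k := k)) !sofrK => /esym/eqP.
by rewrite sqrf_eq1 => /orP[/eqP//|/eqP en]; have := rnorm_ge0 (e n); rewrite en; lra.
Qed.

Lemma rnorm_sum_orthonormal (c : nat -> K) m n :
  rnorm (\sum_(m <= i < n) c i *: e i) ^+ 2 = \sum_(m <= i < n) (sre `|c i|) ^+ 2.
Proof.
have [mn|nm] := leqP m n; last first.
  by rewrite !big_geq ?(ltnW nm)// rnorm0 expr0n.
rewrite -(subnK mn); elim: (n - m)%N => [|d IH].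
  by rewrite add0n !big_geq// rnorm0 expr0n.
rewrite addSn !big_nat_recr ?leq_addl//= rpythagoras.
  by rewrite IH rnormZ rnorm_orthonormal mulr1.
rewrite innerZr inner_suml big_nat big1 ?mulr0// => i /andP[_ id].
by rewrite eo ltn_eqF// mulr0.
Qed.

Lemma bessel x n : \sum_(0 <= i < n) (sre `|inner x (e i)|) ^+ 2 <= rnorm x ^+ 2.
Proof.
rewrite -rnorm_sum_orthonormal; set y := \sum_(_ <= i < _) _.
have zy j : (j < n)%N -> inner (x - y) (e j) = 0.
  move=> jn; rewrite innerBl /y inner_suml big_mkord (bigD1 (Ordinal jn))//= eo eqxx mulr1.
  rewrite big1 ?addr0 ?subrr// => i ij; rewrite eo [_ == j](_ : _ = false) ?mulr0//.
  exact/negbTE.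
have xy : inner (x - y) y = 0.
  apply: inner_eq0C; rewrite {1}/y inner_suml big_nat big1// => j /andP[_ jn].
  by rewrite (inner_eq0C (zy j jn)) mulr0.
by have := rpythagoras xy; rewrite subrK => ->; rewrite lerDr exprn_ge0// rnorm_ge0.
Qed.

End Bessel.

Variables (e f : nat -> H).
Hypotheses (eo : orthonormal_seq e) (fo : orthonormal_seq f).

Definition diag_sum (b : nat -> R) (n : nat) x : H :=
  \sum_(0 <= i < n) (sofr (b i) * inner x (e i)) *: f i.

Lemma diag_sum_bound b (B : R) x m n : (forall i, `|b i| <= B) -> (m <= n)%N ->
  rnorm (diag_sum b n x - diag_sum b m x) ^+ 2 <=
    B ^+ 2 * \sum_(m <= i < n) (sre `|inner x (e i)|) ^+ 2.
Proof.
move=> bB mn; rewrite /diag_sum (@big_cat_nat _ _ _ m 0 n)//= addrAC subrr add0r.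
rewrite (rnorm_sum_orthonormal fo (fun i => sofr (b i) * inner x (e i))).
rewrite mulr_sumr; apply: ler_sum => i _.
rewrite normrM sreM// rnorm_sofr exprMn ler_wpM2r ?exprn_ge0 ?sre_ge0//.
by rewrite lerXn2r ?nnegrE ?(le_trans _ (bB i)).
Qed.

Lemma diag_sumP b n a x y : diag_sum b n (a *: x + y) = a *: diag_sum b n x + diag_sum b n y.
Proof.
rewrite /diag_sum scaler_sumr -big_split; apply: eq_bigr => i _ /=.
by rewrite innerP mulrDr scalerDl scalerA; congr (_ *: _ + _); ring.
Qed.

Lemma diag_sumD b b' n x :
  diag_sum (fun i => b i + b' i) n x = diag_sum b n x + diag_sum b' n x.
Proof.
rewrite /diag_sum -big_split; apply: eq_bigr => i _ /=.
by rewrite sofrD mulrDl scalerDl.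
Qed.

Lemma diag_sumN b n x : diag_sum (fun i => - b i) n x = - diag_sum b n x.
Proof.
rewrite /diag_sum -sumrN; apply: eq_bigr => i _ /=.
by rewrite sofrN mulNr scaleNr.
Qed.

Lemma diag_sum_norm b (B : R) x n : (forall i, `|b i| <= B) ->
  rnorm (diag_sum b n x) <= B * rnorm x.
Proof.
move=> bB; have B0 : 0 <= B by exact: le_trans (bB 0%N).
rewrite -ler_sqr ?nnegrE ?mulr_ge0 ?rnorm_ge0// exprMn.
have := diag_sum_bound x bB (leq0n n).
rewrite {2}/diag_sum big_geq// subr0 => /le_trans; apply.
by rewrite ler_wpM2l ?exprn_ge0// bessel.
Qed.

Lemma diag_sum_cvg b (B : R) x : (forall i, `|b i| <= B) ->
  cvg ((fun n => diag_sum b n x) @ \oo).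
Proof.
move=> bB; have B0 : 0 <= B by exact: le_trans (bB 0%N).
apply: cauchy_cvg; apply: cauchy_exP => eps eps0.
pose r := sre eps / (B + 1); have B1 : 0 < B + 1 by lra.
have r0 : 0 < r by rewrite divr_gt0// sre_gt0.
pose S := range (fun n => \sum_(0 <= i < n) (sre `|inner x (e i)|) ^+ 2).
have S0 : S !=set0 by exists (\sum_(0 <= i < 0) (sre `|inner x (e i)|) ^+ 2), 0%N.
have Sub : has_ubound S by exists (rnorm x ^+ 2) => _ [n _ <-]; exact: bessel.
have [_ [N _ <-] NS] := sup_adherent (exprn_gt0 2 r0) (conj S0 Sub).
exists (diag_sum b N x), N => // M /= NM.
rewrite -ball_normE /= -sofr_rnorm -(sofr_sre (ltW eps0)) ltr_sofr rnormB.
rewrite -ltr_sqr ?nnegrE ?rnorm_ge0 ?sre_ge0 ?(ltW eps0)//.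
apply: (le_lt_trans (diag_sum_bound x bB NM)).
have : \sum_(0 <= i < M) (sre `|inner x (e i)|) ^+ 2 <= sup S.
  by apply: ub_le_sup => //; exists M.
rewrite (@big_cat_nat _ _ _ N 0 M)//= => le1.
have tail : \sum_(N <= i < M) (sre `|inner x (e i)|) ^+ 2 <= r ^+ 2 by lra.
apply: (le_lt_trans (ler_wpM2l (exprn_ge0 2 B0) tail)).
have -> : sre eps = (B + 1) * r by rewrite /r mulrC divfK// lt0r_neq0.
rewrite [ltRHS]exprMn ltr_pM2r ?exprn_gt0//; nra.
Qed.

Lemma diag_sum_compact b n (V : Gr H) :
  compact_map (fun x : subsp V => diag_sum b n x).
Proof.
have Hc : banach H := @complete_banach _ _ H.
elim: n => [|n IH].
  rewrite (_ : (fun _ => _) = fun=> 0); first exact: compact_map0.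
  by apply/funext => x; rewrite /diag_sum big_geq.
rewrite (_ : (fun _ => _) = fun x : subsp V => diag_sum b n x +
    (sofr (b n) * inner (x : H) (e n)) *: f n); last first.
  by apply/funext => x; rewrite /diag_sum big_nat_recr.
apply: compact_mapD => //.
apply: (@rank_one_compact R k _ _ (fun x : subsp V => sofr (b n) * inner (x : H) (e n)) `|b n|) => //.
move=> x; rewrite /unit_ball /= rnorm_le1 => x1.
rewrite normrM sreM// rnorm_sofr -[leRHS]mulr1 ler_wpM2l//.
apply: (le_trans (rcauchy_schwarz _ _)); rewrite rnorm_orthonormal// mulr1.
exact: x1.
Qed.

Variable V : Gr H.
Hypothesis fV : forall n, orth V (f n).
Local Notation L := (Lb (subsp V) (subsp (orth V))).

Lemma diag_sum_orth b n x : orth V (diag_sum b n x).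
Proof.
rewrite /diag_sum; elim/big_ind: _ => [|u v|i _].
- exact: Gr0.
- exact: GrD.
- exact: GrZ.
Qed.

(** [A] is the sum, for the strong topology, of the operators [b i <., e i> f i]. *)
Definition is_diag (b : nat -> R) (A : L) : Prop :=
  forall x : subsp V, (fun n => diag_sum b n x) @ \oo --> (A x : H).

Lemma cvg_rnorm_le (u : nat -> H) (l : H) (C : R) :
  u @ \oo --> l -> (forall n, rnorm (u n) <= C) -> rnorm l <= C.
Proof.
move=> ul uC; apply/ler_addgt0Pr => d d0.
have : nbhs l [set y | rnorm (l - y) < d] by apply/nbhs_rnorm; exists d.
move=> /ul[N _ /(_ N (leqnn N))/= lN].
have := rnormD (l - u N) (u N); rewrite subrK; have := uC N; lra.
Qed.

Lemma is_diag_norm b (B : R) A : is_diag b A -> (forall i, `|b i| <= B) -> rnorm A <= B.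
Proof.
move=> bA bB; rewrite rnorm_Lb; apply: opnorm_lebound => [|x].
  exact: le_trans (bB 0%N).
rewrite rnorm_subsp; apply: (cvg_rnorm_le (bA x)) => n; exact: diag_sum_norm.
Qed.

Lemma is_diag_uniq b A A' : is_diag b A -> is_diag b A' -> A = A'.
Proof.
move=> bA bA'; apply: val_inj; apply/funext => x; apply: subsp_inj.
exact: (cvg_unique (@norm_hausdorff _ H) (bA x) (bA' x)).
Qed.

Lemma is_diagD b b' A A' : is_diag b A -> is_diag b' A' ->
  is_diag (fun i => b i + b' i) (A + A').
Proof.
move=> bA bA' x; under eq_fun do rewrite diag_sumD.
exact: (cvgD (bA x) (bA' x)).
Qed.

Lemma is_diagN b A : is_diag b A -> is_diag (fun i => - b i) (- A).
Proof.
move=> bA x; under eq_fun do rewrite diag_sumN.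
exact: (cvgN (bA x)).
Qed.

Lemma is_diag0 : is_diag (fun=> 0) 0.
Proof.
move=> x; apply: cvg_near_cst; exists 0%N => // n _.
by rewrite /diag_sum big1// => i _; rewrite sofr0 mul0r scale0r.
Qed.

Lemma diag_exists b (B : R) : (forall i, `|b i| <= B) -> exists A, is_diag b A.
Proof.
move=> bB.
have /choice[D Dc] (x : subsp V) : exists l : H, (fun n => diag_sum b n x) @ \oo --> l.
  by have /cvg_ex := diag_sum_cvg (x := x) bB.
have DV (x : subsp V) : orth V (D x).
  apply: (Gr_closed (g := orth V)) => U /Dc[N _ /(_ N (leqnn N)) UN].
  by exists (diag_sum b N x); split=> //; exact: diag_sum_orth.
pose D' (x : subsp V) : subsp (orth V) := MkSubsp (mem_set (DV x)).
have [|A AE] := @Lb_in R k _ _ D'.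
  apply: (@bounded_linear_of _ _ _ _ _ B) => [a x y|x].
    apply: subsp_inj; apply: (cvg_unique (@norm_hausdorff _ H) (Dc _)).
    have -> : (fun n => diag_sum b n (a *: x + y)%R) =
        fun n => a *: diag_sum b n x + diag_sum b n y.
      by apply/funext => n; exact: diag_sumP.
    by apply: cvgD; [apply: cvgZr|]; exact: Dc.
  by rewrite rnorm_subsp; apply: (cvg_rnorm_le (Dc x)) => n; exact: diag_sum_norm.
by exists A => x; rewrite AE; exact: Dc.
Qed.

Lemma is_diag_finite b A M : is_diag b A -> (forall i, (M <= i)%N -> b i = 0) ->
  compact_map A.
Proof.
move=> bA b0.
have AE (x : subsp V) : diag_sum b M x = A x.
  apply: (cvg_unique (@norm_hausdorff _ H) _ (bA x)).
  apply: cvg_near_cst; exists M => // n /= Mn.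
  rewrite /diag_sum (@big_cat_nat _ _ _ M 0 n)//= [X in _ + X]big_nat.
  by rewrite [X in _ + X]big1 ?addr0// => i /andP[/b0 -> _]; rewrite sofr0 mul0r scale0r.
have -> : (A : subsp V -> subsp (orth V)) = orthprojS (orth V) \o (fun x : subsp V => diag_sum b M x).
  by apply/funext => x; rewrite /= AE orthprojSK.
apply: compact_map_postcomp; [exact: banach_subsp|exact: diag_sum_compact|].
exact: orthprojS_bounded.
Qed.

Lemma is_diag_coef b A n (en : subsp V) : is_diag b A -> en = e n :> H ->
  inner (A en : H) (f n) = sofr (b n).
Proof.
move=> bA enE; suff -> : (A en : H) = sofr (b n) *: f n.
  by rewrite innerZl fo eqxx mulr1.
apply: (cvg_unique (@norm_hausdorff _ H) (bA en)).
apply: cvg_near_cst; exists n.+1 => // m /= nm.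
rewrite /diag_sum enE big_mkord (bigD1 (Ordinal nm))//= eo eqxx mulr1.
rewrite big1 ?addr0// => i ij; rewrite eo [_ == _](_ : _ = false) ?mulr0 ?scale0r//.
by rewrite eq_sym; apply/negbTE.
Qed.

End Diagonal.

(** * The compact operators are not complemented *)

(** The branches of the binary tree [seq bool] form an uncountable almost disjoint
    family of infinite sets of integers. *)
Section Branches.

Definition code (phi : nat -> bool) (m : nat) : nat := choice.pickle (mkseq phi m).

Definition branch (phi : nat -> bool) (j : nat) : Prop := exists m, j = code phi m.

Lemma code_eq phi psi m n : code phi m = code psi n ->
  m = n /\ forall i, (i < m)%N -> phi i = psi i.
Proof.
move=> /(pcan_inj (@choice.pickleK _)) pq.
have mn : m = n by rewrite -(size_mkseq phi m) pq size_mkseq.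
split=> // i im; rewrite -mn in pq.
by rewrite -(nth_mkseq false phi im) pq nth_mkseq.
Qed.

Lemma branch_disjoint phi psi : phi <> psi ->
  exists M, forall j, (M <= j)%N -> branch phi j -> branch psi j -> False.
Proof.
move=> pq; have [k pqk] : exists k, phi k <> psi k.
  by apply: contrapT => no; apply: pq; apply/funext => k; apply: contrapT => nk; apply: no; exists k.
exists (\max_(m < k.+1) code phi m).+1 => j Mj [m jm] [n jn].
have [_ pqm] : m = n /\ forall i, (i < m)%N -> phi i = psi i.
  by apply: code_eq; rewrite -jm.
have mk : (m < k.+1)%N by rewrite ltnNge; apply/negP => /pqm.
have := @leq_bigmax _ (fun m : 'I_k.+1 => code phi m) (Ordinal mk); rewrite /= -jm leqNgt.
by rewrite Mj.
Qed.

Lemma uncountable_branches (B : set (nat -> bool)) : countable B -> exists phi, ~ B phi.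
Proof.
move=> /countable_injP[h hinj]; apply: contrapT => no.
have all phi : B phi by apply: contrapT => nB; apply: no; exists phi.
pose psi n := ~~ (xget (fun=> false) [set phi | h phi = n]) n.
have : psi (h psi) = ~~ psi (h psi).
  rewrite {1}/psi; congr (~~ (_ _)).
  case: xgetP => [phi _ /= hphi|none]; last by case: (none psi).
  by apply: hinj => //; apply: mem_set.
have nb (c : bool) : c <> ~~ c by case: c.
exact: nb.
Qed.

End Branches.

Section Whitley.
Context {R : realType} {k : scalar_kind} {H : hilbertType R k}.
Local Notation K := (scalars R k).

Definition chi (phi : nat -> bool) (j : nat) : R := `[< branch phi j >]%:R.

Lemma chi_ge0 phi j : 0 <= chi phi j.
Proof. exact: ler0n. Qed.

Lemma chi_le1 phi j : chi phi j <= 1.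
Proof. by rewrite /chi lern1; case: asboolP. Qed.

Lemma chi_code phi m : chi phi (code phi m) = 1.
Proof. by rewrite /chi asboolT//; exists m. Qed.

Lemma chi_sum_le1 (s : seq (nat -> bool)) : uniq s ->
  exists M, forall j, (M <= j)%N -> \sum_(phi <- s) chi phi j <= 1.
Proof.
move=> us.
have /choice[M MP] (pq : (nat -> bool) * (nat -> bool)) : exists M, pq.1 <> pq.2 ->
    forall j, (M <= j)%N -> branch pq.1 j -> branch pq.2 j -> False.
  have [e|/branch_disjoint[M MP]] := pselect (pq.1 = pq.2); first by exists 0%N.
  by exists M.
exists (\max_(pq <- [seq (p, q) | p <- s, q <- s]) M pq) => j Mj.
have [[phi [phis bphi]]|no] := pselect (exists phi, phi \in s /\ branch phi j); last first.
  rewrite big_seq big1 // => phi phis; rewrite /chi asboolF// => b; apply: no.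
  by exists phi.
rewrite (bigD1_seq phi)//= big_seq_cond big1 ?addr0 ?chi_le1// => psi /andP[psis pp].
rewrite /chi asboolF// => bpsi.
apply: (MP (phi, psi) _ j) => //=; first by apply/eqP; rewrite eq_sym.
apply: leq_trans Mj; apply: leq_bigmax_seq => //.
by apply/allpairsP; exists (phi, psi).
Qed.

Variable V : Gr H.
Hypotheses (Vinf : ~ finite_dim (Gr_set V)) (Vcoinf : ~ finite_codim (Gr_set V)).
Local Notation L := (Lb (subsp V) (subsp (orth V))).

Lemma orth_infinite : ~ finite_dim (Gr_set (orth V)).
Proof.
move=> [s sP]; apply: Vcoinf; exists s => x.
exists (orthproj V x); first exact: proj_in.
have [c cE] := sP _ (proj_in (orth V) x).
by exists c; rewrite -cE -proj_split.
Qed.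

(** Whitley's argument. Let [T phi] be the diagonal operator whose coefficients are the
    characteristic function of the branch [phi]. The functional [g n] that gives the [n]-th
    diagonal coefficient of [A - P A] is bounded and vanishes on the compact operators. As
    the branches are almost disjoint, a signed sum of finitely many [T phi] has norm at most
    1 up to a compact operator; so, for each [n], [g n (T phi)] is nonzero for only countably
    many [phi]. Hence there is [phi] for which they all vanish, and [P (T phi)] is then a compact operator with
    infinitely many diagonal coefficients equal to 1, which contradicts Bessel's
    inequality. *)
Lemma no_projection (P : L -> L) (C : R) : {morph P : A B / A + B} ->
  (forall A, rnorm (P A) <= C * rnorm A) -> (forall A : L, compact_map (P A)) ->
  (forall A : L, compact_map A -> P A = A) -> False.
Proof.
move=> PD PC Pc Pid.
have [e eo eV] := orthonormal_exists Vinf.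
have [f fo fV] := orthonormal_exists orth_infinite.
have /choice[en enE] n : exists v : subsp V, v = e n :> H by exact: subsp_in.
pose g n (A : L) : R := sre (inner ((A (en n) : H) - (P A (en n) : H)) (f n)).
have gD n A B : g n (A + B) = g n A + g n B.
  rewrite /g PD -sreD -innerDl; congr (sre (inner _ _)).
  by rewrite addrACA -opprD.
have g0 n (A : L) : compact_map A -> g n A = 0.
  move=> /Pid PA; rewrite /g PA subrr inner0l.
  by rewrite -[X in sre X](sofr0 (k := k)) sofrK.
have gN n A : g n (- A) = - g n A.
  apply/eqP; rewrite -addr_eq0 -gD addNr g0//; exact: compact_map0.
pose C' := 1 + `|C|.
have gC n A : `|g n A| <= C' * rnorm A.
  apply: (le_trans (sre_norm _)); apply: (le_trans (rcauchy_schwarz _ _)).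
  rewrite (rnorm_orthonormal fo) mulr1.
  have := opnorm_bound (en n) (Lb_bounded (A - P A)).
  rewrite !rnorm_subsp -rnorm_Lb enE (rnorm_orthonormal eo) mulr1.
  move=> /le_trans; apply; apply: (le_trans (rnormD _ _)); rewrite rnormN mulrDl mul1r lerD2l.
  by apply: (le_trans (PC A)); rewrite ler_wpM2r ?rnorm_ge0// ler_norm.
have /choice[T TP] phi : exists A : L, is_diag e f (chi phi) A.
  by apply: (diag_exists eo fo fV (B := 1)) => i; rewrite ger0_norm ?chi_ge0 ?chi_le1.
pose sg n phi (x : R) : R := if 0 <= g n (T phi) then x else - x.
have sumT n (s : seq (nat -> bool)) : exists2 A : L,
    is_diag e f (fun j => \sum_(phi <- s) sg n phi (chi phi j)) A &
    g n A = \sum_(phi <- s) `|g n (T phi)|.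
  elim: s => [|phi s [A dA gA]].
    exists 0; last by rewrite big_nil g0//; exact: compact_map0.
    by under eq_fun do rewrite big_nil; exact: is_diag0.
  exists ((if 0 <= g n (T phi) then T phi else - T phi) + A); last first.
    rewrite big_cons gD gA; congr (_ + _).
    by case: ifPn => [/ger0_norm//|]; rewrite -ltNge => /ltr0_norm ->; rewrite gN.
  have dT : is_diag e f (fun j => sg n phi (chi phi j))
      (if 0 <= g n (T phi) then T phi else - T phi).
    by rewrite /sg; case: ifPn => _; [exact: TP|exact: is_diagN].
  by under eq_fun do rewrite big_cons; exact: is_diagD dT dA.
(* The coefficients of the sum [A] are split at [M]: [A2] has finitely many nonzero
   ones, and those of [A1] are bounded by 1. *)
have sum_le n (s : seq (nat -> bool)) : uniq s -> \sum_(phi <- s) `|g n (T phi)| <= C'.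
  move=> us; have [A dA <-] := sumT n s.
  have [M MP] := chi_sum_le1 us.
  set b := (fun j => _) in dA.
  have bj j : `|b j| <= \sum_(phi <- s) chi phi j.
    rewrite /b; apply: (le_trans (ler_norm_sum _ _ _)); apply: ler_sum => phi _.
    by rewrite /sg; case: ifP => _; rewrite ?normrN ger0_norm ?chi_ge0.
  have [|A1 dA1] := @diag_exists _ _ _ _ _ eo fo V fV (fun j => if (j < M)%N then 0 else b j) 1.
    move=> j; case: ltnP => [|Mj]; first by rewrite normr0.
    exact: le_trans (bj j) (MP j Mj).
  have A1n : rnorm A1 <= 1.
    apply: (is_diag_norm eo fo dA1) => j; case: ltnP => [|Mj]; first by rewrite normr0.
    exact: le_trans (bj j) (MP j Mj).
  have [|A2 dA2] := @diag_exists _ _ _ _ _ eo fo V fV (fun j => if (j < M)%N then b j else 0) (size s)%:R.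
    move=> j; case: ifP => _; last by rewrite normr0.
    apply: (le_trans (bj j)); apply: (@le_trans _ _ (\sum_(phi <- s) 1)).
      by apply: ler_sum => phi _; exact: chi_le1.
    by rewrite big_const_seq count_predT iter_addr addr0.
  have A2c : compact_map A2.
    by apply: (is_diag_finite eo (M := M) dA2) => j Mj; rewrite ltnNge Mj.
  have -> : A = A1 + A2.
    apply: is_diag_uniq dA _; have := is_diagD dA1 dA2.
    rewrite (_ : (fun j => _ + _) = b)//; apply/funext => j.
    by case: ifP; rewrite ?add0r ?addr0.
  rewrite gD (g0 n A2 A2c) addr0; apply: (le_trans (ler_norm _)); apply: (le_trans (gC n A1)).
  by rewrite -[leRHS]mulr1 ler_wpM2l// addr_ge0.
have fin n m : finite_set [set phi | hpow m <= `|g n (T phi)|].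
  apply: contrapT => /infinite_set_fset inf.
  have [B BP Bs] := inf (Num.truncn (C' / hpow m)).+1.
  have := sum_le n _ (fset_uniq B); apply/negP; rewrite -ltNge.
  apply: (@lt_le_trans _ _ (\sum_(phi <- B) hpow m)).
    rewrite big_const_seq count_predT iter_addr addr0 -mulr_natl -ltr_pdivrMr ?hpow_gt0//.
    by apply: (lt_le_trans (truncnS_gt _)); rewrite ler_nat.
  by rewrite big_seq [leRHS]big_seq; apply: ler_sum => phi phiB; exact: BP.
have [phi phiP] : exists phi, forall n, g n (T phi) = 0.
  have cB : countable (\bigcup_(nm in [set: nat * nat]) [set phi | hpow nm.2 <= `|g nm.1 (T phi)|]).
    by apply: bigcup_countable => // nm _; exact/finite_set_countable/fin.
  have [phi nphi] := uncountable_branches cB; exists phi => n.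
  apply/eqP; apply/negPn/negP => gn; apply: nphi.
  have gn0 : 0 < `|g n (T phi)| by rewrite normr_gt0.
  have [m me] := hpow_small gn0.
  by exists (n, m) => //=; exact: ltW.
(* On the branch [phi], the compact operator [P (T phi)] has diagonal coefficients 1. *)
have coef m : 1 <= sre `|inner (P (T phi) (en (code phi m)) : H) (f (code phi m))|.
  have := phiP (code phi m); rewrite /g innerBl sreD sreN (is_diag_coef eo fo (TP phi) (enE _)).
  rewrite chi_code sofrK => /eqP; rewrite subr_eq0 => /eqP {1}->.
  exact: le_trans (ler_norm _) (sre_norm _).
have half0 : 0 < 2^-1 :> R by rewrite invr_gt0.
have [s sP] := compact_map_tbounded (Pc (T phi)) half0.
pose f' m := f (code phi m).
have fo' : orthonormal_seq f'.
  move=> i j; rewrite fo; congr (_%:R); congr nat_of_bool.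
  by apply/eqP/eqP => [/code_eq[]|->].
pose S := \sum_(c <- s) rnorm c ^+ 2.
pose N := (Num.truncn (4 * S)).+1.
have NS : 4 * S < N%:R by exact: truncnS_gt.
have le1 : \sum_(c <- s) \sum_(0 <= m < N) (sre `|inner (c : H) (f' m)|) ^+ 2 <= S.
  by apply: ler_sum => c _; exact: bessel fo' c N.
have : \sum_(0 <= m < N) (4^-1 : R) <=
    \sum_(0 <= m < N) \sum_(c <- s) (sre `|inner (c : H) (f' m)|) ^+ 2.
  apply: ler_sum => m _.
  have [|c cs xc] := sP (P (T phi) (en (code phi m))).
    exists (en (code phi m)) => //; rewrite /unit_ball /= rnorm_le1 rnorm_subsp enE.
    by rewrite (rnorm_orthonormal eo).
  rewrite (big_rem c)//=; apply: ler_wpDr.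
    by apply: sumr_ge0 => d _; rewrite exprn_ge0// sre_ge0.
  have := coef m; set x := (P (T phi) _ : H) in xc *.
  have -> : inner x (f (code phi m)) = inner (x - (c : H)) (f' m) + inner (c : H) (f' m).
    by rewrite innerBl subrK.
  have := ler_sre (ler_normD (inner (x - (c : H)) (f' m)) (inner (c : H) (f' m))); rewrite sreD.
  have := rcauchy_schwarz (x - (c : H)) (f' m); rewrite (rnorm_orthonormal fo') mulr1.
  move: xc; rewrite rnorm_subsp subspB -/x.
  set y := sre `|inner (c : H) _| => h1 h2 h3 h4.
  have : 2^-1 <= y by lra.
  by move=> yh; nra.
rewrite exchange_big /= => /le_trans/(_ le1).
rewrite big_const_nat subn0 iter_addr addr0 -mulr_natl; lra.
Qed.

End Whitley.

Theorem mainTheorem5 (R : realType) (k : scalar_kind) (H : hilbertType R k)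
    (Hsep : separable_space H) (Hinf : ~ finite_dim [set: H]) (V : Gr H) :
  [/\ forall W : Gr H, Grc V W ->
        (forall Y : Gr H, ball W 1 Y -> Grc V Y ->
           [/\ set_bij (Gr_set Y) (Gr_set W) (orthproj W),
               bounded_linear (graph_map W Y)
             & compact_map (graph_map W Y)]) /\
        homeo_on (ball W 1 `&` Grc V)
          [set: Lc (subsp W) (subsp (orth W))] (chartc W),
      analytic_atlas (Grc V) (Grc V)
        (fun W : Gr H => Lc (subsp W) (subsp (orth W)))
        (fun W : Gr H => ball W 1 `&` Grc V) chartc
    & ~ finite_dim (Gr_set V) -> ~ finite_codim (Gr_set V) ->
        C0_submanifold (Grc V) /\ ~ C1_submanifold (Grc V)].
Proof.
split; first by move=> W; exact: Grc_charts.
  exact: Grc_atlas.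
move=> Vinf Vcoinf; split; first exact: Grc_C0_submanifold.
move=> /C1_submanifold_projection[P [C [PD PC Pc Pid]]].
exact: (no_projection Vinf Vcoinf PD PC Pc Pid).
Qed.
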